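(* Let $$V_1=\{(T,T,-T,-T,B)\mid B=T^2-\eta_2T,\ T\in\mathbb{C}\},$$ $$V_2=\{(T,-T,T,-T,B)\mid B=T^2-\eta_1T,\ T\in\mathbb{C}\},$$ $$V_3=\{(T,-T,-T,T,B)\mid B=T^2,\ T\in\mathbb{C}\}.$$ Then $AP=\bigcup_{i=1}^3V_i$. In particular, $AP$ has exactly one singular point $(0,0,0,0,0)$.
   Context: Let $\tau\in\mathbb{C}$ with $\mathrm{Im}\,\tau>0$, $\Lambda_\tau=\mathbb{Z}+\mathbb{Z}\tau$; $\wp,\zeta$ are the Weierstrass functions of $\Lambda_\tau$ ($\zeta'=-\wp$, $\zeta$ odd). Put $\omega_0=0,\omega_1=1,\omega_2=\tau,\omega_3=1+\tau$ and $\eta_i=\zeta(z+\omega_i)-\zeta(z)$ for $i=1,2,3$. For $(T_0,T_1,T_2,T_3,B)\in\mathbb{C}^5$ with $\sum_{k=0}^3T_k=0$ consider the equation $y''(z)=q(z)y(z)$ with $$q(z)=\tfrac34\sum_{k=0}^3\wp(z-\tfrac{\omega_k}{2})+\sum_{k=0}^3T_k\zeta(z-\tfrac{\omega_k}{2})+B.$$ $AP\subset\mathbb{C}^5$ is the set of all such $(T_0,T_1,T_2,T_3,B)$ (with $\sum T_k=0$) for which the equation is apparent, i.e. all its solutions are free of logarithmic singularities at each $\omega_k/2$, $k=0,1,2,3$. Equivalently (by the Frobenius method), $AP$ is the algebraic set defined by $\sum_{j=0}^3T_j=0$ and $T_k^2-\sum_{j\ne k}T_j\zeta(\tfrac{\omega_k}{2}-\tfrac{\omega_j}{2})-B=0$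 for $k=0,1,2,3$. *)

(* Defs.v *)
From mathcomp Require Import all_boot all_order all_algebra complex.
From mathcomp Require Import all_classical all_reals all_analysis.
(* Not imported: the notations of mpoly clash with those of mathcomp-analysis. *)
From mathcomp Require mpoly.

Set Implicit Arguments.
Unset Strict Implicit.
Unset Printing Implicit Defensive.

Import Order.TTheory GRing.Theory Num.Theory numFieldNormedType.Exports.
Local Open Scope classical_set_scope.
Local Open Scope ring_scope.

(* Seen as a numFieldType, R[i] receives its topology and its structure of
   normed space over itself, so that is_derive is complex differentiation.
   The order is the partial one: 0 < r means that r is real and positive, and
   z <= 0 that z is real and nonpositive. *)
Definition Cplx (R : realType) : numFieldType := R[i]%C.

Definition lattice_point (R : realType) (tau : Cplx R) (m n : int) : Cplx R :=
  m%:~R + n%:~R * tau.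

Definition in_lattice (R : realType) (tau z : Cplx R) : Prop :=
  exists m n : int, z = lattice_point tau m n.

(* Sum over the nonzero lattice points, as the limit of the sums over the boxes
   -N <= m, n <= N. The series of zeta and wp below converge absolutely when
   0 < Im tau, so the choice of the exhaustion is immaterial. *)
Definition lattice_sum (R : realType) (tau : Cplx R) (F : Cplx R -> Cplx R) :
    Cplx R :=
  limn (fun N : nat =>
    let w (i j : 'I_(N.*2.+1)) :=
      lattice_point tau (i%:Z - N%:Z) (j%:Z - N%:Z) in
    \sum_i \sum_(j | w i j != 0) F (w i j)).

(* At the poles, these two functions have meaningless values. *)
Definition wzeta (R : realType) (tau z : Cplx R) : Cplx R :=
  z^-1 + lattice_sum tau (fun w => (z - w)^-1 + w^-1 + z / w ^+ 2).

Definition wp (R : realType) (tau z : Cplx R) : Cplx R :=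
  (z ^+ 2)^-1 + lattice_sum tau (fun w => ((z - w) ^+ 2)^-1 - (w ^+ 2)^-1).

Definition omega (R : realType) (tau : Cplx R) (k : nat) : Cplx R :=
  [:: 0; 1; tau; 1 + tau]`_k.

(* The constant value of zeta(z + omega_k) - zeta(z). *)
Definition eta (R : realType) (tau : Cplx R) (k : nat) : Cplx R :=
  xget 0 [set c : Cplx R | forall z : Cplx R, ~ in_lattice tau z ->
    wzeta tau (z + omega tau k) - wzeta tau z = c].

Definition ode_solution (R : realType) (q : Cplx R -> Cplx R)
    (U : set (Cplx R)) (y : Cplx R -> Cplx R) : Prop :=
  exists y' : Cplx R -> Cplx R, forall z, U z ->
    is_derive z (1 : Cplx R) y (y' z) /\
    is_derive z (1 : Cplx R) y' (q z * y z).

(* The disc |z - p| < r cut along the real half-line from p to -oo. *)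
Definition slit_disc (R : realType) (p r : Cplx R) : set (Cplx R) :=
  [set z | `|z - p| < r /\ ~~ (z - p <= 0)].

Definition power_series_on (R : realType) (p r : Cplx R)
    (h : Cplx R -> Cplx R) : Prop :=
  exists c : nat -> Cplx R, forall z, `|z - p| < r ->
    series (fun n => c n * (z - p) ^+ n) @ \oo --> h z.

(* On a connected open set U that does not contain p, these are exactly the
   nonzero constant multiples of the branches of (z - p)^rho. *)
Definition power_branch (R : realType) (p rho : Cplx R) (U : set (Cplx R))
    (phi : Cplx R -> Cplx R) : Prop :=
  forall z, U z -> phi z != 0 /\
    is_derive z (1 : Cplx R) phi (rho * phi z / (z - p)).

(* All solutions of y'' = q y near p are free of logarithms: the solutions are
   exactly the combinations of two linearly independent Frobenius solutions
   (z - p)^rho_i * h_i(z), with h_i holomorphic at p and no log(z - p) term. *)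
Definition log_free_at (R : realType) (q : Cplx R -> Cplx R) (p : Cplx R) :
    Prop :=
  exists (r rho1 rho2 : Cplx R) (phi1 phi2 h1 h2 : Cplx R -> Cplx R),
    let U := slit_disc p r in
    let y C1 C2 z := C1 * (phi1 z * h1 z) + C2 * (phi2 z * h2 z) in
    [/\ 0 < r,
        power_branch p rho1 U phi1 /\ power_branch p rho2 U phi2,
        power_series_on p r h1 /\ power_series_on p r h2,
        forall C1 C2, (forall z, U z -> y C1 C2 z = 0) -> C1 = 0 /\ C2 = 0 &
        forall f, ode_solution q U f <->
          exists C1 C2, forall z, U z -> f z = y C1 C2 z].

(* Points of C^5 are (T_0, T_1, T_2, T_3, B). *)

Definition point5 (R : realType) (T0 T1 T2 T3 B : Cplx R) : 'rV[Cplx R]_5 :=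
  \row_(i < 5) [:: T0; T1; T2; T3; B]`_i.

Definition coordT (R : realType) (x : 'rV[Cplx R]_5) (k : 'I_4) : Cplx R :=
  x 0 (widen_ord (leqnSn 4) k).

Definition coordB (R : realType) (x : 'rV[Cplx R]_5) : Cplx R := x 0 ord_max.

Definition potential (R : realType) (tau : Cplx R) (x : 'rV[Cplx R]_5)
    (z : Cplx R) : Cplx R :=
  3 / 4 * (\sum_(k < 4) wp tau (z - omega tau k / 2))
  + \sum_(k < 4) coordT x k * wzeta tau (z - omega tau k / 2)
  + coordB x.

Definition AP (R : realType) (tau : Cplx R) : set 'rV[Cplx R]_5 :=
  [set x | \sum_(k < 4) coordT x k = 0 /\
     forall k : 'I_4, log_free_at (potential tau x) (omega tau k / 2)].

Definition V1 (R : realType) (tau : Cplx R) : set 'rV[Cplx R]_5 :=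
  [set x | exists T, x = point5 T T (- T) (- T) (T ^+ 2 - eta tau 2 * T)].

Definition V2 (R : realType) (tau : Cplx R) : set 'rV[Cplx R]_5 :=
  [set x | exists T, x = point5 T (- T) T (- T) (T ^+ 2 - eta tau 1 * T)].

Definition V3 (R : realType) : set 'rV[Cplx R]_5 :=
  [set x | exists T, x = point5 T (- T) (- T) T (T ^+ 2)].
Arguments V3 R : clear implicits.

Definition eval_at (R : realType) (n : nat) (f : mpoly.mpoly n (Cplx R))
    (x : 'rV[Cplx R]_n) : Cplx R :=
  mpoly.meval (fun i => x 0 i) f.

Definition zero_locus (R : realType) (n : nat)
    (S : set (mpoly.mpoly n (Cplx R))) : set 'rV[Cplx R]_n :=
  [set x | forall f, S f -> eval_at f x = 0].

Definition vanishing_ideal (R : realType) (n : nat) (X : set 'rV[Cplx R]_n) :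
    set (mpoly.mpoly n (Cplx R)) :=
  [set f | forall x, X x -> eval_at f x = 0].

Definition zariski_closed (R : realType) (n : nat) (X : set 'rV[Cplx R]_n) :
    Prop :=
  exists S, X = zero_locus S.

Definition zariski_irreducible (R : realType) (n : nat)
    (X : set 'rV[Cplx R]_n) : Prop :=
  X !=set0 /\
  forall A B, zariski_closed A -> zariski_closed B ->
    X `<=` A `|` B -> X `<=` A \/ X `<=` B.

Definition irreducible_chain (R : realType) (n : nat) (X : set 'rV[Cplx R]_n)
    (p : 'rV[Cplx R]_n) (d : nat) : Prop :=
  exists Z : nat -> set 'rV[Cplx R]_n,
    [/\ Z 0 p,
        forall i, (i <= d)%N ->
          [/\ zariski_closed (Z i), zariski_irreducible (Z i) & Z i `<=` X] &
        forall i, (i < d)%N -> Z i `<` Z i.+1].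

(* The Krull dimension of the local ring of X at p. *)
Definition local_dim (R : realType) (n : nat) (X : set 'rV[Cplx R]_n)
    (p : 'rV[Cplx R]_n) (d : nat) : Prop :=
  irreducible_chain X p d /\
  forall e, irreducible_chain X p e -> (e <= d)%N.

Definition tangent_space (R : realType) (n : nat) (X : set 'rV[Cplx R]_n)
    (p : 'rV[Cplx R]_n) : set 'rV[Cplx R]_n :=
  [set v | forall f, vanishing_ideal X f ->
     \sum_(i < n) eval_at (mpoly.mderiv i f) p * v 0 i = 0].

(* p is nonsingular iff the Zariski tangent space has the dimension of X at p. *)
Definition singular_point (R : realType) (n : nat) (X : set 'rV[Cplx R]_n)
    (p : 'rV[Cplx R]_n) : Prop :=
  X p /\
  ~ exists (d : nat) (A : 'M[Cplx R]_(d, n)),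
      [/\ local_dim X p d, row_free A &
          tangent_space X p = [set v | (v <= A)%MS]].

(* Main.v *)
Require Import Defs.
From mathcomp Require Import all_boot all_order all_algebra complex.
From mathcomp Require Import all_classical all_reals all_analysis.
From mathcomp Require Import zify ring lra.
From mathcomp Require Import -(notations) mpoly.
Import Order.TTheory GRing.Theory Num.Theory numFieldNormedType.Exports.
Local Open Scope classical_set_scope.
Local Open Scope ring_scope.

(** The theorem has an analytic half, the description of AP by equations, and a
    geometric half, the singular points of a union of three curves.

    Near p = omega_k / 2, with x = z - p, the potential satisfies x^2 q = 3/4 + T_k x +
    c_k x^2 + ..., so that the exponents are -1/2 and 3/2. A series x^(-1/2) (a_0 + a_1
    x + ...) has a_1 = - T_k a_0, and the coefficient a_2 meets the obstruction (c_k -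
    T_k^2) a_0 = 0. If c_k = T_k^2, the Frobenius method gives two independent solutions
    x^(-1/2) h_i, and their constant Wronskian shows that they span all solutions
    (log_free_sufficient). Otherwise all solutions without logarithm belong to the
    exponent 3/2 and are proportional (log_free_necessary).

    The constant c_k is computed from the Laurent expansions of zeta and wp
    (local_expansion), which come from an interchange of summations. It equals B + sum_j
    T_j zeta((omega_k - omega_j) / 2), since the values of wp at the half-periods sum to
    zero. The latter follows from the duplication formula 2 zeta(2z) = sum_e (zeta(z -
    e) - zeta(- e) + z wp(- e)) over the half-periods e, a mere rearrangement of the
    series: comparing the quasi-periods of the two sides kills the coefficient of z
    (wzeta_double, wp_half_sum). As zeta is odd, its values at half-periods are half
    quasi-periods, and as the T_j sum to zero the four conditions become T_k^2 = C with
    one constant C (AP_equations). So the T_k are equal up to sign and, unless they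
    vanish, with two signs of each kind; and B is determined: these are V1, V2 and V3
    (AP_union).

    Each V_i is a parabola t -> (t, a t, b t, d t, t^2 - c t) with signs a, b, d, and
    two of them meet only at the origin. A polynomial restricted to such a curve is a
    polynomial in t, so that proper closed subsets of the curve are finite; the union
    has dimension one at each of its points (curve_chain). At a point other than the
    origin, the form T_0 + T_i vanishes on the other two curves and not at the point, so
    the tangent space is the tangent line of V_i (sign_curve_nonsingular). At the origin
    the tangent space contains the independent velocities of two curves and is too large
    (crossing_singular). *)

Set Implicit Arguments.
Unset Strict Implicit.
Unset Printing Implicit Defensive.

(** * Complex numbers and unconditional sums *)

Section Modulus.
Variable R : realType.
Implicit Types z w : Cplx R.

(** The norm of the numFieldType of complex numbers is itself complex, and its order is
    partial. All estimates are therefore made with this real modulus. *)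
Definition nrm z : R := ComplexField.Normc.normc z.

Arguments nrm : simpl never.

Definition ofreal (x : R) : Cplx R := (x%:C)%C.

Lemma nrmE z : `|z| = ofreal (nrm z). Proof. by []. Qed.

Lemma nrm_ge0 z : 0 <= nrm z.
Proof. by case: z => a b; exact: sqrtr_ge0. Qed.

Lemma nrm0 : nrm 0 = 0. Proof. exact: ComplexField.Normc.normc0. Qed.

Lemma nrm1 : nrm 1 = 1. Proof. exact: ComplexField.Normc.normc1. Qed.

Lemma nrm_eq0 z : (nrm z == 0) = (z == 0).
Proof.
apply/eqP/eqP => [/ComplexField.Normc.eq0_normc //|->]; exact: nrm0.
Qed.

Lemma nrm_gt0 z : (0 < nrm z) = (z != 0).
Proof. by rewrite lt_def nrm_ge0 andbT nrm_eq0. Qed.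

Lemma nrmM z w : nrm (z * w) = nrm z * nrm w.
Proof. exact: ComplexField.Normc.normcM. Qed.

Lemma nrmV z : nrm z^-1 = (nrm z)^-1.
Proof. exact: ComplexField.Normc.normcV. Qed.

Lemma nrmN z : nrm (- z) = nrm z.
Proof. exact: normcN. Qed.

Lemma nrmX z n : nrm (z ^+ n) = nrm z ^+ n.
Proof. by elim: n => [|n IH]; rewrite ?expr0 ?nrm1 // !exprS nrmM IH. Qed.

Lemma ler_nrmD z w : nrm (z + w) <= nrm z + nrm w.
Proof. exact: le_normcD. Qed.

Lemma ler_nrmB z w : nrm (z - w) <= nrm z + nrm w.
Proof. by rewrite -(nrmN w) ler_nrmD. Qed.

Lemma nrmC z w : nrm (z - w) = nrm (w - z).
Proof. by rewrite -nrmN opprB. Qed.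

Lemma ler_nrm_tri z w u : nrm (z - u) <= nrm (z - w) + nrm (w - u).
Proof. by rewrite (le_trans _ (ler_nrmD _ _))// addrA subrK. Qed.

Lemma ler_subnrm z w : nrm z - nrm w <= nrm (z - w).
Proof. by rewrite lerBlDr (le_trans _ (ler_nrmD _ _))// subrK. Qed.

Lemma ler_nrm_sum (I : Type) (s : seq I) (F : I -> Cplx R) :
  nrm (\sum_(i <- s) F i) <= \sum_(i <- s) nrm (F i).
Proof.
elim: s => [|i s IH]; first by rewrite !big_nil nrm0.
by rewrite !big_cons (le_trans (ler_nrmD _ _))// lerD2l.
Qed.

Lemma ofreal0 : ofreal 0 = 0. Proof. by []. Qed.
Lemma ofreal1 : ofreal 1 = 1. Proof. by []. Qed.

Lemma ofrealD x y : ofreal (x + y) = ofreal x + ofreal y.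
Proof. exact: (rmorphD (real_complex R)). Qed.

Lemma ofrealB x y : ofreal (x - y) = ofreal x - ofreal y.
Proof. exact: (rmorphB (real_complex R)). Qed.

Lemma ofrealM x y : ofreal (x * y) = ofreal x * ofreal y.
Proof. exact: (rmorphM (real_complex R)). Qed.

Lemma ofreal_nat n : ofreal n%:R = n%:R.
Proof. exact: (rmorph_nat (real_complex R)). Qed.

Lemma ofreal_sum (I : Type) (s : seq I) (f : I -> R) :
  ofreal (\sum_(i <- s) f i) = \sum_(i <- s) ofreal (f i).
Proof. exact: (rmorph_sum (real_complex R)). Qed.

Lemma ofreal_eq0 x : (ofreal x == 0) = (x == 0).
Proof. exact: (fmorph_eq0 (real_complex R)). Qed.

Lemma nrm_ofreal x : nrm (ofreal x) = `|x|.
Proof. by rewrite /nrm /= expr0n /= addr0 sqrtr_sqr. Qed.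

Lemma nrm_nat n : nrm n%:R = n%:R.
Proof. by rewrite -ofreal_nat nrm_ofreal ger0_norm. Qed.

Lemma ofreal_le x y : (ofreal x <= ofreal y) = (x <= y).
Proof. exact: lecR. Qed.

Lemma ofreal_lt x y : (ofreal x < ofreal y) = (x < y).
Proof. exact: ltcR. Qed.

Lemma nrm_Re_le z : `|complex.Re z| <= nrm z.
Proof. by rewrite -ofreal_le; exact: normc_ge_Re. Qed.

Lemma nrm_Im_le z : `|complex.Im z| <= nrm z.
Proof.
case: z => a b; rewrite /nrm /= -sqrtr_sqr ler_wsqrtr // lerDr; exact: sqr_ge0.
Qed.

Lemma complex_ReIm z : z = ofreal (complex.Re z) + 'i%C * ofreal (complex.Im z).
Proof. exact: complexE. Qed.

(** Positivity for the partial order forces the imaginary part to vanish, so that radii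
    and tolerances given as complex numbers are real. *)
Lemma posC_real (r : Cplx R) : 0 < r -> exists2 x : R, 0 < x & r = ofreal x.
Proof.
case: r => a b; rewrite (ltcE 0) /= => /andP[/eqP b0 a0].
by exists a; rewrite // b0.
Qed.

Lemma lt_nrm z (x : R) : (`|z| < ofreal x) = (nrm z < x).
Proof. by rewrite nrmE ofreal_lt. Qed.

Lemma nbhs_nrm (P : set (Cplx R)) a :
  nbhs a P <-> exists2 d : R, 0 < d & forall z, nrm (z - a) < d -> P z.
Proof.
split.
  case/nbhs_ballP => e /= e0; case: (posC_real e0) => d d0 -> H.
  exists d => // z zd; apply: H; rewrite -ball_normE /=.
  by rewrite nrmE ofreal_lt nrmC.
case=> d d0 H; apply/nbhs_ballP; exists (ofreal d) => /=.
  by rewrite -ofreal0 ofreal_lt.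
move=> z; rewrite -ball_normE /= nrmE ofreal_lt nrmC; exact: H.
Qed.

Lemma cvg_nrm (u : nat -> Cplx R) l :
  u @ \oo --> l <->
  forall e : R, 0 < e -> exists N, forall n, (N <= n)%N -> nrm (u n - l) < e.
Proof.
split.
  move=> /cvgrPdist_lt H e e0.
  have : 0 < ofreal e by rewrite -ofreal0 ofreal_lt.
  case/H => N _ HN; exists N => n Nn.
  by have := HN n Nn; rewrite /= nrmE ofreal_lt nrmC.
move=> H; apply/cvgrPdist_lt => _ /posC_real[e e0 ->].
case: (H e e0) => N HN; exists N => // n /= Nn.
by rewrite nrmE ofreal_lt nrmC HN.
Qed.

End Modulus.

Arguments nrm : simpl never.

Section Summation.
Variables (R : realType).
Implicit Types (I J K : choiceType).

(** Unconditional summation, along the finite subsets ordered by inclusion. It does not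
    refer to an enumeration, hence it is stable under every permutation of the index
    set: this is what the translations, the symmetry and the dyadic splitting of the
    lattice require. *)
Definition has_sum I (F : I -> Cplx R) (S : Cplx R) : Prop :=
  forall e : R, 0 < e -> exists s0 : seq I, forall s, uniq s ->
    {subset s0 <= s} -> nrm (\sum_(i <- s) F i - S) < e.

Lemma has_sum_unique I (F : I -> Cplx R) S T :
  has_sum F S -> has_sum F T -> S = T.
Proof.
move=> hS hT; apply/eqP; rewrite -subr_eq0 -nrm_eq0 eq_le nrm_ge0 andbT.
apply/ler_addgt0Pr => e e0; rewrite add0r.
have e2 : 0 < e / 2 by lra.
have [s hs] := hS _ e2; have [t ht] := hT _ e2.
have u := undup_uniq (s ++ t).
set X := \sum_(i <- undup (s ++ t)) F i.
have H1 : nrm (X - T) < e / 2.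
  by apply: ht => // x; rewrite mem_undup mem_cat orbC => ->.
have H2 : nrm (X - S) < e / 2.
  by apply: hs => // x; rewrite mem_undup mem_cat => ->.
have := ler_nrm_tri S X T; rewrite (nrmC S X); lra.
Qed.

Lemma eq_has_sum I (F G : I -> Cplx R) S :
  F =1 G -> has_sum F S -> has_sum G S.
Proof. by move=> /funext ->. Qed.

Lemma has_sumD I (F G : I -> Cplx R) S T :
  has_sum F S -> has_sum G T -> has_sum (fun i => F i + G i) (S + T).
Proof.
move=> hF hG e e0; have e2 : 0 < e / 2 by lra.
have [s hs] := hF _ e2; have [t ht] := hG _ e2.
exists (s ++ t) => v uv sub; rewrite big_split /=.
have Hs : nrm (\sum_(i <- v) F i - S) < e / 2.
  by apply: hs => // x xs; apply: sub; rewrite mem_cat xs.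
have Ht : nrm (\sum_(i <- v) G i - T) < e / 2.
  by apply: ht => // x xs; apply: sub; rewrite mem_cat xs orbT.
rewrite opprD addrACA (le_lt_trans (ler_nrmD _ _)) //; lra.
Qed.

Lemma has_sumZ I (F : I -> Cplx R) S c :
  has_sum F S -> has_sum (fun i => c * F i) (c * S).
Proof.
move=> hF e e0; have c0 : 0 < nrm c + 1 by rewrite ltr_wpDl ?nrm_ge0.
have e2 : 0 < e / (nrm c + 1) by rewrite divr_gt0.
have [s hs] := hF _ e2; exists s => t ut st.
rewrite -mulr_sumr -mulrBr nrmM.
have := hs t ut st; rewrite ltr_pdivlMr // => H; apply: le_lt_trans H.
rewrite mulrC; apply: ler_wpM2l; [exact: nrm_ge0|lra].
Qed.

Lemma has_sumN I (F : I -> Cplx R) S :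
  has_sum F S -> has_sum (fun i => - F i) (- S).
Proof.
move=> /(has_sumZ (-1)); rewrite mulN1r; apply: eq_has_sum => i.
by rewrite mulN1r.
Qed.

Lemma has_sumB I (F G : I -> Cplx R) S T :
  has_sum F S -> has_sum G T -> has_sum (fun i => F i - G i) (S - T).
Proof. by move=> hF /has_sumN; apply: has_sumD. Qed.

Lemma has_sum_reindex I J (f : J -> I) (g : I -> J) (F : I -> Cplx R) S :
  cancel f g -> cancel g f -> has_sum F S -> has_sum (fun j => F (f j)) S.
Proof.
move=> fK gK hF e e0; have [s hs] := hF e e0.
exists (map g s) => t ut st; rewrite -(big_map f predT F); apply: hs.
  by rewrite map_inj_uniq //; exact: can_inj fK.
by move=> x xs; rewrite -(gK x) map_f // st // map_f.
Qed.

Lemma has_sum_finite I (F : I -> Cplx R) (s0 : seq I) :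
  uniq s0 -> (forall i, i \notin s0 -> F i = 0) ->
  has_sum F (\sum_(i <- s0) F i).
Proof.
move=> u0 F0 e e0; exists s0 => s us sub.
rewrite (bigID (mem s0)) /= [X in _ + X - _]big1 ?addr0; last by move=> i /F0.
rewrite -big_filter (perm_big s0) ?subrr ?nrm0 //.
apply: uniq_perm; rewrite ?filter_uniq // => i; rewrite mem_filter.
by case: (boolP (i \in s0)) => //= /sub.
Qed.

(** Fubini in its general form: a sum may be computed fibre by fibre. A finite set of
    indices i only involves finitely many fibres, and each of these is within a
    prescribed error of its sum as soon as enough of its elements have been added. *)
Lemma has_sum_fiber K I (phi : K -> I) (F : K -> Cplx R) (G : I -> Cplx R) S :
  has_sum F S ->
  (forall i, has_sum (fun k => if phi k == i then F k else 0) (G i)) ->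
  has_sum G S.
Proof.
move=> hF hG e e0; have e2 : 0 < e / 2 by lra.
have [s0 hs0] := hF _ e2; exists (map phi s0) => s us sub.
have n0 : 0 < (size s).+1%:R :> R by rewrite ltr0n.
have ei : 0 < e / 2 / (size s).+1%:R by rewrite divr_gt0.
pose t i := projT1 (cid (hG i _ ei)).
have ht i := projT2 (cid (hG i _ ei)).
pose T := undup (s0 ++ flatten [seq t i | i <- s]).
have uT : uniq T by exact: undup_uniq.
have tT i : i \in s -> {subset t i <= T}.
  move=> si x xt; rewrite mem_undup mem_cat; apply/orP; right.
  by apply/flattenP; exists (t i) => //; apply: map_f.
have H1 : nrm (\sum_(i <- s) G i
    - \sum_(i <- s) \sum_(k <- T) if phi k == i then F k else 0) <= e / 2.
  rewrite -sumrB (le_trans (ler_nrm_sum _ _)) //.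
  have : \sum_(i <- s) nrm (G i - \sum_(k <- T) if phi k == i then F k else 0)
      <= \sum_(i <- s) e / 2 / (size s).+1%:R.
    rewrite big_seq [leRHS]big_seq; apply: ler_sum => i si.
    by apply: ltW; rewrite nrmC; apply: ht => //; apply: tT.
  move=> /le_trans; apply.
  rewrite big_const_seq count_predT iter_addr_0 -[_ *+ size s]mulr_natr mulrAC.
  by rewrite ler_pdivrMr // ler_wpM2l ?(ltW e2) // ler_nat.
have H2 : nrm (\sum_(i <- s) \sum_(k <- T) (if phi k == i then F k else 0) - S)
    < e / 2.
  rewrite exchange_big /=.
  rewrite (eq_bigr (fun k => if phi k \in s then F k else 0)); last first.
    move=> k _; rewrite -big_mkcond /=; case: ifPn => [ks|ks].
      rewrite (big_rem _ ks) /= eqxx big_seq_cond big1 ?addr0 // => i.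
      rewrite andbC => /andP[/eqP <-].
      by rewrite mem_rem_uniq // inE eqxx.
    rewrite big_seq_cond big1 // => i /andP[si /eqP ki].
    by rewrite ki si in ks.
  rewrite -big_mkcond -big_filter; apply: hs0; first by rewrite filter_uniq.
  move=> x xs; rewrite mem_filter sub ?map_f //=.
  by rewrite mem_undup mem_cat xs.
apply: (le_lt_trans (ler_nrm_tri _ _ _)).
by rewrite [e](splitr); apply: ler_ltD H1 H2.
Qed.

Lemma has_sum_embed I J (i : I) (F : I * J -> Cplx R) S :
  has_sum (fun j => F (i, j)) S ->
  has_sum (fun k => if k.1 == i then F k else 0) S.
Proof.
move=> hF e e0; have [t ht] := hF e e0.
exists [seq (i, j) | j <- t] => s us sub.
rewrite -big_mkcond -big_filter.
set s' := [seq k <- s | k.1 == i].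
have -> : \sum_(k <- s') F k = \sum_(j <- [seq k.2 | k <- s']) F (i, j).
  rewrite big_map big_seq [RHS]big_seq; apply: eq_bigr => -[i' j] /=.
  by rewrite mem_filter => /andP[/eqP /= ->].
apply: ht.
  rewrite map_inj_in_uniq ?filter_uniq // => -[i1 j1] [i2 j2].
  by rewrite !mem_filter /= => /andP[/eqP -> _] /andP[/eqP -> _] ->.
move=> j jt; apply/mapP; exists (i, j) => //.
by rewrite mem_filter eqxx sub // map_f.
Qed.

Lemma has_sum_fubini I J (F : I * J -> Cplx R) (G : I -> Cplx R) S :
  has_sum F S -> (forall i, has_sum (fun j => F (i, j)) (G i)) -> has_sum G S.
Proof.
by move=> hF hG; apply: (has_sum_fiber (phi := fst) hF) => i; apply: has_sum_embed.
Qed.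

Lemma has_sum_sumI (I : finType) J (F : I * J -> Cplx R) (G : I -> Cplx R) S :
  has_sum F S -> (forall i, has_sum (fun j => F (i, j)) (G i)) ->
  S = \sum_i G i.
Proof.
move=> hF hG; apply: (has_sum_unique (has_sum_fubini hF hG)).
rewrite -big_enum; apply: has_sum_finite; first exact: enum_uniq.
by move=> i; rewrite mem_enum.
Qed.

(** For a nonnegative family, a uniform bound on the finite partial sums amounts to
    convergence. *)
Definition sums_le I (f : I -> R) (M : R) : Prop :=
  forall s : seq I, uniq s -> \sum_(i <- s) f i <= M.

Definition abs_summable I (F : I -> Cplx R) : Prop :=
  exists M, sums_le (fun i => nrm (F i)) M.

Lemma sums_le_mono I (f g : I -> R) M :
  (forall i, f i <= g i) -> sums_le g M -> sums_le f M.
Proof. by move=> fg gM s us; apply: le_trans (gM s us); apply: ler_sum. Qed.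

Lemma ler_sum_subset I (f : I -> R) (s t : seq I) :
  (forall i, 0 <= f i) -> uniq s -> {subset s <= t} ->
  \sum_(i <- s) f i <= \sum_(i <- t) f i.
Proof.
move=> f0; elim: s t => [|x s IH] t; first by rewrite big_nil sumr_ge0.
move=> /= /andP[xs us] sub; have xt : x \in t by apply: sub; rewrite mem_head.
rewrite big_cons (big_rem _ xt) /= lerD2l; apply: IH => // y ys.
have yx : y != x by apply: contraNneq xs => <-.
have : y \in t by apply: sub; rewrite inE ys orbT.
by move/perm_to_rem: xt => /perm_mem ->; rewrite inE (negPf yx).
Qed.

Lemma has_sum_le I (F : I -> Cplx R) S M :
  sums_le (fun i => nrm (F i)) M -> has_sum F S -> nrm S <= M.
Proof.
move=> FM hF; apply/ler_addgt0Pr => e e0; have [s hs] := hF e e0.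
have H : nrm (\sum_(i <- undup s) F i - S) < e.
  by apply: hs (undup_uniq s) _ => x; rewrite mem_undup.
have H1 := ler_nrm_sum (undup s) F; have H2 := FM _ (undup_uniq s).
have := ler_subnrm S (\sum_(i <- undup s) F i); rewrite nrmC; lra.
Qed.

Lemma has_sum_nonneg I (f : I -> R) M : (forall i, 0 <= f i) ->
  sums_le f M -> exists S, has_sum (fun i => ofreal (f i)) (ofreal S).
Proof.
move=> f0 fM.
pose A : set R := [set x | exists2 s : seq I, uniq s & x = \sum_(i <- s) f i].
have hA : has_sup A.
  split; first by exists 0, [::]; rewrite ?big_nil.
  by exists M => _ [s us ->]; exact: fM.
exists (sup A) => e e0; have [_ [s us ->] Hs] := sup_adherent e0 hA.
exists s => t ut st; rewrite -ofreal_sum -ofrealB nrm_ofreal.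
have H1 : \sum_(i <- t) f i <= sup A by apply: (ub_le_sup hA.2); exists t.
have H2 := ler_sum_subset f0 us st.
by rewrite ler0_norm; lra.
Qed.

(** The real and imaginary parts u satisfy 0 <= u + |F| <= 2 |F|, so that u is the
    difference of two nonnegative families with bounded partial sums. Existence is thus
    reduced to suprema of bounded sets of real numbers. *)
Lemma abs_summable_has_sum I (F : I -> Cplx R) :
  abs_summable F -> exists S, has_sum F S.
Proof.
case=> M FM.
have real f : (forall i, `|f i| <= nrm (F i)) ->
    exists S, has_sum (fun i => ofreal (f i)) S.
  move=> fF.
  have f1 i : 0 <= f i + nrm (F i) by have := fF i; rewrite ler_norml; lra.
  have [A hA] : exists S, has_sum (fun i => ofreal (f i + nrm (F i))) (ofreal S).
    apply: (@has_sum_nonneg _ _ (2 * M)) f1 _ => s us.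
    apply: (@le_trans _ _ (\sum_(i <- s) 2 * nrm (F i))).
      by apply: ler_sum => i _; have := fF i; rewrite ler_norml; lra.
    by rewrite -mulr_sumr ler_pM2l // FM.
  have [B hB] := has_sum_nonneg (fun i => nrm_ge0 (F i)) FM.
  exists (ofreal A - ofreal B); apply: eq_has_sum (has_sumB hA hB) => i /=.
  by rewrite ofrealD addrK.
have [A hA] := real _ (fun i => nrm_Re_le (F i)).
have [B hB] := real _ (fun i => nrm_Im_le (F i)).
exists (A + 'i%C * B); apply: eq_has_sum (has_sumD hA (has_sumZ 'i%C hB)) => i.
by rewrite /= -complex_ReIm.
Qed.

(** Finitely many indices are exempted from the comparison: for a lattice sum they are
    the points that are close to the argument. *)
Lemma abs_summable_dom I (F G : I -> Cplx R) (s0 : seq I) :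
  (forall i, i \notin s0 -> nrm (F i) <= nrm (G i)) -> abs_summable G ->
  abs_summable F.
Proof.
move=> FG [M GM]; exists (\sum_(i <- s0) nrm (F i) + M) => s us.
rewrite (bigID (mem s0)) /= lerD //.
  rewrite -big_filter; apply: ler_sum_subset.
  - by move=> i; exact: nrm_ge0.
  - by rewrite filter_uniq.
  - by move=> i; rewrite mem_filter => /andP[].
rewrite -big_filter; apply: le_trans (GM [seq i <- s | i \notin s0] _).
  rewrite !big_filter; exact: ler_sum.
by rewrite filter_uniq.
Qed.

Lemma abs_summableZ I (F : I -> Cplx R) c :
  abs_summable F -> abs_summable (fun i => c * F i).
Proof.
case=> M FM; exists (nrm c * M) => s us.
rewrite (eq_bigr (fun i => nrm c * nrm (F i))); last by move=> i _; rewrite nrmM.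
by rewrite -mulr_sumr ler_wpM2l ?nrm_ge0 ?FM.
Qed.

Lemma abs_summable_ofreal I (f : I -> R) M : (forall i, 0 <= f i) ->
  sums_le f M -> abs_summable (fun i => ofreal (f i)).
Proof.
move=> f0 fM; exists M; apply: sums_le_mono fM => i.
by rewrite nrm_ofreal ger0_norm.
Qed.

Lemma sums_le_prod I J (f : I -> R) (g : J -> R) M N :
  (forall i, 0 <= f i) -> (forall j, 0 <= g j) ->
  sums_le f M -> sums_le g N -> sums_le (fun k : I * J => f k.1 * g k.2) (M * N).
Proof.
move=> f0 g0 fM gN s us.
pose s1 := undup (map fst s); pose s2 := undup (map snd s).
apply: (@le_trans _ _ (\sum_(k <- [seq (i, j) | i <- s1, j <- s2]) f k.1 * g k.2)).
  apply: ler_sum_subset => // [[i j]|[i j] ij]; first by rewrite mulr_ge0.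
  apply/allpairsP; exists (i, j); rewrite !mem_undup; split => //.
  - by apply/mapP; exists (i, j).
  - by apply/mapP; exists (i, j).
rewrite big_allpairs /=.
rewrite (eq_bigr (fun i => f i * \sum_(j <- s2) g j)); last first.
  by move=> i _; rewrite mulr_sumr.
rewrite -mulr_suml ler_pM ?sumr_ge0 ?fM ?gN ?undup_uniq //.
Qed.

End Summation.

(** * Complex differentiation *)

Section Differentiation.
Variable R : realType.
Implicit Types (z w d : Cplx R) (f : Cplx R -> Cplx R).

(** Differentiability as a first order estimate, without division. *)
Lemma is_derive_nrm f z d :
  is_derive z (1 : Cplx R) f d <->
  forall e : R, 0 < e -> exists2 r : R, 0 < r & forall w, nrm (w - z) < r ->
    nrm (f w - f z - d * (w - z)) <= e * nrm (w - z).
Proof.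
have quot (h : Cplx R) : h != 0 ->
    nrm (d - h^-1 *: ((f \o shift z) (h *: (1 : Cplx R)) - f z)) * nrm h
    = nrm (f (h + z) - f z - d * h).
  move=> h0; rewrite -nrmM -nrmN; congr nrm.
  change (- ((d - h^-1 * (f (h * 1 + z) - f z)) * h) = f (h + z) - f z - d * h).
  by rewrite mulr1; field.
split.
  case=> df dv e e0.
  have : (fun h => h^-1 *: ((f \o shift z) (h *: (1 : Cplx R)) - f z)) @ 0^'
      --> d by rewrite -dv; exact: df.
  move=> /cvgrPdist_le H; have e1 : 0 < ofreal e by rewrite -ofreal0 ofreal_lt.
  have {H} := H _ e1; rewrite near_withinE => /nbhs_nrm[r r0 Hr].
  exists r => // w wr; have [->|h0] := eqVneq w z.
    by rewrite !subrr mulr0 subrr nrm0 mulr0.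
  rewrite -subr_eq0 in h0; have := Hr (w - z); rewrite subr0 => /(_ wr h0).
  rewrite nrmE ofreal_le => {}Hr.
  by rewrite -{1}(subrK z w) -(quot _ h0) ler_wpM2r ?nrm_ge0.
move=> H.
have cv : (fun h => h^-1 *: ((f \o shift z) (h *: (1 : Cplx R)) - f z)) @ 0^'
    --> d.
  apply/cvgrPdist_le => _ /posC_real[e e0 ->].
  have [r r0 Hr] := H e e0.
  rewrite near_withinE; apply/nbhs_nrm; exists r => // h; rewrite subr0 => hr h0.
  rewrite nrmE ofreal_le -(ler_pM2r (_ : 0 < nrm h)) ?nrm_gt0 // quot //.
  by have := Hr (h + z); rewrite addrK => /(_ hr).
by split; [apply/cvg_ex; exists d | exact: cvg_lim].
Qed.

(** The mean value theorem, applied to the real and imaginary parts of f along the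
    segment. *)
Lemma is_derive_const_segment f a b :
  (forall t : R, 0 <= t <= 1 ->
    is_derive (a + ofreal t * (b - a)) (1 : Cplx R) f 0) -> f a = f b.
Proof.
move=> df; pose g t := f (a + ofreal t * (b - a)).
(* q stands for the real part or the imaginary part. *)
have key (q : Cplx R -> R) : (forall z w, q (z - w) = q z - q w) ->
    (forall z, `|q z| <= nrm z) -> q (f b) = q (f a).
  move=> qB qn.
  have dg (t : R) : 0 <= t <= 1 -> is_derive t (1 : R) (q \o g) (0 : R).
    move=> t01; have /is_derive_nrm D := df t t01.
    have cv : (fun h : R => h^-1 *: (((q \o g) \o shift t) (h *: (1 : R)) - (q \o g) t))
        @ 0^' --> (0 : R).
      apply/cvgrPdist_le => e e0.
      pose k := nrm (b - a) + 1; have k0 : 0 < k by rewrite ltr_wpDl ?nrm_ge0.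
      have ek : 0 < e / k by rewrite divr_gt0.
      have [r r0 Hr] := D _ ek.
      rewrite near_withinE; apply/nbhs_ballP; exists (r / k) => /=.
        by rewrite divr_gt0.
      move=> h; rewrite /ball /= sub0r normrN => hr h0.
      have hk : nrm (ofreal h * (b - a)) <= `|h| * k.
        by rewrite nrmM nrm_ofreal ler_wpM2l // lerDl.
      rewrite sub0r normrN normrZ normfV ler_pdivrMl ?normr_gt0 //.
      change (`|q (g (h * 1 + t)) - q (g t)| <= `|h| * e); rewrite mulr1 -qB.
      apply: le_trans (qn _) _; rewrite /g.
      have := Hr (a + ofreal (h + t) * (b - a)).
      have -> : a + ofreal (h + t) * (b - a) - (a + ofreal t * (b - a))
        = ofreal h * (b - a) by rewrite ofrealD; ring.
      rewrite mul0r subr0 => /(_ _) H.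
      apply: le_trans (H _) _.
        by apply: le_lt_trans hk _; rewrite -ltr_pdivlMr.
      rewrite (le_trans (ler_wpM2l (ltW ek) hk)) // le_eqVlt; apply/orP; left.
      by apply/eqP; field; rewrite gt_eqF.
    by split; [apply/cvg_ex; exists 0 | exact: cvg_lim].
  have ct : {within `[0 : R, 1], continuous (q \o g)}.
    by apply: derivable_within_continuous => t t01; case: (dg t).
  have [|c _] := @MVT_segment R (q \o g) (fun=> 0) 0 1 ler01 _ ct.
    by move=> t /andP[t0 t1]; apply: dg; rewrite ltW // ltW.
  have -> : (q \o g) 0 = q (f a) by rewrite /g /= ofreal0 mul0r addr0.
  have -> : (q \o g) 1 = q (f b) by rewrite /g /= ofreal1 mul1r addrC subrK.
  by rewrite mul0r; move/eqP; rewrite subr_eq0 => /eqP.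
rewrite (complex_ReIm (f a)) (complex_ReIm (f b)); congr (ofreal _ + 'i%C * ofreal _); symmetry.
  by apply: key => [[? ?] [? ?]|z] //; exact: nrm_Re_le.
by apply: key => [[? ?] [? ?]|z] //; exact: nrm_Im_le.
Qed.

End Differentiation.

(** * Power series *)

Section PowerSeries.
Variable R : realType.
Implicit Types (a b : nat -> Cplx R) (x z w S : Cplx R) (r s t M : R).

Definition psum a x S : Prop := has_sum (fun n => a n * x ^+ n) S.

(** Cauchy estimates on the circle of radius r. The operations on power series below are
    controlled through such bounds, the derivative and the product at the cost of a
    smaller radius. *)
Definition tame a r : Prop :=
  0 < r /\ exists M, forall n, nrm (a n) * r ^+ n <= M.

Definition pser a x : Cplx R := xget 0 (psum a x).

Lemma geo_partial t n : 0 <= t < 1 -> \sum_(i < n) t ^+ i <= (1 - t)^-1.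
Proof.
case/andP=> t0 t1; have t10 : 0 < 1 - t by lra.
have E : (1 - t) * \sum_(i < n) t ^+ i = 1 - t ^+ n.
  by have := subrX1 t n; lra.
rewrite -[leRHS]mul1r ler_pdivlMr // mulrC E.
by have := exprn_ge0 n t0; lra.
Qed.

Lemma geo_sums_le t : 0 <= t < 1 -> sums_le (fun n : nat => t ^+ n) (1 - t)^-1.
Proof.
move=> ht u uu; apply: (le_trans _ (geo_partial (\max_(i <- u) i).+1 ht)).
rewrite -(big_mkord predT (fun n => t ^+ n)); apply: ler_sum_subset => //.
  by move=> i; apply: exprn_ge0; case/andP: ht.
by move=> i iu; rewrite mem_index_iota /= ltnS; exact: leq_bigmax_seq.
Qed.

(** The n + 1 terms t^0, ..., t^n of the geometric series are all at least t^n. This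
    absorbs the polynomial factors that come from derivatives and Cauchy products. *)
Lemma geo_weight t n : 0 <= t < 1 -> n.+1%:R * t ^+ n <= (1 - t)^-1.
Proof.
move=> ht; apply: le_trans (geo_partial n.+1 ht); case/andP: ht => t0 t1.
have -> : n.+1%:R * t ^+ n = \sum_(i < n.+1) t ^+ n.
  by rewrite sumr_const card_ord mulr_natl.
by apply: ler_sum => i _; apply: ler_wiXn2l => //; rewrite ?(ltW t1) // -ltnS.
Qed.

Lemma tame_le a r s : 0 < s <= r -> tame a r -> tame a s.
Proof.
case/andP=> s0 sr [_ [M aM]]; split=> //; exists M => n; apply: le_trans (aM n).
by rewrite ler_wpM2l ?nrm_ge0 // lerXn2r // nnegrE ltW // (lt_le_trans s0).
Qed.

Lemma tame_abs a r x : tame a r -> nrm x < r ->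
  exists M, sums_le (fun n => nrm (a n * x ^+ n)) M.
Proof.
case=> r0 [M aM] xr; have M0 : 0 <= M.
  by apply: le_trans (aM 0%N); rewrite expr0 mulr1 nrm_ge0.
have ht : 0 <= nrm x / r < 1.
  by rewrite divr_ge0 ?nrm_ge0 ?(ltW r0) //= ltr_pdivrMr ?mul1r.
exists (M * (1 - nrm x / r)^-1) => u uu.
apply: le_trans (ler_wpM2l M0 (geo_sums_le ht uu)).
rewrite mulr_sumr; apply: ler_sum => n _; rewrite nrmM nrmX expr_div_n.
rewrite mulrCA mulrC ler_wpM2l ?exprn_ge0 ?nrm_ge0 //.
by rewrite ler_pdivlMr ?exprn_gt0.
Qed.

Lemma tame_psum a r x : tame a r -> nrm x < r -> psum a x (pser a x).
Proof.
move=> ha xr; apply: xgetPex; apply: abs_summable_has_sum.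
exact: (tame_abs ha xr).
Qed.

Lemma psum_pser a x S : psum a x S -> pser a x = S.
Proof. by move=> h; exact: has_sum_unique (xgetPex 0 (ex_intro _ S h)) h. Qed.

Lemma tame_weight a r s M : 0 < s < r ->
  (forall n, nrm (a n) * r ^+ n <= n.+1%:R * M) -> tame a s.
Proof.
case/andP=> s0 sr aM; have r0 := lt_trans s0 sr.
have ht : 0 <= s / r < 1 by rewrite divr_ge0 ?ltW //= ltr_pdivrMr ?mul1r.
have M0 : 0 <= M.
  have := aM 0%N; rewrite mul1r expr0 mulr1; apply: le_trans; exact: nrm_ge0.
split=> //; exists (M * (1 - s / r)^-1) => n.
apply: le_trans (ler_wpM2l M0 (geo_weight n ht)).
have -> : nrm (a n) * s ^+ n = (nrm (a n) * r ^+ n) * (s / r) ^+ n.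
  by rewrite expr_div_n -mulrA [r ^+ n * _]mulrC divfK // expf_neq0 ?gt_eqF.
rewrite mulrA [M * _]mulrC ler_wpM2r // exprn_ge0 //; by case/andP: ht.
Qed.

Lemma tameD a b r : tame a r -> tame b r -> tame (fun n => a n + b n) r.
Proof.
case=> r0 [M aM] [_ [N bN]]; split=> //; exists (M + N) => n.
apply: le_trans (lerD (aM n) (bN n)); rewrite -mulrDl.
by rewrite ler_wpM2r ?ler_nrmD // exprn_ge0 // ltW.
Qed.

Lemma tameZ a r x : tame a r -> tame (fun n => x * a n) r.
Proof.
case=> r0 [M aM]; split=> //; exists (nrm x * M) => n.
by rewrite nrmM -mulrA ler_wpM2l ?nrm_ge0.
Qed.

Lemma tame_weightM a r s : 0 < s < r -> tame a r ->
  tame (fun n => n%:R * a n) s.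
Proof.
move=> sr [r0 [M aM]]; apply: (tame_weight (M := M) sr) => n.
rewrite nrmM nrm_nat -mulrA; apply: ler_pM => //.
- by rewrite mulr_ge0 ?nrm_ge0 // exprn_ge0 // ltW.
- by rewrite ler_nat.
Qed.

Definition pderiv a : nat -> Cplx R := fun n => n.+1%:R * a n.+1.

Lemma tame_shift a r m : tame a r -> tame (fun n => a (m + n)%N) r.
Proof.
case=> r0 [M aM]; split=> //; exists (M / r ^+ m) => n.
by rewrite ler_pdivlMr ?exprn_gt0 // -mulrA -exprD addnC.
Qed.

Lemma tame_pderiv a r s : 0 < s < r -> tame a r -> tame (pderiv a) s.
Proof. by move=> sr /(tame_weightM sr)/(tame_shift 1). Qed.

Definition mulXn m a : nat -> Cplx R :=
  fun n => if (m <= n)%N then a (n - m)%N else 0.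

Lemma mulXn_lt m a k : (k < m)%N -> mulXn m a k = 0.
Proof. by move=> km; rewrite /mulXn leqNgt km. Qed.

Lemma tame_mulXn a r m : tame a r -> tame (mulXn m a) r.
Proof.
case=> r0 [M aM]; split=> //; exists (M * r ^+ m) => n.
rewrite /mulXn; case: leqP => [mn|_].
  by rewrite -{2}(subnK mn) exprD mulrA ler_wpM2r ?exprn_ge0 // ltW.
rewrite nrm0 mul0r mulr_ge0 ?exprn_ge0 ?(ltW r0) //.
by apply: le_trans (aM 0%N); rewrite expr0 mulr1 nrm_ge0.
Qed.

Lemma has_sum_shift m (F : nat -> Cplx R) S : has_sum F S ->
  has_sum (fun n => if (m <= n)%N then F (n - m)%N else 0) S.
Proof.
move=> hF; apply: (has_sum_fiber (phi := fun k => (m + k)%N) hF) => i.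
case: leqP => mi.
  have := @has_sum_finite R _ (fun k => if (m + k)%N == i then F k else 0)
    [:: (i - m)%N] isT.
  rewrite big_seq1 subnKC // eqxx; apply=> k; rewrite inE => kn.
  by case: eqP => // E; rewrite -E addKn eqxx in kn.
have := @has_sum_finite R _ (fun k => if (m + k)%N == i then F k else 0) [::] isT.
rewrite big_nil; apply=> k _; case: eqP => // E; move: mi; rewrite -E.
by rewrite ltnNge leq_addr.
Qed.

Lemma psum_mulXn a x S m : psum a x S -> psum (mulXn m a) x (x ^+ m * S).
Proof.
move=> /(has_sumZ (x ^+ m))/(has_sum_shift m); apply: eq_has_sum => n.
rewrite /mulXn; case: leqP => mn; last by rewrite mul0r.
by rewrite mulrCA -exprD subnKC.
Qed.

Lemma psum_drop a x S m : (forall n, (n < m)%N -> a n = 0) -> x != 0 ->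
  psum a x S -> psum (fun n => a (m + n)%N) x (S / x ^+ m).
Proof.
move=> a0 x0 hS; have xm : x ^+ m != 0 by rewrite expf_neq0.
suff : has_sum (fun n => a (m + n)%N * x ^+ (m + n)) S.
  move=> /(has_sumZ (x ^+ m)^-1); rewrite mulrC; apply: eq_has_sum => n.
  by rewrite mulrCA exprD mulKf.
apply: (has_sum_fiber (phi := fun k => (k - m)%N) hS) => i.
have := @has_sum_finite R _
  (fun k => if (k - m)%N == i then a k * x ^+ k else 0) [:: (m + i)%N] isT.
rewrite big_seq1 addKn eqxx; apply=> k; rewrite inE => km; case: eqP => // E.
by rewrite a0 ?mul0r //; lia.
Qed.

(** Cauchy product. *)
Definition conv a b : nat -> Cplx R :=
  fun n => \sum_(j < n.+1) a j * b (n - j)%N.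

Lemma tame_conv a b r s : 0 < s < r -> tame a r -> tame b r ->
  tame (conv a b) s.
Proof.
move=> sr [r0 [M aM]] [_ [N bN]].
apply: (tame_weight (M := M * N) sr) => n.
apply: (@le_trans _ _ (\sum_(j < n.+1) M * N)); last first.
  by rewrite sumr_const card_ord mulr_natl.
apply: (@le_trans _ _ (\sum_(j < n.+1) nrm (a j * b (n - j)%N) * r ^+ n)).
  by rewrite -mulr_suml ler_wpM2r ?ler_nrm_sum // exprn_ge0 // ltW.
apply: ler_sum => j _; have jn : (j <= n)%N by rewrite -ltnS.
have -> : r ^+ n = r ^+ j * r ^+ (n - j) by rewrite -exprD subnKC.
rewrite nrmM mulrACA ler_pM //.
  by rewrite mulr_ge0 ?nrm_ge0 ?exprn_ge0 // ltW.
by rewrite mulr_ge0 ?nrm_ge0 ?exprn_ge0 // ltW.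
Qed.

(** The product of the sums is the sum of the double family a_i b_j x^(i+j), which is
    regrouped along its antidiagonals. *)
Lemma psum_conv a b r x : tame a r -> tame b r -> nrm x < r ->
  psum (conv a b) x (pser a x * pser b x).
Proof.
move=> ha hb xr; have A := tame_psum ha xr; have B := tame_psum hb xr.
have [M aM] := tame_abs ha xr; have [N bN] := tame_abs hb xr.
pose F (k : nat * nat) := (a k.1 * x ^+ k.1) * (b k.2 * x ^+ k.2).
have [S hS] : exists S, has_sum F S.
  apply: abs_summable_has_sum; exists (M * N).
  have := sums_le_prod (fun i => nrm_ge0 _) (fun i => nrm_ge0 _) aM bN.
  by apply: sums_le_mono => k; rewrite /F nrmM.
have -> : pser a x * pser b x = S.
  rewrite mulrC; have H := has_sumZ (pser b x) A.
  apply: (has_sum_unique H); apply: (has_sum_fubini hS) => i /=.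
  by rewrite mulrC; exact: (has_sumZ (a i * x ^+ i) B).
apply: (has_sum_fiber (phi := fun k : nat * nat => (k.1 + k.2)%N) hS) => n.
pose L := [seq (j, (n - j)%N) | j <- iota 0 n.+1].
have uL : uniq L by rewrite map_inj_uniq ?iota_uniq // => i j [].
have := @has_sum_finite R _ (fun k => if (k.1 + k.2)%N == n then F k else 0) L uL.
have -> : \sum_(k <- L) (if (k.1 + k.2)%N == n then F k else 0) = conv a b n * x ^+ n.
  rewrite big_map /conv mulr_suml -(big_mkord predT
    (fun j => a j * b (n - j)%N * x ^+ n)) /index_iota subn0.
  rewrite big_seq [RHS]big_seq; apply: eq_bigr => j.
  rewrite mem_iota add0n /= => jn; have {}jn : (j <= n)%N by lia.
  by rewrite subnKC // eqxx /F /= mulrACA -exprD subnKC.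
apply=> -[j k] /= kL; case: eqP => // E.
case/mapP: kL; exists j; first by rewrite mem_iota; lia.
by rewrite -E addKn.
Qed.

(** Writing e_n for the remainder w^n - x^n - n x^(n-1) (w - x), one has e_(n+1) = w e_n
    + n x^(n-1) (w - x)^2. The factor s^2 on the left avoids the exponent n - 2. *)
Lemma taylor_bound s x w n : nrm x <= s -> nrm w <= s ->
  nrm (w ^+ n - x ^+ n - n%:R * x ^+ n.-1 * (w - x)) * s ^+ 2
  <= n%:R ^+ 2 * s ^+ n * nrm (w - x) ^+ 2.
Proof.
move=> xs ws; have s0 : 0 <= s by apply: le_trans (nrm_ge0 _) xs.
elim: n => [|n IH]; first by rewrite mulr0n !expr0 subrr !mul0r subrr nrm0 mul0r expr0n !mul0r.
have -> : w ^+ n.+1 - x ^+ n.+1 - n.+1%:R * x ^+ n.+1.-1 * (w - x) =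
    w * (w ^+ n - x ^+ n - n%:R * x ^+ n.-1 * (w - x))
    + n%:R * x ^+ n.-1 * (w - x) ^+ 2.
  case: n {IH} => [|n]; first by rewrite !expr1 expr0; ring.
  by rewrite !succnK -[n.+2%:R]natr1 !exprS; ring.
apply: (le_trans (ler_wpM2r (exprn_ge0 2 s0) (ler_nrmD _ _))).
rewrite mulrDl [nrm (w * _)]nrmM -(mulrA (nrm w)).
have H1 := ler_pM (nrm_ge0 w) (mulr_ge0 (nrm_ge0 _) (exprn_ge0 2 s0)) ws IH.
apply: (le_trans (lerD H1 (lexx _))).
rewrite nrmM [nrm ((w - x) ^+ 2)]nrmX nrmM nrm_nat nrmX; set h := nrm (w - x) ^+ 2.
have h0 : 0 <= h by rewrite exprn_ge0 ?nrm_ge0.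
have H2 : n%:R * nrm x ^+ n.-1 * s ^+ 2 <= n%:R * s ^+ n.+1.
  case: n {IH H1} => [|n]; first by rewrite !mul0r.
  rewrite /= -mulrA ler_wpM2l // -[in leRHS]addn2 exprD ler_wpM2r ?exprn_ge0 //.
  by rewrite lerXn2r // nnegrE ?nrm_ge0.
have -> : s * (n%:R ^+ 2 * s ^+ n * h) = n%:R ^+ 2 * s ^+ n.+1 * h.
  by rewrite [s ^+ n.+1]exprS; ring.
rewrite [X in _ + X <= _]mulrAC -mulrDl ler_wpM2r //.
apply: (le_trans (lerD (lexx _) H2)).
rewrite -mulrDl ler_wpM2r ?exprn_ge0 //.
by rewrite -natr1; have := ler0n R n; nra.
Qed.

(** Termwise differentiation: the first order remainders add up to O(|w - x|^2), because
    the coefficients n^2 a_n are still bounded on a slightly smaller circle. *)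
Lemma is_derive_pser a r x : tame a r -> nrm x < r ->
  is_derive x (1 : Cplx R) (pser a) (pser (pderiv a) x).
Proof.
move=> ha xr; pose s := (nrm x + r) / 2; pose t := (s + r) / 2.
have x0 := nrm_ge0 x.
have xs : nrm x < s by rewrite /s; lra.
have st : s < t by rewrite /t /s; lra.
have tr : t < r by rewrite /t /s; lra.
have s0 : 0 < s by lra.
have h1 : tame (fun n => n%:R * a n) t by apply: tame_weightM ha; lra.
have h2 : tame (fun n => n%:R * (n%:R * a n)) ((s + t) / 2).
  by apply: tame_weightM h1; lra.
have [|M HM] := tame_abs (x := ofreal s) h2; first by rewrite nrm_ofreal gtr0_norm; lra.
have M0 : 0 <= M by have := HM [::] isT; rewrite big_nil.
apply/is_derive_nrm => e e0.
pose K := M / s ^+ 2; have K0 : 0 <= K by rewrite divr_ge0 // exprn_ge0 // ltW.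
have K1 : 0 < K + 1 by lra.
exists (Num.min (s - nrm x) (e / (K + 1))).
  by rewrite lt_min divr_gt0 // andbT; lra.
move=> w; rewrite lt_min => /andP[ws we].
have {}ws : nrm w < s by have := ler_subnrm w x; lra.
have A := tame_psum ha xr.
have B : psum a w (pser a w) by apply: (tame_psum ha); lra.
have D : has_sum (fun n => n%:R * a n * x ^+ n.-1) (pser (pderiv a) x).
  have := @tame_psum (pderiv a) t x _ (lt_trans xs st).
  move=> /(_ (tame_pderiv _ ha)) H.
  have {}H : psum (pderiv a) x (pser (pderiv a) x) by apply: H; lra.
  move: H => /(has_sum_shift 1); apply: eq_has_sum => -[|n] /=.
    by rewrite !mul0r.
  by rewrite subn1.
have H := has_sumB (has_sumB B A) (has_sumZ (w - x) D).
have E : forall n, nrm (a n * w ^+ n - a n * x ^+ n -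
    (w - x) * (n%:R * a n * x ^+ n.-1)) <=
    nrm (w - x) ^+ 2 / s ^+ 2 * nrm (n%:R * (n%:R * a n) * ofreal s ^+ n).
  move=> n; have -> : a n * w ^+ n - a n * x ^+ n -
      (w - x) * (n%:R * a n * x ^+ n.-1)
      = a n * (w ^+ n - x ^+ n - n%:R * x ^+ n.-1 * (w - x)) by ring.
  rewrite [leRHS]mulrAC ler_pdivlMr ?exprn_gt0 // nrmM -(mulrA (nrm (a n))).
  apply: (le_trans (ler_wpM2l (nrm_ge0 _) (taylor_bound n (ltW xs) (ltW ws)))).
  rewrite !nrmM nrm_nat nrmX nrm_ofreal gtr0_norm // le_eqVlt; apply/orP; left.
  by apply/eqP; ring.
have {E H} : nrm (pser a w - pser a x - (w - x) * pser (pderiv a) x) <=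
    nrm (w - x) ^+ 2 / s ^+ 2 * M.
  apply: has_sum_le H => u uu; apply: (le_trans (ler_sum _ (fun n _ => E n))).
  rewrite -mulr_sumr ler_wpM2l ?HM // divr_ge0 ?exprn_ge0 ?nrm_ge0 // ltW //.
rewrite [leRHS]mulrC [(w - x) * _]mulrC => /le_trans; apply.
have -> : M * (nrm (w - x) ^+ 2 / s ^+ 2) = K * nrm (w - x) * nrm (w - x).
  by rewrite /K; field; rewrite gt_eqF.
rewrite ler_wpM2r ?nrm_ge0 //; move: we; rewrite ltr_pdivlMr // => we.
have := nrm_ge0 (w - x); nra.
Qed.

Lemma pser_at0 a : pser a 0 = a 0%N.
Proof.
apply: psum_pser; have := @has_sum_finite R _ (fun n => a n * 0 ^+ n) [:: 0%N] isT.
rewrite big_seq1 expr0 mulr1; apply=> n; rewrite inE => n0.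
by rewrite expr0n (negPf n0) mulr0.
Qed.

(** Continuity at the centre determines the constant coefficient. *)
Lemma pser_nonzero a r s : tame a r -> 0 < s ->
  (forall t, 0 < t < s -> pser a (ofreal t) = 0) -> a 0%N = 0.
Proof.
move=> ha s0 H; have r0 : 0 < r by case: ha.
apply/eqP; rewrite -nrm_eq0 eq_le nrm_ge0 andbT.
have n0 : nrm (0 : Cplx R) < r by rewrite nrm0.
have /is_derive_nrm D := is_derive_pser ha n0.
have [d d0 Hd] := D 1 ltr01; rewrite pser_at0 in Hd.
set c := pser (pderiv a) 0 in Hd.
apply/ler_addgt0Pr => e e0; rewrite add0r.
have c0 : 0 < nrm c + 1 by rewrite ltr_wpDl ?nrm_ge0.
pose t := Num.min (Num.min (d / 2) (s / 2)) (e / (nrm c + 1)).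
have t0 : 0 < t by rewrite !lt_min divr_gt0 // divr_gt0 // divr_gt0.
have td : t <= d / 2 by rewrite /t !ge_min lexx.
have ts : t <= s / 2 by rewrite /t !ge_min lexx orbT.
have te : t <= e / (nrm c + 1) by rewrite /t ge_min lexx orbT.
rewrite ler_pdivlMr // in te.
have := Hd (ofreal t); rewrite subr0 nrm_ofreal gtr0_norm // H; last by lra.
rewrite sub0r -opprD nrmN mul1r => /(_ _) Hd1.
have {}Hd1 : nrm (a 0%N + c * ofreal t) <= t by apply: Hd1; lra.
have := ler_subnrm (a 0%N + c * ofreal t) (c * ofreal t).
have := ler_nrmB (a 0%N + c * ofreal t) (c * ofreal t).
rewrite addrK nrmM nrm_ofreal gtr0_norm // => H1 _; nra.
Qed.

(** The identity theorem, with zeros only assumed along a real segment issued from the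
    centre. The first nonzero coefficient would be the constant coefficient of the
    series divided by a power of x. *)
Lemma pser_eq0 a r s : tame a r -> 0 < s ->
  (forall t, 0 < t < s -> pser a (ofreal t) = 0) -> forall n, a n = 0.
Proof.
move=> ha s0 H n; have r0 : 0 < r by case: ha.
elim/ltn_ind: n => m IH.
rewrite -[m in a m]addn0; apply: (pser_nonzero (tame_shift m ha) (s := Num.min r s)).
  by rewrite lt_min r0.
move=> t; rewrite lt_min => /and3P[t0 tr ts].
have tn : nrm (ofreal t) < r by rewrite nrm_ofreal gtr0_norm.
have := tame_psum ha tn; rewrite H ?t0 // => /(psum_drop IH).
rewrite ofreal_eq0 gt_eqF // mul0r => /(_ isT); exact: psum_pser.
Qed.

Lemma has_sum_series (F : nat -> Cplx R) S :
  has_sum F S -> series F @ \oo --> S.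
Proof.
move=> hF; apply/cvg_nrm => e e0; have [s0 hs] := hF e e0.
exists (\max_(i <- s0) i).+1 => n Nn; rewrite /series /=.
apply: hs; first exact: iota_uniq.
move=> i is0; rewrite mem_index_iota /=; apply: leq_trans Nn.
rewrite ltnS; exact: leq_bigmax_seq.
Qed.

Lemma tame_power_series_on p r a : tame a r ->
  power_series_on p (ofreal r) (fun z => pser a (z - p)).
Proof.
move=> ha; exists a => z; rewrite lt_nrm => zr.
by apply: has_sum_series; apply: tame_psum ha zr.
Qed.

Lemma cvg_series_bounded (F : nat -> Cplx R) S : series F @ \oo --> S ->
  exists M, forall n, nrm (F n) <= M.
Proof.
move=> /cvg_nrm /(_ 1 ltr01)[N HN].
exists (2 + \sum_(i < N) nrm (F i)) => n.
have s0 : 0 <= \sum_(i < N) nrm (F i) by rewrite sumr_ge0 // => i _; exact: nrm_ge0.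
have [nN|Nn] := ltnP n N.
  rewrite (bigD1 (Ordinal nN)) //= [leRHS]addrCA lerDl addr_ge0 //.
  by rewrite sumr_ge0 // => i _; exact: nrm_ge0.
have E : F n = series F n.+1 - series F n.
  by rewrite /series /= big_nat_recr //= [_ + F n]addrC addrK.
have H1 := HN _ Nn; have H2 := HN n.+1 (leqW Nn).
have := ler_nrm_tri (series F n.+1) S (series F n); rewrite -E (nrmC S); lra.
Qed.

(** Abel's lemma: the terms of a convergent series are bounded, so that convergence in
    the open disc yields Cauchy estimates on every smaller circle. *)
Lemma power_series_on_tame p r h : 0 < r -> power_series_on p (ofreal r) h ->
  exists a, [/\ forall s, 0 < s < r -> tame a s &
    forall z, nrm (z - p) < r -> psum a (z - p) (h z)].
Proof.
move=> r0 [a Ha]; exists a.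
have ta s : 0 < s < r -> tame a s.
  case/andP=> s0 sr; split=> //.
  have := Ha (p + ofreal s); rewrite addrAC subrr add0r lt_nrm.
  rewrite nrm_ofreal gtr0_norm // => /(_ sr) /cvg_series_bounded[M HM].
  by exists M => n; have := HM n; rewrite nrmM nrmX nrm_ofreal gtr0_norm.
split=> // z zr; have := Ha z; rewrite lt_nrm => /(_ zr) cz.
have z0 := nrm_ge0 (z - p).
have tz : tame a ((nrm (z - p) + r) / 2) by apply: ta; lra.
have H : psum a (z - p) (pser a (z - p)) by apply: tame_psum tz _; lra.
suff -> : h z = pser a (z - p) by [].
by apply: (cvg_unique _ cz); [exact: norm_hausdorff | exact: has_sum_series].
Qed.

End PowerSeries.

(** * Slit discs and branches of powers *)

Section SlitDisc.
Variable R : realType.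
Implicit Types (p z w x rho : Cplx R) (r t : R) (phi f : Cplx R -> Cplx R).

Lemma complex_le0 x : (x <= 0) = (complex.Im x == 0) && (complex.Re x <= 0).
Proof. by case: x => a b; rewrite (lecE _ 0) /= eq_sym. Qed.

Lemma slit_discE p r z : slit_disc p (ofreal r) z <->
  nrm (z - p) < r /\ (complex.Im (z - p) != 0 \/ 0 < complex.Re (z - p)).
Proof.
rewrite /slit_disc /= lt_nrm complex_le0 negb_and -ltNge.
by split => -[-> H]; split => //; apply/orP.
Qed.

Lemma slit_disc_neq0 p r z : slit_disc p (ofreal r) z -> z - p != 0.
Proof.
move=> /slit_discE[_ H]; apply/eqP => E; move: H; rewrite E /= eqxx ltxx.
by case.
Qed.

Lemma slit_disc_nrm p r z : slit_disc p (ofreal r) z -> nrm (z - p) < r.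
Proof. by move=> /slit_discE[]. Qed.

Lemma slit_disc_le p r t z : r <= t ->
  slit_disc p (ofreal r) z -> slit_disc p (ofreal t) z.
Proof.
move=> rt /slit_discE[H1 H2]; apply/slit_discE; split=> //.
exact: lt_le_trans rt.
Qed.

Lemma slit_disc_real p r t : 0 < t < r -> slit_disc p (ofreal r) (p + ofreal t).
Proof.
case/andP=> t0 tr; apply/slit_discE; rewrite addrAC subrr add0r.
by rewrite nrm_ofreal gtr0_norm //=; split=> //; right.
Qed.

Lemma slit_disc_open p r z : slit_disc p (ofreal r) z ->
  nbhs z (slit_disc p (ofreal r)).
Proof.
move=> /slit_discE[zr H]; apply/nbhs_nrm.
have [d d0 Hd] : exists2 d : R, 0 < d & forall w, nrm (w - z) < d ->
    complex.Im (w - p) != 0 \/ 0 < complex.Re (w - p).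
  have E w : w - p = (z - p) + (w - z) by ring.
  case: H => H.
    exists `|complex.Im (z - p)|; rewrite ?normr_gt0 // => w wd; left.
    have := le_lt_trans (nrm_Im_le (w - z)) wd; apply: contraTneq; rewrite (E w).
    case: (z - p) (w - z) => [a b] [a' b'] /= /eqP; rewrite addr_eq0 => /eqP ->.
    by rewrite normrN ltxx.
  exists (complex.Re (z - p)) => // w wd; right.
  have := le_lt_trans (nrm_Re_le (w - z)) wd; rewrite (E w).
  by case: (z - p) (w - z) => [a b] [a' b'] /=; rewrite ltr_norml; lra.
exists (Num.min (r - nrm (z - p)) d); first by rewrite lt_min d0 andbT subr_gt0.
move=> w; rewrite lt_min => /andP[w1 w2]; apply/slit_discE; split; last exact: Hd.
by have := ler_nrm_tri w z p; lra.
Qed.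

(** A slit disc is star-shaped around the points of its positive radius. *)
Lemma slit_disc_const p r f : 0 < r ->
  (forall z, slit_disc p (ofreal r) z -> is_derive z (1 : Cplx R) f 0) ->
  forall z w, slit_disc p (ofreal r) z -> slit_disc p (ofreal r) w -> f z = f w.
Proof.
move=> r0 df; pose c := p + ofreal (r / 2).
suff H z : slit_disc p (ofreal r) z -> f c = f z by move=> z w /H <- /H <-.
move=> Uz; apply: is_derive_const_segment => t /andP[t0 t1]; apply: df.
have -> : c + ofreal t * (z - c) =
  p + (ofreal ((1 - t) * (r / 2)) + ofreal t * (z - p)).
  by rewrite /c (ofrealM (1 - t)) ofrealB ofreal1; ring.
move: Uz => /slit_discE[zr H]; apply/slit_discE; rewrite addrAC subrr add0r.
have [->|tn0] := eqVneq t 0.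
  rewrite ofreal0 mul0r addr0 nrm_ofreal /= subr0 mul1r gtr0_norm; last by lra.
  by split; [lra | right; lra].
have tp : 0 < t by rewrite lt_def tn0.
split.
  rewrite (le_lt_trans (ler_nrmD _ _)) // nrmM !nrm_ofreal !ger0_norm //.
    by have := nrm_ge0 (z - p); nra.
  by rewrite mulr_ge0 //; lra.
case: (z - p) H => a b /=; rewrite !mul0r add0r subr0 addr0.
case=> H; [left; rewrite mulf_neq0 // | right].
by have := mulr_gt0 tp H; nra.
Qed.

Lemma is_derive_sub p z : is_derive z (1 : Cplx R) (fun w => w - p) 1.
Proof.
apply/is_derive_nrm => e e0; exists 1 => // w _.
have -> : w - p - (z - p) - 1 * (w - z) = 0 by ring.
by rewrite nrm0 mulr_ge0 ?nrm_ge0 // ltW.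
Qed.

Lemma is_derive_mul f g z df dg :
  is_derive z (1 : Cplx R) f df -> is_derive z (1 : Cplx R) g dg ->
  is_derive z (1 : Cplx R) (fun w => f w * g w) (df * g z + f z * dg).
Proof.
move=> hf hg; have := is_deriveM hf hg; rewrite addrC.
by rewrite -[f z *: dg]/(f z * dg) -[g z *: df]/(g z * df) [g z * df]mulrC.
Qed.

Lemma is_derive_inv f z df : f z != 0 -> is_derive z (1 : Cplx R) f df ->
  is_derive z (1 : Cplx R) (fun w => (f w)^-1) (- df / f z ^+ 2).
Proof.
move=> f0 [hf dv]; split; first exact: derivableV.
rewrite deriveV // dv -[_ *: df]/(_ * df) mulrC mulrN mulNr.
by rewrite -exprVn.
Qed.

Lemma is_derive_addf f g z df dg :
  is_derive z (1 : Cplx R) f df -> is_derive z (1 : Cplx R) g dg ->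
  is_derive z (1 : Cplx R) (fun w => f w + g w) (df + dg).
Proof. exact: is_deriveD. Qed.

Lemma is_derive_scale f z df c : is_derive z (1 : Cplx R) f df ->
  is_derive z (1 : Cplx R) (fun w => c * f w) (c * df).
Proof. by move=> h; exact: (@is_deriveZ _ _ _ f c z 1 df h). Qed.

Lemma power_branch_id p r :
  power_branch p 1 (slit_disc p (ofreal r)) (fun z => z - p).
Proof.
move=> z Uz; have z0 := slit_disc_neq0 Uz; split=> //.
by rewrite mul1r divff //; exact: is_derive_sub.
Qed.

Lemma power_branchM p rho1 rho2 U f g :
  power_branch p rho1 U f -> power_branch p rho2 U g ->
  power_branch p (rho1 + rho2) U (fun z => f z * g z).
Proof.
move=> hf hg z Uz; have [f0 df] := hf z Uz; have [g0 dg] := hg z Uz.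
split; first by rewrite mulf_neq0.
by apply: is_derive_eq (is_derive_mul df dg) _; ring.
Qed.

Lemma power_branchV p rho U f :
  power_branch p rho U f -> power_branch p (- rho) U (fun z => (f z)^-1).
Proof.
move=> hf z Uz; have [f0 df] := hf z Uz; split; first by rewrite invr_neq0.
apply: is_derive_eq (is_derive_inv f0 df) _.
have [->|z0] := eqVneq (z - p) 0; first by rewrite invr0 !mulr0 oppr0 mul0r.
by field; rewrite z0.
Qed.

Lemma power_branchX p r n :
  power_branch p n%:R (slit_disc p (ofreal r)) (fun z => (z - p) ^+ n).
Proof.
elim: n => [|n IH] z Uz.
  split; first by rewrite expr0 oner_neq0.
  rewrite mulr0n !mul0r; exact: (is_derive_cst (1 : Cplx R) z 1).
have [H1 H2] := power_branchM IH (@power_branch_id p r) Uz.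
rewrite -natr1; split; first by rewrite exprSr.
by rewrite exprSr; under eq_fun do rewrite exprSr.
Qed.

(** The quotient of two branches of the same power is a branch of the power zero, whose
    derivative vanishes. *)
Lemma power_branch_unique p rho r f g : 0 < r ->
  power_branch p rho (slit_disc p (ofreal r)) f ->
  power_branch p rho (slit_disc p (ofreal r)) g ->
  exists c, forall z, slit_disc p (ofreal r) z -> f z = c * g z.
Proof.
move=> r0 hf hg; have H := power_branchM hf (power_branchV hg).
exists (f (p + ofreal (r / 2)) / g (p + ofreal (r / 2))) => z Uz.
have [g0 _] := hg z Uz.
apply: (canRL (divfK g0)).
apply: (@slit_disc_const p r (fun z => f z / g z)) => //.
  by move=> w Uw; have [_] := H w Uw; rewrite subrr !mul0r.
by apply: slit_disc_real; lra.
Qed.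

(** The principal square root: its real part is nonnegative. *)
Definition csqrt x : Cplx R := sqrtc x.

Lemma csqrtK x : csqrt x ^+ 2 = x. Proof. exact: sqr_sqrtc. Qed.

Lemma csqrt_Re_ge0 x : 0 <= complex.Re (csqrt x).
Proof. by case: x => a b; exact: sqrtr_ge0. Qed.

Lemma csqrt_Re_gt0 x : ~~ (x <= 0) -> 0 < complex.Re (csqrt x).
Proof.
move=> hx; rewrite lt_def csqrt_Re_ge0 andbT; apply: contra hx => /eqP E.
rewrite -(csqrtK x) expr2; move: E; case: (csqrt x) => a b /= ->.
rewrite complex_le0 /= !mul0r mulr0 addr0 eqxx /=.
by rewrite sub0r oppr_le0 -expr2 sqr_ge0.
Qed.

(** Off the half-line of nonpositive reals the root s(x) has a positive real part m, so
    that |s(w) + s(x)| >= m for every w, which bounds the difference quotient (s(w) -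
    s(x)) / (w - x) = 1 / (s(w) + s(x)). *)
Lemma is_derive_csqrt x : ~~ (x <= 0) ->
  is_derive x (1 : Cplx R) csqrt (1 / 2 * csqrt x / x).
Proof.
move=> /csqrt_Re_gt0; set m := complex.Re _ => m0.
have lowm w : m <= nrm (csqrt w + csqrt x).
  have := nrm_Re_le (csqrt w + csqrt x); have := csqrt_Re_ge0 w.
  rewrite /m; case: (csqrt w) (csqrt x) => [a b] [a' b'] /= a0.
  by rewrite ler_norml => /andP[_]; lra.
have s0 : csqrt x != 0 by apply: contraTneq m0; rewrite /m => ->; rewrite ltxx.
have ns : 0 < nrm (csqrt x) by rewrite nrm_gt0.
apply/is_derive_nrm => e e0; exists (e * (2 * nrm (csqrt x) * m ^+ 2)).
  by rewrite !mulr_gt0 ?exprn_gt0.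
move=> w wd.
have ss : csqrt w + csqrt x != 0 by rewrite -nrm_gt0 (lt_le_trans m0).
have -> : csqrt w - csqrt x - 1 / 2 * csqrt x / x * (w - x) =
    - ((w - x) ^+ 2 / (2 * csqrt x * (csqrt w + csqrt x) ^+ 2)).
  have E (s t : Cplx R) : t != 0 -> s + t != 0 ->
      s - t - 1 / 2 * t / t ^+ 2 * (s ^+ 2 - t ^+ 2) =
      - ((s ^+ 2 - t ^+ 2) ^+ 2 / (2 * t * (s + t) ^+ 2)).
    by move=> t0 st0; field; rewrite st0 t0.
  by have := E _ _ s0 ss; rewrite !csqrtK.
rewrite nrmN nrmM nrmV nrmX 2!nrmM nrm_nat nrmX.
have D0 : 0 < 2 * nrm (csqrt x) * m ^+ 2 by rewrite !mulr_gt0 ?exprn_gt0.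
have DD : 2 * nrm (csqrt x) * m ^+ 2 <=
    2 * nrm (csqrt x) * nrm (csqrt w + csqrt x) ^+ 2.
  rewrite ler_wpM2l ?mulr_ge0 ?nrm_ge0 //.
  by rewrite lerXn2r // nnegrE ?nrm_ge0 // ltW.
rewrite ler_pdivrMr; last exact: lt_le_trans DD.
have h0 := nrm_ge0 (w - x).
apply: (@le_trans _ _ (e * (2 * nrm (csqrt x) * m ^+ 2) * nrm (w - x))).
  by rewrite expr2 ler_wpM2r // ltW.
by rewrite -!(mulrA e) ler_wpM2l ?(ltW e0) // mulrC ler_wpM2l.
Qed.

Lemma power_branch_sqrt_inv p r :
  power_branch p (- (1 / 2)) (slit_disc p (ofreal r))
    (fun z => (csqrt (z - p))^-1).
Proof.
apply: power_branchV => z /= [_ hz].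
have z0 : z - p != 0 by apply: contraNneq hz => ->; rewrite lexx.
split; first by rewrite -sqrf_eq0 csqrtK.
have /is_derive_nrm H := is_derive_csqrt hz.
apply/is_derive_nrm => e e0; have [d d0 Hd] := H e e0; exists d => // w wz.
have E : w - p - (z - p) = w - z by ring.
by have := Hd (w - p); rewrite E; exact.
Qed.

End SlitDisc.

(** * Frobenius solutions at a regular singular point *)

Section Frobenius.
Variable R : realType.
Implicit Types (a b g : nat -> Cplx R) (p z x rho : Cplx R) (r t : R).
Implicit Types (q phi h f : Cplx R -> Cplx R).

Lemma is_derive_pser_sub a r p z : tame a r -> nrm (z - p) < r ->
  is_derive z (1 : Cplx R) (fun w => pser a (w - p)) (pser (pderiv a) (z - p)).
Proof.
move=> ha zr; have /is_derive_nrm D := is_derive_pser ha zr.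
apply/is_derive_nrm => e e0; have [d d0 Hd] := D e e0; exists d => // w wd.
have E : w - p - (z - p) = w - z by ring.
by have := Hd (w - p); rewrite E; exact.
Qed.

(** The equation x^2 y'' = (sum g_n x^n) y for y = x^rho (sum a_n x^n), coefficient by
    coefficient. *)
Definition frobenius_rec g rho a : Prop :=
  forall n, (rho + n%:R) * (rho + n%:R - 1) * a n = conv g a n.

Lemma tame_margin a r x : tame a r -> nrm x < r ->
  exists2 s, nrm x < s < r & tame (pderiv a) s /\ tame (pderiv (pderiv a)) s.
Proof.
move=> ha xr; have x0 := nrm_ge0 x.
exists ((nrm x + (nrm x + r) / 2) / 2); first by apply/andP; lra.
have h : tame (pderiv a) ((nrm x + r) / 2) by apply: tame_pderiv ha; lra.
by split; [apply: tame_le h | apply: tame_pderiv h]; lra.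
Qed.

Lemma pser_lin a b r x c d : tame a r -> tame b r -> nrm x < r ->
  pser (fun n => c * a n + d * b n) x = c * pser a x + d * pser b x.
Proof.
move=> ha hb xr; apply: psum_pser.
have := has_sumD (has_sumZ c (tame_psum ha xr)) (has_sumZ d (tame_psum hb xr)).
by apply: eq_has_sum => n /=; rewrite mulrDl !mulrA.
Qed.

(** The operator x^2 d^2/dx^2 acts on x^rho (sum a_n x^n) by multiplying a_n by (rho +
    n)(rho + n - 1). *)
Lemma pser_euler a r x rho : tame a r -> nrm x < r ->
  psum (fun n => (rho + n%:R) * (rho + n%:R - 1) * a n) x
    (x ^+ 2 * pser (pderiv (pderiv a)) x + 2 * rho * (x * pser (pderiv a) x)
     + rho * (rho - 1) * pser a x).
Proof.
move=> ha xr; have [s /andP[xs _] [h1 h2]] := tame_margin ha xr.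
have D2 := psum_mulXn 2 (tame_psum h2 xs).
have D1 := has_sumZ (2 * rho) (psum_mulXn 1 (tame_psum h1 xs)).
have D0 := has_sumZ (rho * (rho - 1)) (tame_psum ha xr).
apply: eq_has_sum (has_sumD (has_sumD D2 D1) D0) => n.
rewrite /mulXn /pderiv; case: n => [|[|n]] /=.
- by rewrite !mul0r mulr0 !add0r addr0 mulrA.
- by rewrite subnn !mul0r !add0r; ring.
- by rewrite !subSS !subn0 -!natr1; ring.
Qed.

Lemma branch_deriv2 p rho U phi a r z : power_branch p rho U phi -> U z ->
  z - p != 0 -> tame a r -> nrm (z - p) < r ->
  is_derive z (1 : Cplx R) (fun w => phi w * (rho * pser a (w - p) / (w - p)
      + pser (pderiv a) (w - p)))
    (phi z * ((z - p) ^+ 2 * pser (pderiv (pderiv a)) (z - p)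
      + 2 * rho * ((z - p) * pser (pderiv a) (z - p))
      + rho * (rho - 1) * pser a (z - p)) / (z - p) ^+ 2).
Proof.
move=> hphi Uz z0 ha zr; have [_ D] := hphi z Uz.
have [s /andP[zs _] [h1 _]] := tame_margin ha zr.
have D1 := is_derive_pser_sub ha zr; have D2 := is_derive_pser_sub h1 zs.
have DV := is_derive_inv (f := fun w => w - p) z0 (is_derive_sub p z).
apply: is_derive_eq (is_derive_mul D (is_derive_addf
  (is_derive_mul (is_derive_scale rho D1) DV) D2)) _.
by field.
Qed.

Lemma branch_deriv1 p rho U phi a r z : power_branch p rho U phi -> U z ->
  tame a r -> nrm (z - p) < r ->
  is_derive z (1 : Cplx R) (fun w => phi w * pser a (w - p))
    (phi z * (rho * pser a (z - p) / (z - p) + pser (pderiv a) (z - p))).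
Proof.
move=> hphi Uz ha zr; have [_ D] := hphi z Uz.
by apply: is_derive_eq (is_derive_mul D (is_derive_pser_sub ha zr)) _; ring.
Qed.

(** p is at worst a regular singular point of y'' = q y: g expands x^2 q. *)
Definition potential_series q p g r : Prop :=
  tame g r /\
  forall z, z - p != 0 -> nrm (z - p) < r -> (z - p) ^+ 2 * q z = pser g (z - p).

Lemma frobenius_rec_solution q p g rho phi a r :
  potential_series q p g r -> tame a r ->
  power_branch p rho (slit_disc p (ofreal r)) phi -> frobenius_rec g rho a ->
  forall z, slit_disc p (ofreal r) z ->
  is_derive z (1 : Cplx R) (fun w => phi w * pser a (w - p))
    (phi z * (rho * pser a (z - p) / (z - p) + pser (pderiv a) (z - p))) /\
  is_derive z (1 : Cplx R) (fun w => phi w * (rho * pser a (w - p) / (w - p)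
      + pser (pderiv a) (w - p))) (q z * (phi z * pser a (z - p))).
Proof.
move=> [tg Hq] ta hphi rec z Uz; have z0 := slit_disc_neq0 Uz.
have zr := slit_disc_nrm Uz; split; first exact: branch_deriv1 Uz ta zr.
apply: is_derive_eq (branch_deriv2 hphi Uz z0 ta zr) _.
have H1 := psum_pser (pser_euler rho ta zr).
have H2 := psum_pser (psum_conv tg ta zr).
rewrite -H1 (_ : (fun n => _) = conv g a); last exact/funext.
by rewrite H2 -(Hq z z0 zr); field.
Qed.

(** Conversely to the preceding lemma, a solution phi h yields the recursion: after
    division by phi, the differential equation is an identity between power series in a
    slit disc, to which the identity theorem applies. *)
Lemma solution_frobenius_rec q p g rho phi h a r t : 0 < r -> r <= t ->
  potential_series q p g r -> tame a r ->
  power_branch p rho (slit_disc p (ofreal t)) phi ->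
  (forall z, nrm (z - p) < r -> h z = pser a (z - p)) ->
  ode_solution q (slit_disc p (ofreal t)) (fun z => phi z * h z) ->
  frobenius_rec g rho a.
Proof.
move=> r0 rt [tg Hq] ta hphi hh [y' Hy] n.
pose s := r / 2; have sr : 0 < s < r by rewrite /s; lra.
have sub z : slit_disc p (ofreal r) z -> slit_disc p (ofreal t) z.
  exact: slit_disc_le.
have E z : slit_disc p (ofreal r) z -> y' z =
    phi z * (rho * pser a (z - p) / (z - p) + pser (pderiv a) (z - p)).
  move=> Uz; have zr := slit_disc_nrm Uz; have [D _] := Hy z (sub z Uz).
  have D' := branch_deriv1 hphi (sub z Uz) ta zr.
  have := @near_eq_is_derive _ _ _ _ _ z 1 _ _ D' => /(_ (fun z => phi z * h z)).
  case=> [|_ <-]; last by case: D.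
  apply: filterS (slit_disc_open Uz) => w Uw.
  by rewrite hh // (slit_disc_nrm Uw).
have key z : slit_disc p (ofreal r) z ->
    psum (fun n => (rho + n%:R) * (rho + n%:R - 1) * a n) (z - p)
      (pser g (z - p) * pser a (z - p)).
  move=> Uz; have z0 := slit_disc_neq0 Uz; have zr := slit_disc_nrm Uz.
  have [_ D] := Hy z (sub z Uz); have [phi0 _] := hphi z (sub z Uz).
  have D' := branch_deriv2 hphi (sub z Uz) z0 ta zr.
  have := @near_eq_is_derive _ _ _ _ _ z 1 _ _ D' => /(_ y').
  case=> [|_ D2].
    by apply: filterS (slit_disc_open Uz) => w /E ->.
  have := pser_euler rho ta zr; congr (psum _ _ _).
  apply: (mulfI phi0); rewrite -(Hq z z0 zr) -hh //.
  case: D => _ D; rewrite D in D2; rewrite hh // in D2 *.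
  have z2 : (z - p) ^+ 2 != 0 by rewrite expf_neq0.
  by apply: (mulIf (invr_neq0 z2)); rewrite -D2; field.
have te : tame (fun n => (rho + n%:R) * (rho + n%:R - 1) * a n
    - conv g a n) (s / 2).
  have h1 : tame (fun n => n%:R * a n) ((s + r) / 2) by apply: tame_weightM ta; lra.
  have h2 : tame (fun n => n%:R * (n%:R * a n)) s by apply: tame_weightM h1; lra.
  have h3 : tame (conv g a) s by exact: tame_conv tg ta.
  have h0 : tame a s by apply: tame_le ta; lra.
  have {}h1 : tame (fun n => n%:R * a n) s by apply: tame_le h1; lra.
  have := tameD (tameD h2 (tameZ (2 * rho - 1) h1))
    (tameD (tameZ (rho * (rho - 1)) h0) (tameZ (-1) h3)).
  move=> /(@tame_le _ _ _ (s / 2)); rewrite (_ : (fun n => _) = fun n =>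
     (rho + n%:R) * (rho + n%:R - 1) * a n - conv g a n).
    by apply; lra.
  by apply/funext => k; ring.
apply/eqP; rewrite -subr_eq0; apply/eqP.
apply: (pser_eq0 te (s := r)) => // x x0; apply: psum_pser.
have Ux := slit_disc_real p x0; have := key _ Ux; rewrite addrAC subrr add0r => H.
have xr : nrm (ofreal x) < r by rewrite nrm_ofreal gtr0_norm; lra.
have := has_sumB H (psum_conv tg ta xr); rewrite subrr.
by apply: eq_has_sum => k; rewrite mulrBl.
Qed.

Lemma ode_solution_ext q p r f h :
  (forall z, slit_disc p (ofreal r) z -> f z = h z) ->
  ode_solution q (slit_disc p (ofreal r)) f ->
  ode_solution q (slit_disc p (ofreal r)) h.
Proof.
move=> fh [y' Hy]; exists y' => z Uz; have [D1 D2] := Hy z Uz.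
rewrite -fh //; split=> //; apply: near_eq_is_derive D1.
exact: filterS (slit_disc_open Uz).
Qed.

Lemma wronskian_const q p r f f' h h' : 0 < r ->
  (forall z, slit_disc p (ofreal r) z ->
    is_derive z (1 : Cplx R) f (f' z) /\
    is_derive z (1 : Cplx R) f' (q z * f z)) ->
  (forall z, slit_disc p (ofreal r) z ->
    is_derive z (1 : Cplx R) h (h' z) /\
    is_derive z (1 : Cplx R) h' (q z * h z)) ->
  exists c, forall z, slit_disc p (ofreal r) z -> f z * h' z - f' z * h z = c.
Proof.
move=> r0 Hf Hh.
exists (f (p + ofreal (r / 2)) * h' (p + ofreal (r / 2))
  - f' (p + ofreal (r / 2)) * h (p + ofreal (r / 2))) => z Uz.
apply: (@slit_disc_const R p r (fun z => f z * h' z - f' z * h z)) => //; last first.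
  by apply: slit_disc_real; lra.
move=> w Uw; have [f1 f2] := Hf w Uw; have [h1 h2] := Hh w Uw.
apply: is_derive_eq (is_deriveB (is_derive_mul f1 h2) (is_derive_mul f2 h1)) _.
by ring.
Qed.

(** For g_0 = 3/4 the indicial roots are -1/2 and 3/2, and they differ by 2. In terms of the
    smaller root the recursion reads n (n - 2) a_n = sum of g_(n-j) a_j over j < n, so that
    a_0 = alpha and a_2 = beta are free, the latter under one condition. Both Frobenius
    solutions are then of the form x^(-1/2) times a power series. *)
Section Recursion.
Variables (g : nat -> Cplx R) (alpha beta : Cplx R).

(** Course-of-values recursion has to carry the list of all earlier coefficients. *)
Fixpoint frob_prefix n : seq (Cplx R) :=
  if n is m.+1 then
    let s := frob_prefix m in
    rcons s (if m == 0%N then alpha else if m == 2%N then beta else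
      (\sum_(j < m) g (m - j)%N * s`_j) / (m%:R * (m%:R - 2)))
  else [::].

Definition frob_coef n := (frob_prefix n.+1)`_n.

Lemma size_frob_prefix n : size (frob_prefix n) = n.
Proof. by elim: n => //= n IH; rewrite size_rcons IH. Qed.

Lemma nth_frob_prefix n j : (j < n)%N -> (frob_prefix n)`_j = frob_coef j.
Proof.
elim: n => // n IH; rewrite ltnS leq_eqVlt => /orP[/eqP ->//|jn].
by rewrite [frob_prefix _]/= nth_rcons size_frob_prefix jn IH.
Qed.

Lemma frob_coef0 : frob_coef 0 = alpha. Proof. by []. Qed.

Lemma frob_coefE n : frob_coef n =
  if n == 0%N then alpha else if n == 2%N then beta else
    (\sum_(j < n) g (n - j)%N * frob_coef j) / (n%:R * (n%:R - 2)).
Proof.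
rewrite /frob_coef [frob_prefix _]/= nth_rcons size_frob_prefix ltnn eqxx.
case: eqP => // _; case: eqP => // _; congr (_ / _); apply: eq_bigr => j _.
by congr (_ * _); exact: nth_frob_prefix.
Qed.

(** At n = 2 the factor n (n - 2) vanishes and the right-hand side is g_1 a_1 + g_2 a_0
    = (g_2 - g_1^2) a_0: this is the obstruction to a solution without logarithm. *)
Lemma frob_coef_rec : g 0%N = 3 / 4 -> g 2%N = g 1%N ^+ 2 ->
  frobenius_rec g (- (1 / 2)) frob_coef.
Proof.
move=> g0 g2 n.
have -> : conv g frob_coef n =
    g 0%N * frob_coef n + \sum_(j < n) g (n - j)%N * frob_coef j.
  rewrite /conv (reindex_inj rev_ord_inj) /=.
  rewrite (eq_bigr (fun j : 'I_n.+1 => g (n - j)%N * frob_coef j)); last first.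
    by move=> j _; rewrite subSS subKn // -ltnS.
  by rewrite big_ord_recr /= subnn addrC.
suff -> : \sum_(j < n) g (n - j)%N * frob_coef j = n%:R * (n%:R - 2) * frob_coef n.
  by rewrite g0; field.
case: n => [|[|[|n]]].
- by rewrite big_ord0 mulr0n !mul0r.
- rewrite big_ord1 subn0 [frob_coef 1]frob_coefE /= big_ord1 subn0 /=.
  by field.
- rewrite big_ord_recr big_ord1 /= subn0 subSS subn0 [frob_coef 1]frob_coefE /=.
  by rewrite big_ord1 /= subn0 g2; field.
- rewrite [frob_coef n.+3 in RHS]frob_coefE /= mulrC divfK //.
Qed.

(** If |g_n| r^n <= M, then A_n = |a_n| r^n satisfies A_n <= M max(A_j, j < n) for n >=
    3, since the n terms of the recursion are divided by n (n - 2) >= n. Hence A_n grows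
    at most like (M + 1)^n. *)
Lemma tame_frob_coef r : tame g r -> exists2 s, 0 < s <= r & tame frob_coef s.
Proof.
case=> r0 [M gM]; have M0 : 0 <= M.
  by apply: le_trans (gM 0%N); rewrite expr0 mulr1 nrm_ge0.
pose L := M + 1; have L0 : 0 < L by rewrite /L; lra.
have L1 : 1 <= L by rewrite /L; lra.
pose A n := nrm (frob_coef n) * r ^+ n.
have A0 n : 0 <= A n by rewrite mulr_ge0 ?nrm_ge0 ?exprn_ge0 // ltW.
pose K := A 0%N + A 1%N + A 2%N.
have K0 : 0 <= K by rewrite !addr_ge0.
have L1n n : 1 <= L ^+ n by exact: exprn_ege1.
have KL n k : K * L ^+ n <= K * L ^+ (n + k).
  by rewrite exprD ler_wpM2l // ler_peMr // exprn_ge0 // ltW.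
have small n : (n < 3)%N -> A n <= K * L ^+ n.
  move=> n3; apply: (@le_trans _ _ K); last by rewrite ler_peMr.
  have := A0 0%N; have := A0 1%N; have := A0 2%N; rewrite /K.
  by case: n n3 => [|[|[|//]]] _; lra.
have H n : A n <= K * L ^+ n.
  elim/ltn_ind: n => n IH; have [n3|n3] := ltnP n 3; first exact: small.
  have n2 : n%:R * (n%:R - 2) = (n * (n - 2))%:R :> Cplx R.
    by rewrite natrM natrB // ltnW.
  have B : A n * (n%:R * (n - 2)%:R) <= \sum_(j < n) M * (K * L ^+ n.-1).
    rewrite /A frob_coefE (_ : n == 0%N = false); last by lia.
    rewrite (_ : n == 2%N = false); last by lia.
    rewrite n2 nrmM nrmV nrm_nat -natrM mulrAC.
    rewrite divfK; last by rewrite pnatr_eq0; lia.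
    apply: (le_trans (ler_wpM2r (exprn_ge0 n (ltW r0)) (ler_nrm_sum _ _))).
    rewrite mulr_suml; apply: ler_sum => j _; have jn := ltn_ord j.
    have -> : r ^+ n = r ^+ (n - j) * r ^+ j by rewrite -exprD subnK // ltnW.
    rewrite nrmM mulrACA ler_pM ?mulr_ge0 ?nrm_ge0 ?exprn_ge0 ?(ltW r0) //.
    apply: (le_trans (IH _ jn)).
    by have -> : n.-1 = (j + (n.-1 - j))%N; [lia | exact: KL].
  have n0 : 0 < n%:R * (n - 2)%:R :> R by rewrite mulr_gt0 // ltr0n; lia.
  rewrite -(ler_pM2r n0); apply: (le_trans B).
  rewrite sumr_const card_ord -[leLHS]mulr_natl [leRHS]mulrC -mulrA.
  rewrite ler_wpM2l //.
  have -> : K * L ^+ n = L * (K * L ^+ n.-1).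
    by rewrite mulrCA -exprS prednK //; lia.
  rewrite [leRHS]mulrA ler_wpM2r ?mulr_ge0 ?exprn_ge0 ?(ltW L0) //.
  apply: (@le_trans _ _ L); first by rewrite /L; lra.
  by rewrite ler_peMl ?(ltW L0) // ler1n; lia.
exists (r / L); first by rewrite divr_gt0 //= ler_pdivrMr // ler_peMr // ltW.
split; first by rewrite divr_gt0.
exists K => n; rewrite expr_div_n mulrA ler_pdivrMr ?exprn_gt0 //; exact: H.
Qed.

End Recursion.

Lemma frobenius_rec_lin g rho a b c d :
  frobenius_rec g rho a -> frobenius_rec g rho b ->
  frobenius_rec g rho (fun n => c * a n + d * b n).
Proof.
move=> ha hb n; rewrite mulrDr !(mulrCA _ c) !(mulrCA _ d) ha hb /conv.
rewrite !mulr_sumr -big_split /=; apply: eq_bigr => j _.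
by rewrite mulrDr !(mulrCA (g j)).
Qed.

(** The coordinates of f in a fundamental system with Wronskian 2. *)
Lemma cramer2 (f f' y1 y2 d1 d2 : Cplx R) : y1 * d2 - d1 * y2 = 2 ->
  f = (f * d2 - f' * y2) / 2 * y1 + (y1 * f' - d1 * f) / 2 * y2.
Proof.
move=> E; have -> : (f * d2 - f' * y2) / 2 * y1 + (y1 * f' - d1 * f) / 2 * y2 =
  f * (y1 * d2 - d1 * y2) / 2 by ring.
by rewrite E mulfK // pnatr_eq0.
Qed.

(** The series with (a_0, a_2) = (1, 0) and (0, 1) give two solutions x^(-1/2) h_1 and
    x^(-1/2) h_2. Their Wronskian is constant; as the square of x^(-1/2) is 1/x, it is
    the coefficient of x in h_1 h_2' - h_1' h_2, that is, 2. Any other solution is then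
    a combination of them, whose coefficients are Wronskians, hence constants. *)
Theorem log_free_sufficient q p g r : potential_series q p g r ->
  g 0%N = 3 / 4 -> g 2%N = g 1%N ^+ 2 -> log_free_at q p.
Proof.
move=> [tg Hq] g0 g2.
pose a := frob_coef g 1 0; pose b := frob_coef g 0 1.
have [s1 /andP[s10 s1r] ta1] := tame_frob_coef 1 0 tg.
have [s2 /andP[s20 s2r] tb1] := tame_frob_coef 0 1 tg.
pose s := Num.min s1 s2; have s0 : 0 < s by rewrite lt_min s10.
have ss1 : s <= s1 by rewrite ge_min lexx.
have ss2 : s <= s2 by rewrite ge_min lexx orbT.
have ta : tame a s by apply: tame_le ta1; rewrite s0.
have tb : tame b s by apply: tame_le tb1; rewrite s0.
have ps : potential_series q p g s.
  split; first by apply: tame_le tg; rewrite s0 (le_trans ss1).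
  by move=> z z0 zs; apply: Hq => //; lra.
pose U := slit_disc p (ofreal s).
pose phi z := (csqrt (z - p))^-1.
have hphi : power_branch p (- (1 / 2)) U phi by exact: power_branch_sqrt_inv.
pose h1 z := pser a (z - p); pose h2 z := pser b (z - p).
have reca : frobenius_rec g (- (1 / 2)) a by exact: frob_coef_rec.
have recb : frobenius_rec g (- (1 / 2)) b by exact: frob_coef_rec.
have lin C1 C2 z : U z -> C1 * (phi z * h1 z) + C2 * (phi z * h2 z)
    = phi z * pser (fun n => C1 * a n + C2 * b n) (z - p).
  by move=> Uz; rewrite (pser_lin _ _ ta tb) ?(slit_disc_nrm Uz) // /h1 /h2; ring.
have tlin C1 C2 : tame (fun n => C1 * a n + C2 * b n) s.
  by apply: tameD; apply: tameZ.
have a0 : a 0%N = 1 by []. have b0 : b 0%N = 0 by [].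
have a2 : a 2%N = 0 by rewrite /a frob_coefE.
have b2 : b 2%N = 1 by rewrite /b frob_coefE.
exists (ofreal s), (- (1 / 2)), (- (1 / 2)), phi, phi, h1, h2 => U' y.
split => //.
- by rewrite -ofreal0 ofreal_lt.
- by split; exact: tame_power_series_on.
- move=> C1 C2 H.
  have Z := @pser_eq0 _ (fun n => C1 * a n + C2 * b n) s s (tlin C1 C2) s0.
  have {}Z n : C1 * a n + C2 * b n = 0.
    apply: Z => t ts; have Ut := slit_disc_real p ts.
    have := H _ Ut; rewrite /y lin // => /eqP; rewrite mulf_eq0.
    have [phi0 _] := hphi _ Ut; rewrite (negPf phi0) /= addrAC subrr add0r.
    by move/eqP.
  have := Z 0%N; have := Z 2%N.
  by rewrite a0 b0 a2 b2 !mulr0 !mulr1 add0r addr0.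
- move=> f; split; last first.
    case=> C1 [C2 Hf].
    have S := frobenius_rec_solution ps (tlin C1 C2) hphi
      (frobenius_rec_lin C1 C2 reca recb).
    apply: (@ode_solution_ext q p s (fun w => phi w *
      pser (fun n => C1 * a n + C2 * b n) (w - p))).
      by move=> z Uz; rewrite Hf // /y lin.
    by eexists => z Uz; exact: S.
  case=> f' Hf.
  pose d c z := phi z * (- (1 / 2) * pser c (z - p) / (z - p) + pser (pderiv c) (z - p)).
  have S1 z (Uz : U z) := frobenius_rec_solution ps ta hphi reca Uz.
  have S2 z (Uz : U z) := frobenius_rec_solution ps tb hphi recb Uz.
  have [w Hw] := @wronskian_const q p s _ (d a) _ (d b) s0 S1 S2.
  have [c1 Hc1] := wronskian_const s0 Hf S2.
  have [c2 Hc2] := wronskian_const s0 S1 Hf.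
  (* Here phi^2 = 1/x, so w x is the sum of the series h_1 h_2' - h_1' h_2. *)
  have w2 : w = 2.
    pose e n := conv a (pderiv b) n - conv (pderiv a) b n - w * (n == 1%N)%:R.
    have s2' : 0 < s / 2 / 2 < s / 2 by lra.
    have da : tame (pderiv a) (s / 2) by apply: tame_pderiv ta; lra.
    have db : tame (pderiv b) (s / 2) by apply: tame_pderiv tb; lra.
    have ta' : tame a (s / 2) by apply: tame_le ta; lra.
    have tb' : tame b (s / 2) by apply: tame_le tb; lra.
    have t1 : tame (fun n => (n == 1%N)%:R) (s / 2 / 2).
      split; first by lra.
      exists (s / 2 / 2) => n; rewrite nrm_nat; case: eqP => [->|_].
        by rewrite mul1r expr1.
      by rewrite mul0r; lra.
    have te : tame e (s / 2 / 2).
      have := tameD (tameD (tame_conv s2' ta' db)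
        (tameZ (-1) (tame_conv s2' da tb'))) (tameZ (- w) t1).
      by congr (tame _ _); apply/funext => n; rewrite /e !mulNr mul1r.
    have e1 : e 1%N = 0.
      apply: (pser_eq0 te (s := s / 2)); first by lra.
      move=> t ht; apply: psum_pser.
      have Ut : U (p + ofreal t) by apply: slit_disc_real; lra.
      have tn : nrm (ofreal t) < s / 2 by rewrite nrm_ofreal gtr0_norm; lra.
      have tx0 : ofreal t != 0 by rewrite ofreal_eq0 gt_eqF //; lra.
      have H1 := psum_conv ta' db tn; have H2 := psum_conv da tb' tn.
      have H3 : psum (fun n => (n == 1%N)%:R) (ofreal t) (ofreal t).
        have := @has_sum_finite R _ (fun n => (n == 1%N)%:R * ofreal t ^+ n)
          [:: 1%N] isT.
        rewrite big_seq1 eqxx mul1r expr1; apply=> n; rewrite inE => /negPf ->.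
        by rewrite mul0r.
      have E := Hw _ Ut.
      have phi2 : phi (p + ofreal t) ^+ 2 = (ofreal t)^-1.
        by rewrite /phi exprVn csqrtK addrAC subrr add0r.
      rewrite /d (addrAC p) subrr add0r in E.
      have {}E : phi (p + ofreal t) ^+ 2 * (pser a (ofreal t) *
          pser (pderiv b) (ofreal t) - pser (pderiv a) (ofreal t)
          * pser b (ofreal t)) = w.
        have alg (F A B A' B' k V : Cplx R) : F * A * (F * (k * B / V + B'))
            - F * (k * A / V + A') * (F * B) = F ^+ 2 * (A * B' - A' * B).
          by ring.
        by rewrite -E alg.
      rewrite phi2 in E.
      have {}E : pser a (ofreal t) * pser (pderiv b) (ofreal t)
        - pser (pderiv a) (ofreal t) * pser b (ofreal t) - w * ofreal t = 0.
        by rewrite -E [_ * ofreal t]mulrC mulrA divff // mul1r subrr.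
      have := has_sumB (has_sumB H1 H2) (has_sumZ w H3); rewrite E.
      by apply: eq_has_sum => n; rewrite /e !mulrBl !mulrA.
    have b1 : b 1%N = 0.
      by rewrite /b frob_coefE /= big_ord1 /= frob_coef0 mulr0 mul0r.
    move: e1; rewrite /e /conv !big_ord_recr !big_ord0 /= /pderiv.
    rewrite a0 b0 b1 b2 a2 => /eqP; rewrite subr_eq0 => /eqP H.
    by rewrite -[LHS]mulr1 -H subn0 subnn; ring.
  exists (c1 / 2), (c2 / 2) => z Uz.
  rewrite /y -(Hc1 z Uz) -(Hc2 z Uz) /h1 /h2.
  by apply: cramer2; exact: etrans (Hw z Uz) w2.
Qed.

(** Moving a factor x^m from the power series to the power of x. *)
Lemma frobenius_rec_drop g rho a m : (forall n, (n < m)%N -> a n = 0) ->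
  frobenius_rec g rho a -> frobenius_rec g (rho + m%:R) (fun n => a (m + n)%N).
Proof.
move=> a0 rec n; have := rec (m + n)%N; rewrite natrD addrA => ->.
rewrite /conv (big_ord_widen (m + n).+1 (fun j => g j * a (m + (n - j))%N)).
  rewrite [RHS]big_mkcond /=; apply: eq_bigr => j _; case: ltnP => jn.
    by congr (_ * a _); rewrite addnBA // -ltnS.
  by rewrite a0 ?mulr0 //; have := ltn_ord j; lia.
by rewrite ltnS leq_addl.
Qed.

Lemma conv_recl g a n : conv g a n.+1 = g 0%N * a n.+1 + \sum_(j < n.+1) g j.+1 * a (n - j)%N.
Proof. by rewrite /conv big_ord_recl subn0. Qed.

(** If m is the order of vanishing of the series, then rho + m is an indicial root. For
    the root -1/2 the coefficients of order 0, 1 and 2 give g_2 = g_1^2, so only 3/2 is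
    left. *)
Lemma indicial_root_three_halves g rho a : g 0%N = 3 / 4 -> g 2%N != g 1%N ^+ 2 ->
  frobenius_rec g rho a -> (exists n, a n != 0) ->
  exists m, [/\ forall n, (n < m)%N -> a n = 0, a m != 0 & rho + m%:R = 3 / 2].
Proof.
move=> g0 g2 rec ex; pose m := ex_minn ex; exists m.
have [am min_m] : a m != 0 /\ forall n, a n != 0 -> (m <= n)%N.
  by rewrite /m; case: ex_minnP.
have a0 n : (n < m)%N -> a n = 0.
  by move=> nm; apply/eqP; apply: contraTT nm => /min_m; rewrite -leqNgt.
split=> //; have {}rec := frobenius_rec_drop a0 rec.
set s := rho + m%:R in rec *.
have b0 : a (m + 0)%N != 0 by rewrite addn0.
have E0 := rec 0%N; rewrite /conv big_ord1 subn0 mulr0n addr0 g0 in E0.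
have {E0} : (s + 1 / 2) * (s - 3 / 2) = 0.
  by apply: (mulIf b0); rewrite mul0r -[RHS](subrr (3 / 4 * a (m + 0)%N)) -{1}E0; field.
move/eqP; rewrite mulf_eq0 => /orP[|]; last by rewrite subr_eq0 => /eqP.
rewrite addr_eq0 => /eqP sE; have E1 := rec 1%N; have E2 := rec 2%N.
rewrite conv_recl big_ord1 /= subn0 g0 sE in E1.
rewrite conv_recl big_ord_recl big_ord1 /= g0 sE subn0 subnn in E2.
have {}E1 : a (m + 1)%N = - g 1%N * a (m + 0)%N.
  apply/eqP; rewrite -subr_eq0 mulNr opprK addrC.
  have -> : g 1%N * a (m + 0)%N + a (m + 1)%N = (3 / 4 * a (m + 1)%N + g 1%N * a (m + 0)%N)
    + 1 / 4 * a (m + 1)%N by field.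
  by rewrite -E1; apply/eqP; field.
case/negP: g2; rewrite -subr_eq0; apply/eqP; apply: (mulIf b0); rewrite mul0r.
have -> : (g 2%N - g 1%N ^+ 2) * a (m + 0)%N = (3 / 4 * a (m + 2)%N +
  (g 1%N * (- g 1%N * a (m + 0)%N) + g 2%N * a (m + 0)%N)) - 3 / 4 * a (m + 2)%N.
  by ring.
by rewrite -E1 -E2; field.
Qed.

(** For the larger root, n (n + 2) never vanishes and the recursion determines
    everything from the constant coefficient. *)
Lemma frobenius_rec_unique g b c : g 0%N = 3 / 4 ->
  frobenius_rec g (3 / 2) b -> frobenius_rec g (3 / 2) c ->
  forall n, c 0%N * b n = b 0%N * c n.
Proof.
move=> g0 hb hc n; apply/eqP; rewrite -subr_eq0; apply/eqP.
pose d n := c 0%N * b n + (- b 0%N) * c n.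
have hd : frobenius_rec g (3 / 2) d by exact: frobenius_rec_lin.
suff : d n = 0 by rewrite /d mulNr.
elim/ltn_ind: n => -[_|n IH]; first by rewrite /d mulNr mulrC subrr.
have := hd n.+1; rewrite conv_recl big1; last first.
  by move=> j _; rewrite IH ?mulr0 // ltnS leq_subr.
rewrite addr0 g0 => E.
have : n.+1%:R * n.+3%:R * d n.+1 = 0.
  rewrite -[RHS](subrr (3 / 4 * d n.+1)) -{1}E -(natr1 n) -[n.+3%:R]natr1 -[n.+2%:R]natr1 -(natr1 n).
  by field.
by move/eqP; rewrite !mulf_eq0 !pnatr_eq0 /= => /eqP.
Qed.

(** If g_2 <> g_1^2, both solutions of the fundamental system belong to the root 3/2.
    The recursion makes their power series proportional, and the branches of x^(3/2) are
    proportional too, against linear independence. *)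
Theorem log_free_necessary q p g r : potential_series q p g r ->
  g 0%N = 3 / 4 -> log_free_at q p -> g 2%N = g 1%N ^+ 2.
Proof.
move=> [tg Hq] g0 [t' [rho1 [rho2 [phi1 [phi2 [h1 [h2 [t0 [b1 b2] [s1 s2] indep sols]]]]]]]].
have r0 : 0 < r by case: tg.
case: (posC_real t0) => t {}t0 E; subst t'.
apply/eqP; apply/negPn/negP => g2.
pose U := slit_disc p (ofreal t).
pose s := Num.min t r / 2.
have m0 : 0 < Num.min t r by rewrite lt_min t0.
have m1 : Num.min t r <= t by rewrite ge_min lexx.
have m2 : Num.min t r <= r by rewrite ge_min lexx orbT.
have ps : potential_series q p g s.
  split; first by apply: tame_le tg; rewrite /s; lra.
  by move=> z z0 zs; apply: Hq => //; rewrite /s in zs; lra.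
have main rho phi h : power_branch p rho U phi -> power_series_on p (ofreal t) h ->
    (exists2 z, U z & h z != 0) ->
    ode_solution q U (fun z => phi z * h z) ->
    exists m b, [/\ b 0%N != 0, rho + m%:R = 3 / 2, frobenius_rec g (3 / 2) b &
      forall z, U z -> psum b (z - p) (h z / (z - p) ^+ m)].
  move=> hphi /(power_series_on_tame t0)[a [ta ha]] [z Uz hz] sol.
  have tas : tame a s by apply: ta; rewrite /s; lra.
  have rec : frobenius_rec g rho a.
    apply: (solution_frobenius_rec (r := s) (t := t) _ _ ps tas hphi _ sol).
    - by rewrite /s; lra.
    - by rewrite /s; lra.
    - by move=> w ws; symmetry; apply: psum_pser; apply: ha; rewrite /s in ws; lra.
  have ex : exists n, a n != 0.
    apply: contrapT => /forallNP H; case/negP: hz; apply/eqP.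
    apply: (has_sum_unique (ha z (slit_disc_nrm Uz))).
    have := @has_sum_finite R _ (fun n => a n * (z - p) ^+ n) [::] isT.
    rewrite big_nil; apply=> n _; have := H n; move/negP; rewrite negbK.
    by move/eqP ->; rewrite mul0r.
  have [m [am0 am mE]] := indicial_root_three_halves g0 g2 rec ex.
  exists m, (fun n => a (m + n)%N); rewrite addn0; split=> //.
    by rewrite -mE; exact: frobenius_rec_drop.
  move=> w Uw; apply: psum_drop => //; first exact: slit_disc_neq0 Uw.
  exact/ha/(slit_disc_nrm Uw).
have nz h phi C1 C2 : (C1, C2) != 0 ->
    (forall z, C1 * (phi1 z * h1 z) + C2 * (phi2 z * h2 z) = phi z * h z) ->
    exists2 z, U z & h z != 0.
  move=> C12 E; apply: contrapT => H.
  have [c1 c2] : C1 = 0 /\ C2 = 0.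
    apply: indep => z Uz; rewrite E; apply/eqP; rewrite mulf_eq0 orbC.
    by apply/orP; left; apply/negPn/negP => hz; apply: H; exists z.
  by rewrite c1 c2 eqxx in C12.
have [k1 [c1 [c10 e1 rec1 sum1]]] : exists m b, [/\ b 0%N != 0, rho1 + m%:R = 3 / 2,
      frobenius_rec g (3 / 2) b &
      forall z, U z -> psum b (z - p) (h1 z / (z - p) ^+ m)].
  apply: main b1 s1 _ _.
    apply: (nz _ phi1 1 0) => [|z]; last by rewrite mul1r mul0r addr0.
    by rewrite xpair_eqE oner_eq0.
  by apply/sols; exists 1, 0 => z _; rewrite mul1r mul0r addr0.
have [k2 [c2 [c20 e2 rec2 sum2]]] : exists m b, [/\ b 0%N != 0, rho2 + m%:R = 3 / 2,
      frobenius_rec g (3 / 2) b &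
      forall z, U z -> psum b (z - p) (h2 z / (z - p) ^+ m)].
  apply: main b2 s2 _ _.
    apply: (nz _ phi2 0 1) => [|z]; last by rewrite mul1r mul0r add0r.
    by rewrite xpair_eqE oner_eq0 andbF.
  by apply/sols; exists 0, 1 => z _; rewrite mul1r mul0r add0r.
have B1 := power_branchM b1 (@power_branchX _ p t k1).
have B2 := power_branchM b2 (@power_branchX _ p t k2).
rewrite e1 in B1; rewrite e2 in B2.
have [k Hk] := power_branch_unique t0 B1 B2.
have [] : c2 0%N = 0 /\ - (k * c1 0%N) = 0; last by move/eqP: c20.
apply: indep => z Uz; have z0 := slit_disc_neq0 Uz.
have H : c2 0%N * (h1 z / (z - p) ^+ k1) = c1 0%N * (h2 z / (z - p) ^+ k2).
  apply: has_sum_unique (has_sumZ _ (sum1 z Uz)) _.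
  apply: eq_has_sum (has_sumZ (c1 0%N) (sum2 z Uz)) => n.
  by rewrite !mulrA (frobenius_rec_unique g0 rec1 rec2).
have -> : c2 0%N * (phi1 z * h1 z) =
    (phi1 z * (z - p) ^+ k1) * (c2 0%N * (h1 z / (z - p) ^+ k1)).
  by field; rewrite expf_neq0.
have -> : - (k * c1 0%N) * (phi2 z * h2 z) =
    - (k * (phi2 z * (z - p) ^+ k2) * (c1 0%N * (h2 z / (z - p) ^+ k2))).
  by field; rewrite expf_neq0.
by rewrite H (Hk z Uz) subrr.
Qed.

End Frobenius.

(** * The Weierstrass functions as lattice sums *)

Section LatticeSums.
Variables (R : realType) (tau : Cplx R).
Hypothesis htau : 0 < complex.Im tau.
Implicit Types (k l : int * int) (z a x : Cplx R).

Definition lat k : Cplx R := lattice_point tau k.1 k.2.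

Lemma latD k l : lat (k + l) = lat k + lat l.
Proof. by rewrite /lat /lattice_point !rmorphD /=; ring. Qed.

Lemma latN k : lat (- k) = - lat k.
Proof. by rewrite /lat /lattice_point !rmorphN /=; ring. Qed.

Lemma lat0 : lat 0 = 0.
Proof. by rewrite /lat /lattice_point /= mul0r addr0. Qed.

(** The constant of the comparison |m| + |n| <= lat_const * |m + n tau|, which expresses
    that 1 and tau are linearly independent over the reals. *)
Definition lat_const : R := 1 + (1 + nrm tau) / complex.Im tau.

Lemma lat_const_gt0 : 0 < lat_const.
Proof. by rewrite ltr_wpDr // divr_ge0 ?(ltW htau) // addr_ge0 ?nrm_ge0. Qed.

Lemma coord_le (a b : R) :
  `|a| + `|b| <= lat_const * nrm (ofreal a + ofreal b * tau).
Proof.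
set z := ofreal a + _.
have Ez : z = ofreal a + ofreal b * tau by [].
have hb : `|b| <= nrm z / complex.Im tau.
  rewrite ler_pdivlMr // -(gtr0_norm htau) -normrM.
  apply: le_trans (nrm_Im_le z); rewrite Ez.
  by case: tau => u v /=; rewrite mul0r !addr0 add0r.
have ha : `|a| <= nrm z + nrm tau * `|b|.
  have -> : `|a| = nrm (z - ofreal b * tau) by rewrite Ez addrK nrm_ofreal.
  by apply: le_trans (ler_nrmB _ _) _; rewrite nrmM nrm_ofreal mulrC.
have H := ler_wpM2l (addr_ge0 ler01 (nrm_ge0 tau)) hb.
rewrite /lat_const mulrDl mul1r mulrAC -mulrA; lra.
Qed.

Lemma ofreal_int (m : int) : ofreal (m%:~R : R) = m%:~R.
Proof. exact: (rmorph_int (real_complex R)). Qed.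

Definition height k : nat := (`|k.1|%N + `|k.2|%N)%N.

Lemma heightE k : (height k)%:R = `|k.1%:~R| + `|k.2%:~R| :> R.
Proof. by rewrite natrD -!intr_norm -!abszE !pmulrn. Qed.

Lemma height_le k : (height k)%:R <= lat_const * nrm (lat k).
Proof. by rewrite heightE; have := coord_le k.1%:~R k.2%:~R; rewrite !ofreal_int. Qed.

Lemma height_eq0 k : (height k == 0%N) = (k == 0).
Proof.
case: k => m n; rewrite /height addn_eq0 !absz_eq0 /=.
by rewrite -[(m, n) == 0]/((m == 0) && (n == 0)).
Qed.

Lemma lat_eq0 k : (lat k == 0) = (k == 0).
Proof.
apply/eqP/eqP => [H|->]; last exact: lat0.
apply/eqP; rewrite -height_eq0 -leqn0 -(ler_nat R).
by have := height_le k; rewrite H nrm0 mulr0.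
Qed.

Lemma lat_inj : injective lat.
Proof.
move=> k l E; apply/eqP; rewrite -subr_eq0 -lat_eq0 latD latN E subrr //.
Qed.

(** A substitute for 1 / height^3 whose double sum telescopes twice. *)
Definition weight k : R :=
  ((height k).+1%:R * (height k).+2%:R * (height k).+3%:R)^-1.

Lemma weight_inner (m n : nat) :
  \sum_(j < n) (((m + j).+1%:R * (m + j).+2%:R * (m + j).+3%:R)^-1 : R)
  = (2 * (m.+1%:R * m.+2%:R))^-1 - (2 * ((m + n).+1%:R * (m + n).+2%:R))^-1.
Proof.
elim: n => [|n IH]; first by rewrite big_ord0 addn0 subrr.
rewrite big_ord_recr /= IH addnS; set q := (m + n)%N.
have E3 : q.+3%:R = q.+1%:R + 2 :> R by rewrite -addn2 natrD.
have E2 : q.+2%:R = q.+1%:R + 1 :> R by rewrite -addn1 natrD.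
have n1 : q.+1%:R != 0 :> R by rewrite pnatr_eq0.
have n2 : q.+1%:R + 1 != 0 :> R by rewrite -E2 pnatr_eq0.
have n3 : q.+1%:R + 2 != 0 :> R by rewrite -E3 pnatr_eq0.
rewrite E3 E2; move: (q.+1%:R) (2 * _)^-1 n1 n2 n3 => x y n1 n2 n3.
by field; rewrite n1 n2 n3.
Qed.

Lemma weight_outer (n : nat) :
  \sum_(m < n) ((2 * (m.+1%:R * m.+2%:R))^-1 : R) = 2^-1 - (2 * n.+1%:R)^-1.
Proof.
elim: n => [|n IH]; first by rewrite big_ord0 mulr1 subrr.
rewrite big_ord_recr /= IH -[n.+2%:R]natr1.
have n1 : n.+1%:R != 0 :> R by rewrite pnatr_eq0.
have n2 : n.+1%:R + 1 != 0 :> R by rewrite natr1 pnatr_eq0.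
by move: (n.+1%:R) n1 n2 => x n1 n2; field; rewrite n1 n2.
Qed.

Lemma weight_ge0 k : 0 <= weight k.
Proof. by rewrite invr_ge0 !mulr_ge0. Qed.

Definition int_range (N : nat) : seq int :=
  [seq Posz i | i <- iota 0 N] ++ [seq - Posz i | i <- iota 0 N].

Lemma mem_int_range (N : nat) (m : int) : (`|m| < N)%N -> m \in int_range N.
Proof.
move=> mN; rewrite mem_cat; case: (lerP 0 m) => m0; apply/orP; [left|right].
  by apply/mapP; exists `|m|%N; [rewrite mem_iota | rewrite gez0_abs].
by apply/mapP; exists `|m|%N; [rewrite mem_iota | rewrite ltz0_abs // opprK].
Qed.

Lemma sum_int_range (N : nat) (G : int -> R) :
  \sum_(m <- int_range N) G m = \sum_(i < N) G i + \sum_(i < N) G (- (i : int)).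
Proof.
rewrite big_cat !big_map; have -> : iota 0 N = index_iota 0 N.
  by rewrite /index_iota subn0.
by rewrite !big_mkord.
Qed.

Lemma weight_sums_le : sums_le weight 2.
Proof.
move=> s us; pose N := (\max_(k <- s) height k).+1.
pose L := int_range N.
apply: (@le_trans _ _ (\sum_(k <- [seq (i, j) | i <- L, j <- L]) weight k)).
  apply: ler_sum_subset => //; first exact: weight_ge0.
  move=> [m n] ks; have kN : (height (m, n) < N)%N.
    by rewrite ltnS; apply: (@leq_bigmax_seq _ s xpredT height).
  by apply/allpairsP; exists (m, n); split=> //; apply: mem_int_range; rewrite /height /= in kN *; lia.
pose S := \sum_(i < N) \sum_(j < N) (((i + j).+1%:R * (i + j).+2%:R * (i + j).+3%:R)^-1 : R).
have -> : \sum_(k <- [seq (i, j) | i <- L, j <- L]) weight k = 4 * S.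
  have inner (m : int) : \sum_(j <- L) weight (m, j) =
      2 * \sum_(j < N) (((`|m| + j).+1%:R * (`|m| + j).+2%:R * (`|m| + j).+3%:R)^-1 : R).
    rewrite sum_int_range [2]mulr2n mulrDl mul1r; congr (_ + _).
    by apply: eq_bigr => j _; rewrite /weight /height /= abszN.
  rewrite big_allpairs (eq_bigr _ (fun m _ => inner m)) -mulr_sumr.
  rewrite sum_int_range /= -/S.
  under [X in _ + X]eq_bigr do rewrite abszN.
  by rewrite /S /=; ring.
have -> : (2 : R) = 4 * 2^-1 by field.
rewrite ler_pM2l //; apply: le_trans (_ : 2^-1 - (2 * N.+1%:R)^-1 <= _); last first.
  by rewrite gerBl invr_ge0 mulr_ge0.
rewrite -weight_outer; apply: ler_sum => i _; rewrite weight_inner gerBl.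
by rewrite invr_ge0 !mulr_ge0.
Qed.

Lemma lat_large (K : R) : exists s : seq (int * int),
  forall k, k \notin s -> K <= nrm (lat k).
Proof.
pose N := (Num.bound `|K * lat_const|).+1.
pose L := int_range N.
exists [seq (i, j) | i <- L, j <- L] => -[m n] kL.
have H : (N <= height (m, n))%N.
  rewrite leqNgt; apply: contra kL => kN; apply/allpairsP; exists (m, n).
  by split=> //; apply: mem_int_range; rewrite /height /= in kN *; lia.
rewrite -(ler_pM2r lat_const_gt0) [leRHS]mulrC; apply: le_trans (height_le _).
apply: le_trans (_ : N%:R <= _); last by rewrite ler_nat.
by apply: le_trans (ler_norm _) _; rewrite -natr1 ler_wpDr // ltW // archi_boundP.
Qed.

(** Comparison with the weight: its denominator is at most 24 height^3 outside the
    origin. *)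
Lemma lat_abs_summable (F : int * int -> Cplx R) (D : R) (s : seq (int * int)) :
  (forall k, k \notin s -> nrm (F k) <= D / nrm (lat k) ^+ 3) -> abs_summable F.
Proof.
move=> HF.
pose E := D * (24 * lat_const ^+ 3).
have H := abs_summableZ (ofreal E) (abs_summable_ofreal weight_ge0 weight_sums_le).
apply: (abs_summable_dom (s0 := 0 :: s)) H => k.
rewrite inE negb_or => /andP[k0 ks]; apply: (le_trans (HF k ks)).
have n0 : 0 < nrm (lat k) by rewrite nrm_gt0 lat_eq0.
have D0 : 0 <= D.
  have := le_trans (nrm_ge0 _) (HF k ks).
  by rewrite pmulr_lge0 // invr_gt0 exprn_gt0.
rewrite nrmM !nrm_ofreal (ger0_norm (weight_ge0 k)) ger0_norm; last first.
  by rewrite /E !mulr_ge0 ?exprn_ge0 // ltW // lat_const_gt0.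
rewrite /E -(mulrA D) ler_wpM2l // /weight ler_pdivlMr ?mulr_gt0 //.
rewrite [leLHS]mulrC ler_pdivrMr ?exprn_gt0 // -(mulrA 24) -exprMn.
have h1 : 1 <= (height k)%:R :> R by rewrite ler1n lt0n height_eq0.
apply: (@le_trans _ _ (24 * (height k)%:R ^+ 3)); last first.
  by rewrite ler_wpM2l // lerXn2r ?nnegrE ?height_le // mulr_ge0 ?nrm_ge0 // ltW // lat_const_gt0.
set h := (height k) in h1 *.
have E1 : h.+1%:R = h%:R + 1 :> R by rewrite -addn1 natrD.
have E2 : h.+2%:R = h%:R + 2 :> R by rewrite -addn2 natrD.
have E3 : h.+3%:R = h%:R + 3 :> R by rewrite -addn3 natrD.
rewrite E1 E2 E3; move: (h%:R : R) h1 => y y1.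
have H1 : (y + 1) * (y + 2) <= (2 * y) * (3 * y) by apply: ler_pM; lra.
have H2 : (y + 1) * (y + 2) * (y + 3) <= (2 * y) * (3 * y) * (4 * y).
  by apply: ler_pM => //; [apply: mulr_ge0; lra | lra | lra].
by apply: le_trans H2 _; rewrite le_eqVlt; apply/orP; left; apply/eqP; ring.
Qed.

(** Terms of the two series. As 0^-1 = 0, the term of the origin is 1/z, respectively
    1/z^2, and both functions have definite values at their poles, for which the
    symmetry and the periodicity below hold without exception. *)
Definition zeta_term z k : Cplx R := (z - lat k)^-1 + (lat k)^-1 + z / lat k ^+ 2.

Definition wp_term z k : Cplx R := ((z - lat k) ^+ 2)^-1 - (lat k ^+ 2)^-1.

Lemma lat_far z : exists s : seq (int * int), forall k, k \notin s ->
  [/\ lat k != 0, z - lat k != 0 & nrm (lat k) / 2 <= nrm (z - lat k)].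
Proof.
have [s Hs] := lat_large (2 * nrm z + 1); exists s => k /Hs H.
have z0 := nrm_ge0 z; have := ler_subnrm (lat k) z; rewrite nrmC => H1.
by rewrite -!nrm_gt0; split; lra.
Qed.

Lemma zeta_term_summable z : abs_summable (zeta_term z).
Proof.
have [s Hs] := lat_far z.
apply: (@lat_abs_summable _ (2 * nrm z ^+ 2) s) => k /Hs[w0 zw0 H].
have -> : zeta_term z k = z ^+ 2 / (lat k ^+ 2 * (z - lat k)).
  by rewrite /zeta_term; field; rewrite zw0 w0.
have n0 : 0 < nrm (lat k) by rewrite nrm_gt0.
rewrite nrmM nrmX nrmV nrmM nrmX [2 * _]mulrC -(mulrA (nrm z ^+ 2)).
rewrite ler_wpM2l ?exprn_ge0 ?nrm_ge0 //.
rewrite -[2]invrK -invfM lef_pV2 ?posrE ?mulr_gt0 ?exprn_gt0 ?invr_gt0 ?nrm_gt0 //.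
by rewrite (exprSr _ 2) mulrCA ler_wpM2l ?exprn_ge0 ?nrm_ge0 // mulrC.
Qed.

Lemma wp_term_summable z : abs_summable (wp_term z).
Proof.
have [s Hs] := lat_far z; have [s' Hs'] := lat_large (2 * nrm z).
apply: (@lat_abs_summable _ (12 * nrm z) (s ++ s')) => k.
rewrite mem_cat negb_or => /andP[/Hs[w0 zw0 H] /Hs' H'].
have -> : wp_term z k = z * (lat k * 2 - z) / (lat k ^+ 2 * (z - lat k) ^+ 2).
  by rewrite /wp_term; field; rewrite zw0 w0.
have n0 : 0 < nrm (lat k) by rewrite nrm_gt0.
rewrite nrmM nrmV nrmM [nrm (_ ^+ 2 * _)]nrmM !nrmX.
rewrite [12 * _]mulrC -(mulrA (nrm z)) -(mulrA (nrm z)) ler_wpM2l ?nrm_ge0 //.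
rewrite ler_pdivrMr ?mulr_gt0 ?exprn_gt0 ?nrm_gt0 //.
rewrite mulrAC ler_pdivlMr ?exprn_gt0 //.
have z0 := nrm_ge0 z.
have H1 : nrm (lat k * 2 - z) <= 3 * nrm (lat k).
  by apply: le_trans (ler_nrmB _ _) _; rewrite nrmM nrm_nat; lra.
apply: (@le_trans _ _ (3 * nrm (lat k) * nrm (lat k) ^+ 3)).
  by rewrite ler_wpM2r // exprn_ge0 // ltW.
have H2 : nrm (lat k) ^+ 2 / 4 <= nrm (z - lat k) ^+ 2.
  have -> : nrm (lat k) ^+ 2 / 4 = (nrm (lat k) / 2) ^+ 2 by field.
  by rewrite lerXn2r // nnegrE ?nrm_ge0 // divr_ge0 // ltW.
have := ler_wpM2l (exprn_ge0 2 (ltW n0)) H2; set u := nrm _ => H3.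
have -> : 3 * u * u ^+ 3 = 12 * (u ^+ 2 * (u ^+ 2 / 4)) by field.
by rewrite ler_pM2l.
Qed.

(** The boxes exhaust the lattice, so that the limit over boxes is the unconditional sum. *)
Lemma lattice_sumE (F : Cplx R -> Cplx R) S :
  has_sum (fun k => if k == 0 then 0 else F (lat k)) S -> lattice_sum tau F = S.
Proof.
move=> hS; apply: cvg_lim; first exact: norm_hausdorff.
apply/cvg_nrm => e e0; have [s0 hs] := hS e e0.
exists (\max_(k <- s0) height k) => N HN /=.
pose t := [seq (i%:Z - N%:Z, j%:Z - N%:Z) | i <- iota 0 N.*2.+1, j <- iota 0 N.*2.+1].
have -> : \sum_(i < N.*2.+1) \sum_(j < N.*2.+1 |
     lattice_point tau (i%:Z - N%:Z) (j%:Z - N%:Z) != 0)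
     F (lattice_point tau (i%:Z - N%:Z) (j%:Z - N%:Z)) =
   \sum_(k <- t) (if k == 0 then 0 else F (lat k)).
  have E : iota 0 N.*2.+1 = index_iota 0 N.*2.+1 by rewrite /index_iota subn0.
  rewrite big_allpairs_dep E big_mkord; apply: eq_bigr => i _.
  rewrite big_mkord big_mkcond /=; apply: eq_bigr => j _.
  rewrite -[lattice_point _ _ _]/(lat (i%:Z - N%:Z, j%:Z - N%:Z)) lat_eq0.
  by case: eqP.
apply: hs.
  rewrite allpairs_uniq ?iota_uniq // => -[i j] [i' j'] _ _ [].
  by move=> /addIr [->] /addIr [->].
move=> [m n] ks; have := @leq_bigmax_seq _ s0 xpredT height _ ks isT.
move=> /leq_trans/(_ HN); rewrite /height /= => H.
apply/allpairsP; exists (absz (m + N%:Z), absz (n + N%:Z)); rewrite !mem_iota /=.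
split; [lia|lia|]; rewrite !gez0_abs; last by lia. 
  by rewrite !addrK.
by lia.
Qed.

Lemma has_sum_zeta z : has_sum (zeta_term z) (wzeta tau z).
Proof.
have [S hS] := abs_summable_has_sum (zeta_term_summable z).
suff -> : wzeta tau z = S by [].
rewrite /wzeta (@lattice_sumE _ (S - z^-1)) ?subrKC //.
have := @has_sum_finite R _ (fun k => if k == 0 then z^-1 else 0) [:: (0 : int * int)] isT.
rewrite big_seq1 eqxx => /(_ _) H0.
have := has_sumB hS (H0 _) => /(_ _) H; apply: eq_has_sum (H _) => [k|k].
  rewrite /zeta_term; case: eqP => [->|_]; last by rewrite subr0.
  by rewrite lat0 subr0 invr0 addr0 expr0n invr0 mulr0 addr0 subrr.
by rewrite inE => /negPf ->.
Qed.

Lemma has_sum_wp z : has_sum (wp_term z) (wp tau z).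
Proof.
have [S hS] := abs_summable_has_sum (wp_term_summable z).
suff -> : wp tau z = S by [].
rewrite /wp (@lattice_sumE _ (S - (z ^+ 2)^-1)) ?subrKC //.
have := @has_sum_finite R _ (fun k => if k == 0 then (z ^+ 2)^-1 else 0) [:: (0 : int * int)] isT.
rewrite big_seq1 eqxx => /(_ _) H0.
have := has_sumB hS (H0 _) => /(_ _) H; apply: eq_has_sum (H _) => [k|k].
  rewrite /wp_term; case: eqP => [->|_]; last by rewrite subr0.
  by rewrite lat0 subr0 expr0n invr0 subr0 subrr.
by rewrite inE => /negPf ->.
Qed.

Lemma has_sum_opp (F : int * int -> Cplx R) S :
  has_sum F S -> has_sum (fun k => F (- k)) S.
Proof. exact: (has_sum_reindex (f := -%R) (g := -%R) opprK opprK). Qed.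

Lemma has_sum_translate l (F : int * int -> Cplx R) S :
  has_sum F S -> has_sum (fun k => F (k + l)) S.
Proof. exact: (has_sum_reindex (addrK l) (subrK l)). Qed.

Lemma wzeta_odd z : wzeta tau (- z) = - wzeta tau z.
Proof.
apply: has_sum_unique (has_sum_opp (has_sum_zeta (- z))) _.
apply: eq_has_sum (has_sumN (has_sum_zeta z)) => k.
by rewrite /zeta_term latN -opprD !invrN sqrrN mulNr; ring.
Qed.

Lemma wp_even z : wp tau (- z) = wp tau z.
Proof.
apply: has_sum_unique (has_sum_opp (has_sum_wp (- z))) _.
apply: eq_has_sum (has_sum_wp z) => k.
by rewrite /wp_term latN -opprD !sqrrN.
Qed.

(** The substitution k -> - k - l exchanges the two terms, by the symmetry of the
    lattice; the sum is thus equal to its opposite. *)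
Lemma has_sum_telescope l c S :
  has_sum (fun k => c * ((lat (k + l) ^+ 2)^-1 - (lat k ^+ 2)^-1)) S -> S = 0.
Proof.
move=> hS; have : has_sum (fun k => - (c * ((lat (k + l) ^+ 2)^-1 - (lat k ^+ 2)^-1))) S.
  have := has_sum_opp (has_sum_translate (- l) hS); apply: eq_has_sum => k.
  by rewrite subrK -(opprD k l) !latN !sqrrN; ring.
move=> /(has_sum_unique (has_sumN hS)) /eqP.
by rewrite eq_sym -subr_eq0 opprK -mulr2n mulrn_eq0 /= => /eqP.
Qed.

(** After translation of the summation index by l, the terms of the two sides differ by
    the telescoping family of the preceding lemma. *)
Lemma wzeta_quasiperiod l z z' :
  wzeta tau (z + lat l) - wzeta tau z = wzeta tau (z' + lat l) - wzeta tau z'.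
Proof.
have H := has_sumB (has_sum_translate l (has_sumB (has_sum_zeta (z + lat l))
  (has_sum_zeta (z' + lat l)))) (has_sumB (has_sum_zeta z) (has_sum_zeta z')).
have := @has_sum_telescope l (z - z') _ (eq_has_sum _ H).
have E : forall k, zeta_term (z + lat l) (k + l) - zeta_term (z' + lat l) (k + l)
    - (zeta_term z k - zeta_term z' k) =
    (z - z') * ((lat (k + l) ^+ 2)^-1 - (lat k ^+ 2)^-1).
  move=> k; rewrite /zeta_term.
  have E u : u + lat l - lat (k + l) = u - lat k by rewrite latD; ring.
  by rewrite !E; ring.
move=> /(_ E) /eqP; rewrite subr_eq0 => /eqP E'.
by apply/eqP; rewrite -subr_eq0; apply/eqP; rewrite opprB addrACA -opprD addrC; rewrite -[RHS](subrr (wzeta tau z - wzeta tau z')) -{1}E'; ring.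
Qed.

Lemma wp_periodic l z : wp tau (z + lat l) = wp tau z.
Proof.
apply/eqP; rewrite -subr_eq0; apply/eqP.
apply: (@has_sum_telescope l (-1)).
apply: eq_has_sum (has_sumB (has_sum_translate l (has_sum_wp (z + lat l)))
  (has_sum_wp z)) => k.
rewrite /wp_term; have -> : z + lat l - lat (k + l) = z - lat k by rewrite latD; ring.
by ring.
Qed.

(** The half-periods, indexed by the parities of their doubled coordinates. *)
Definition half (e : bool * bool) : Cplx R := (e.1%:R + e.2%:R * tau) / 2.

(** The lattice splits into its four classes modulo 2. The terms of 2 zeta(2z) in the
    class of e are the terms of zeta(z - half e), up to a polynomial of degree one in z
    whose coefficients sum to the other two terms. *)
Lemma wzeta_double z : 2 * wzeta tau (2 * z) =
  \sum_(e : bool * bool) (wzeta tau (z - half e) - wzeta tau (- half e)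
    + z * wp tau (- half e)).
Proof.
(* An integer is twice its quotient by 2, plus its parity. *)
pose f (k : (bool * bool) * (int * int)) : int * int :=
  (k.2.1 *+ 2 + (k.1.1 : nat)%:Z, k.2.2 *+ 2 + (k.1.2 : nat)%:Z).
pose g (k : int * int) : (bool * bool) * (int * int) :=
  (((k.1 %% 2)%Z == 1, (k.2 %% 2)%Z == 1), ((k.1 %/ 2)%Z, (k.2 %/ 2)%Z)).
have fK : cancel f g.
  move=> [[e1 e2] [m n]]; rewrite /f /g /=; congr ((_, _), (_, _)); case: e1; case: e2; lia.
have gK : cancel g f.
  move=> [m n]; rewrite /f /g /=; congr (_, _).
    by case: eqP; lia.
  by case: eqP; lia.
have := has_sum_reindex fK gK (has_sumZ 2 (has_sum_zeta (2 * z))).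
move=> /has_sum_sumI; apply=> e.
have := has_sumD (has_sumB (has_sum_zeta (z - half e)) (has_sum_zeta (- half e)))
  (has_sumZ z (has_sum_wp (- half e))).
apply: eq_has_sum => k; rewrite /zeta_term /wp_term.
have -> : lat (f (e, k)) = 2 * (half e + lat k).
  rewrite /lat /lattice_point /half /f /= !mulr2n !rmorphD /= !pmulrn.
  by field.
have -> : z - half e - lat k = z - (half e + lat k) by ring.
rewrite -opprD -mulrBr exprMn !invfM.
rewrite !invrN; move: (z - _)^-1 (half e + lat k)^-1 => A B.
by move: (lat k)^-1 (half e) => C D; field.
Qed.

Lemma half_lat (e : bool * bool) : 2 * half e = lat ((e.1 : nat)%:Z, (e.2 : nat)%:Z).
Proof. by rewrite /half /lat /lattice_point /= !pmulrn; field. Qed.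

(** Under z -> z + 1 both sides of the duplication formula grow by 4 eta_1, apart from
    the linear term z * (sum of the wp(- half e)); its coefficient is therefore zero.
    The index e = (0, 0) is included, as wp takes the value 0 at the origin. *)
Lemma wp_half_sum : \sum_(e : bool * bool) wp tau (half e) = 0.
Proof.
under eq_bigr do rewrite -wp_even.
have E1 := wzeta_double 1; have E0 := wzeta_double 0.
have L1 : (1 : Cplx R) = lat (1, 0).
  by rewrite /lat /lattice_point /= mul0r addr0.
have q z : wzeta tau (z + 1) = wzeta tau z + (wzeta tau 1 - wzeta tau 0).
  have := wzeta_quasiperiod (1, 0) z 0; rewrite -L1 add0r => <-.
  by rewrite [RHS]addrC subrK.
set d := wzeta tau 1 - wzeta tau 0 in q; set X := \sum_e _.
have S0 : 2 * wzeta tau 0 = 0.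
  rewrite -[0 in LHS](mulr0 2) E0 big1 // => e _.
  by rewrite sub0r subrr mul0r addr0.
have S1 : 2 * wzeta tau (2 * 1) = 2 * wzeta tau 0 + 4 * d.
  have -> : (2 * 1 : Cplx R) = 0 + 1 + 1 by ring.
  by rewrite !q; ring.
have : 2 * wzeta tau (2 * 1) = 4 * d + X.
  rewrite E1 (eq_bigr (fun e => d + wp tau (- half e))).
    by rewrite big_split /= sumr_const card_prod card_bool mulr_natl.
  by move=> e _; rewrite mul1r addrC [1 - _]addrC q; ring.
by rewrite S1 S0 add0r -[LHS]addr0 => /addrI.
Qed.

End LatticeSums.

(** * Laurent expansions of the Weierstrass functions *)

Section SumsOfPowerSeries.
Variables (R : realType).
Implicit Types (x y : Cplx R) (r : R) (a c : nat -> Cplx R).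

Lemma has_sum_bigsum (I : choiceType) (J : Type) (s : seq J)
    (F : J -> I -> Cplx R) (S : J -> Cplx R) :
  (forall j, has_sum (F j) (S j)) ->
  has_sum (fun i => \sum_(j <- s) F j i) (\sum_(j <- s) S j).
Proof.
move=> hF; elim: s => [|j s IH].
  rewrite big_nil; have := @has_sum_finite R I (fun=> 0) [::] isT.
  by rewrite big_nil => /(_ (fun _ _ => erefl)); apply: eq_has_sum => i; rewrite big_nil.
by rewrite big_cons; apply: eq_has_sum (has_sumD (hF j) IH) => i; rewrite big_cons.
Qed.

Lemma tame_bigsum (J : Type) (s : seq J) (a : J -> nat -> Cplx R) r : 0 < r ->
  (forall j, tame (a j) r) -> tame (fun n => \sum_(j <- s) a j n) r.
Proof.
move=> r0 ha; elim: s => [|j s IH].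
  by split=> //; exists 0 => n; rewrite big_nil nrm0 mul0r.
have := tameD (ha j) IH; congr (tame _ _); apply/funext => n.
by rewrite big_cons.
Qed.

Lemma psum_affine x y z :
  psum (fun n => if n == 0%N then y else if n == 1%N then z else 0) x (y + z * x).
Proof.
have := @has_sum_finite R _
  (fun n => (if n == 0%N then y else if n == 1%N then z else 0) * x ^+ n)
  [:: 0%N; 1%N] isT.
rewrite !big_cons big_nil /= expr0 expr1 mulr1 addr0; apply=> n.
by rewrite !inE negb_or => /andP[/negPf -> /negPf ->]; rewrite mul0r.
Qed.

Lemma tame_affine y z r : 0 < r ->
  tame (fun n => if n == 0%N then y else if n == 1%N then z else 0) r.
Proof.
move=> r0; split=> //; exists (nrm y + nrm z * r) => n.
have z0 := mulr_ge0 (nrm_ge0 z) (ltW r0); have y0 := nrm_ge0 y.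
case: n => [|[|n]] /=.
- by rewrite expr0 mulr1 lerDl.
- by rewrite expr1 lerDr.
- by rewrite nrm0 mul0r addr_ge0.
Qed.

Lemma finite_lower_bound (I : eqType) (s : seq I) (f : I -> R) :
  (forall i, 0 < f i) -> exists2 r : R, 0 < r & forall i, i \in s -> r <= f i.
Proof.
move=> f0; elim: s => [|i s [r r0 IH]]; first by exists 1.
exists (Num.min (f i) r); first by rewrite lt_min f0.
move=> j; rewrite inE => /orP[/eqP ->|/IH]; first by rewrite ge_min lexx.
by apply: le_trans; rewrite ge_min lexx orbT.
Qed.

(** Interchange of two absolutely convergent summations. *)
Lemma has_sum_power_series (I : choiceType) (A : I -> nat -> Cplx R) r (B : I -> R) M :
  0 < r -> (forall k n, nrm (A k n) * r ^+ n <= B k) -> sums_le B M ->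
  exists c, [/\ tame c r, forall n, has_sum (fun k => A k n) (c n) &
    forall x, nrm x < r -> has_sum (fun k => pser (A k) x) (pser c x)].
Proof.
move=> r0 AB BM.
have AM n : sums_le (fun k => nrm (A k n)) (M / r ^+ n).
  move=> s us; rewrite ler_pdivlMr ?exprn_gt0 // mulr_suml.
  by apply: le_trans (BM s us); apply: ler_sum.
have /choice[c hc] : forall n, exists S, has_sum (fun k => A k n) S.
  by move=> n; apply: abs_summable_has_sum; exists (M / r ^+ n).
have tc : tame c r.
  split=> //; exists M => n; rewrite -ler_pdivlMr ?exprn_gt0 //.
  exact: has_sum_le (AM n) (hc n).
exists c; split=> // x xr.
have B0 k : 0 <= B k by apply: le_trans (AB k 0%N); rewrite expr0 mulr1 nrm_ge0.
have ht : 0 <= nrm x / r < 1.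
  by rewrite divr_ge0 ?nrm_ge0 ?(ltW r0) //= ltr_pdivrMr ?mul1r.
pose F (k : I * nat) := A k.1 k.2 * x ^+ k.2.
have [S hS] : exists S, has_sum F S.
  apply: abs_summable_has_sum; eexists.
  apply: sums_le_mono (sums_le_prod B0 _ BM (geo_sums_le ht)) => [[k n]|n] /=.
    rewrite /F /= nrmM nrmX expr_div_n mulrCA mulrC ler_wpM2l ?exprn_ge0 ?nrm_ge0 //.
    by rewrite ler_pdivlMr ?exprn_gt0.
  by rewrite exprn_ge0 //; case/andP: ht.
have rows : has_sum (fun k => pser (A k) x) S.
  apply: (has_sum_fubini hS) => k; apply: (@tame_psum _ _ r) => //.
  by split=> //; exists (B k).
suff : has_sum (fun n => c n * x ^+ n) S by move=> /psum_pser ->.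
pose swap (k : nat * I) := (k.2, k.1); pose swap' (k : I * nat) := (k.2, k.1).
have := @has_sum_reindex R _ _ swap swap' _ _ (fun=> _) (fun=> _) hS.
move=> /(_ _ _)/has_sum_fubini; apply; try by case.
move=> n; have := has_sumZ (x ^+ n) (hc n); rewrite mulrC; apply: eq_has_sum => k.
by rewrite mulrC.
Qed.

Lemma tame_geometric y r : 0 < r -> nrm y * r <= 1 -> tame (fun n => y ^+ n.+1) r.
Proof.
move=> r0 yr; split=> //; exists (nrm y) => n.
rewrite nrmX exprS -mulrA -exprMn ler_piMr ?nrm_ge0 // exprn_ile1 //.
by rewrite mulr_ge0 ?nrm_ge0 // ltW.
Qed.

Lemma geometric_neq0 x y r : nrm y * r <= 1 -> nrm x < r -> 1 - x * y != 0.
Proof.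
move=> yr xr; apply/eqP => /eqP; rewrite subr_eq0 => /eqP E.
have [y0|y0] := eqVneq y 0; first by move/eqP: E; rewrite y0 mulr0 oner_eq0.
have : nrm (x * y) < 1.
  by rewrite nrmM; apply: lt_le_trans yr; rewrite mulrC ltr_pM2l // nrm_gt0.
by rewrite -E nrm1 ltxx.
Qed.

(** Shifting the indices shows that the sum S satisfies S = y + x y S. *)
Lemma psum_geometric x y r : 0 < r -> nrm y * r <= 1 -> nrm x < r ->
  psum (fun n => y ^+ n.+1) x (y / (1 - x * y)).
Proof.
move=> r0 yr xr; have D := geometric_neq0 yr xr.
have H := tame_psum (tame_geometric r0 yr) xr; set S := pser _ x in H.
suff -> : y / (1 - x * y) = S by [].
have : S = y * (x * S) + y.
  apply: (has_sum_unique H).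
  have := has_sumD (has_sumZ y (psum_mulXn 1 H)) (psum_affine x y 0).
  rewrite mul0r addr0; apply: eq_has_sum => -[|n].
    by rewrite /mulXn /= mul0r mulr0 add0r expr1.
  rewrite /mulXn /= subn1 /=; case: n => [|n]; rewrite /= mul0r addr0 mulrA -exprS //.
move=> E; apply: (mulIf D); rewrite divfK // mulrBr mulr1 {1}E; ring.
Qed.

(** The Cauchy square of the geometric series is its derivative. *)
Lemma psum_geometric_deriv x y r : 0 < r -> nrm y * r <= 1 -> nrm x < r ->
  psum (pderiv (fun n => y ^+ n.+1)) x ((y / (1 - x * y)) ^+ 2).
Proof.
move=> r0 yr xr; have t := tame_geometric r0 yr.
have := psum_conv t t xr; rewrite (psum_pser (psum_geometric r0 yr xr)).
rewrite -expr2; apply: eq_has_sum => n; congr (_ * _).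
rewrite /conv /pderiv (eq_bigr (fun=> y ^+ n.+2)); last first.
  by move=> j _; rewrite -exprD addnS addSn subnKC // -ltnS.
by rewrite sumr_const card_ord mulr_natl.
Qed.

End SumsOfPowerSeries.

Section LocalExpansions.
Variables (R : realType) (tau : Cplx R).
Hypothesis htau : 0 < complex.Im tau.
Implicit Types (k l : int * int) (z a x : Cplx R).

Definition is_pole a : Cplx R := if `[< exists k, lat tau k = a >] then 1 else 0.

Lemma has_sum_pole a x :
  has_sum (fun k => if lat tau k == a then x else 0) (is_pole a * x).
Proof.
rewrite /is_pole; case: asboolP => [[k0 <-]|H].
  have := @has_sum_finite R _ (fun k => if lat tau k == lat tau k0 then x else 0)
    [:: k0] isT.
  rewrite big_seq1 eqxx mul1r; apply=> k; rewrite inE => kk.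
  by case: eqP => // /(lat_inj htau) E; rewrite E eqxx in kk.
have := @has_sum_finite R _ (fun k => if lat tau k == a then x else 0) [::] isT.
rewrite big_nil mul0r; apply=> k _; case: eqP => // E.
by case: H; exists k.
Qed.

Lemma lat_isolated a : exists2 r : R, 0 < r &
  forall k, lat tau k != a -> r <= nrm (lat tau k - a).
Proof.
have [s Hs] := lat_large htau (nrm a + 1).
pose f k := if lat tau k == a then 1 else nrm (lat tau k - a).
have f0 k : 0 < f k.
  by rewrite /f; case: eqP => // /eqP H; rewrite nrm_gt0 subr_eq0.
have [r r0 Hr] := finite_lower_bound s f0.
exists (Num.min r 1); first by rewrite lt_min r0 ltr01.
move=> k ka; case: (boolP (k \in s)) => [/Hr|/Hs H].
  by rewrite /f (negPf ka); apply: le_trans; rewrite ge_min lexx.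
have := ler_subnrm (lat tau k) a => H1.
by apply: (@le_trans _ _ 1); [rewrite ge_min lexx orbT | lra].
Qed.

Lemma inv_cube_summable a :
  abs_summable (fun k => (lat tau k - a)^-1 ^+ 3).
Proof.
have [s Hs] := lat_far htau a.
apply: (@lat_abs_summable _ _ htau _ 8 s) => k /Hs[w0 _ H].
have n0 : 0 < nrm (lat tau k) by rewrite nrm_gt0.
rewrite nrmX nrmV nrmC.
have -> : 8 / nrm (lat tau k) ^+ 3 = (nrm (lat tau k) / 2)^-1 ^+ 3.
  by field; rewrite gt_eqF.
have v0 : 0 < nrm (a - lat tau k) by apply: lt_le_trans H; lra.
by rewrite lerXn2r ?nnegrE ?invr_ge0 ?nrm_ge0 ?lef_pV2 ?posrE //; lra.
Qed.

(** Expansion at a of the term of index k, in powers of x: the first summand is that of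
    1 / (a + x - lat k), and it disappears when lat k = a because 0^-1 = 0. *)
Definition zeta_coef a k (n : nat) : Cplx R :=
  - (lat tau k - a)^-1 ^+ n.+1 +
  (if n == 0%N then (lat tau k)^-1 + a / lat tau k ^+ 2
   else if n == 1%N then (lat tau k ^+ 2)^-1 else 0).

Lemma zeta_coef0 a k : zeta_coef a k 0 = zeta_term tau a k.
Proof. by rewrite /zeta_coef /zeta_term /= expr1 -invrN opprB addrA. Qed.

Lemma zeta_coef1 a k : zeta_coef a k 1 = - wp_term tau a k.
Proof. by rewrite /zeta_coef /wp_term /= exprVn -sqrrN !opprB addrC. Qed.

(** The coefficients of order 0 and 1 are the terms of zeta and of -wp at a. The others
    are dominated by the summable family |lat k - a|^-3. *)
Lemma zeta_coef_dom a r : 0 < r ->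
  (forall k, nrm (lat tau k - a)^-1 * r <= 1) ->
  exists2 B : int * int -> R, (exists M, sums_le B M) &
    forall k n, nrm (zeta_coef a k n) * r ^+ n <= B k.
Proof.
move=> r0 hr; have [M1 H1] := zeta_term_summable htau a.
have [M2 H2] := wp_term_summable htau a; have [M3 H3] := inv_cube_summable a.
exists (fun k => nrm (zeta_term tau a k) + r * nrm (wp_term tau a k)
  + r ^+ 2 * nrm ((lat tau k - a)^-1 ^+ 3)).
  exists (M1 + r * M2 + r ^+ 2 * M3) => s us.
  rewrite !big_split -!mulr_sumr /= !lerD ?H1 //.
    by rewrite ler_wpM2l ?H2 // ltW.
  by rewrite ler_wpM2l ?H3 // exprn_ge0 // ltW.
move=> k n.
have h1 := nrm_ge0 (zeta_term tau a k).
have h2 := mulr_ge0 (ltW r0) (nrm_ge0 (wp_term tau a k)).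
have h3 := mulr_ge0 (exprn_ge0 2 (ltW r0)) (nrm_ge0 ((lat tau k - a)^-1 ^+ 3)).
case: n => [|[|n]].
- by rewrite zeta_coef0 expr0; lra.
- by rewrite zeta_coef1 expr1 nrmN mulrC; lra.
rewrite /zeta_coef /= addr0 nrmN nrmX.
apply: le_trans (_ : r ^+ 2 * nrm ((lat tau k - a)^-1 ^+ 3) <= _); last by lra.
rewrite nrmX; set y := nrm _ in hr *.
have -> : y ^+ n.+3 * r ^+ n.+2 = r ^+ 2 * y ^+ 3 * (y * r) ^+ n.
  by rewrite exprMn -[n.+3]addn3 -[n.+2]addn2 !exprD; ring.
rewrite ler_piMr //; first by rewrite mulr_ge0 ?exprn_ge0 ?nrm_ge0 // ltW.
by rewrite exprn_ile1 // ?hr // mulr_ge0 ?nrm_ge0 // ltW.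
Qed.

Lemma pole_quotient a x k : 1 - x * (lat tau k - a)^-1 != 0 ->
  (a + x - lat tau k)^-1 =
  (if lat tau k == a then x^-1 else 0)
  - (lat tau k - a)^-1 / (1 - x * (lat tau k - a)^-1).
Proof.
have [->|ka D] := eqVneq (lat tau k) a.
  by rewrite subrr invr0 mul0r subr0 addrAC subrr add0r.
have v0 : lat tau k - a != 0 by rewrite subr_eq0.
have w0 : lat tau k - a - x != 0.
  apply: contraNneq D => /eqP; rewrite subr_eq0 => /eqP <-.
  by rewrite divff // subrr.
have E : 1 - x / (lat tau k - a) = (lat tau k - a - x) / (lat tau k - a).
  by rewrite mulrBl divff.
have -> : a + x - lat tau k = - (lat tau k - a - x) by ring.
by rewrite E invf_div mulrA mulVf // mul1r sub0r invrN.
Qed.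

(** Laurent expansions at an arbitrary point. The polar part is separated by is_pole,
    and the convention 0^-1 = 0 makes the values at a, be it a pole or not, the constant
    terms of the regular parts. *)
Lemma local_expansion a : exists r c, [/\ tame c r, tame (pderiv c) r,
  c 0%N = wzeta tau a, c 1%N = - wp tau a &
  forall x, nrm x < r ->
    wzeta tau (a + x) = is_pole a / x + pser c x /\
    wp tau (a + x) = is_pole a / x ^+ 2 - pser (pderiv c) x].
Proof.
have [r r0 Hr] := lat_isolated a.
pose y k := (lat tau k - a)^-1.
have hr k : nrm (y k) * r <= 1.
  rewrite /y; have [->|ka] := eqVneq (lat tau k) a.
    by rewrite subrr invr0 nrm0 mul0r.
  by rewrite nrmV mulrC ler_pdivrMr ?mul1r ?Hr // nrm_gt0 subr_eq0.
have [B [M BM] AB] := zeta_coef_dom r0 hr.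
have [c [tc hc Hc]] := has_sum_power_series r0 AB BM.
have r2 : 0 < r / 2 by lra.
have AB' k n : nrm (pderiv (zeta_coef a k) n) * (r / 2) ^+ n <= 2 / r * B k.
  have H1 := AB k n.+1; have H2 : n.+1%:R * 2^-1 ^+ n <= 2 :> R.
    have := @geo_weight R 2^-1 n; have -> : (1 - 2^-1 : R)^-1 = 2 by field.
    by apply; lra.
  have := ler_pM _ _ H2 H1; rewrite !mulr_ge0 ?nrm_ge0 ?exprn_ge0 ?(ltW r0) //.
  move=> /(_ isT isT) H; rewrite mulrAC ler_pdivlMr //; apply: le_trans H.
  rewrite /pderiv nrmM nrm_nat expr_div_n -exprVn le_eqVlt; apply/orP; left.
  by apply/eqP; rewrite exprSr; ring.
have BM' : sums_le (fun k => 2 / r * B k) (2 / r * M).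
  by move=> s us; rewrite -mulr_sumr ler_wpM2l ?BM // divr_ge0 // ltW.
have [c' [tc' hc' Hc']] := has_sum_power_series r2 AB' BM'.
have cE : c' = pderiv c.
  by apply/funext => n; apply: has_sum_unique (hc' n) _; exact: has_sumZ (hc n.+1).
exists (r / 2), c; split.
- by apply: tame_le tc; lra.
- by rewrite -cE.
- apply: has_sum_unique (hc 0%N) _; apply: eq_has_sum (has_sum_zeta htau a) => k.
  by rewrite zeta_coef0.
- apply: has_sum_unique (hc 1%N) _.
  by apply: eq_has_sum (has_sumN (has_sum_wp htau a)) => k; rewrite zeta_coef1.
move=> x xr2; have xr : nrm x < r by lra.
have D k : 1 - x * y k != 0 := geometric_neq0 (hr k) xr.
have PQ k := pole_quotient (D k).
split.
  apply: has_sum_unique (has_sum_zeta htau (a + x)) _.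
  apply: eq_has_sum (has_sumD (has_sum_pole a x^-1) (Hc x xr)) => k.
  have := has_sumD (has_sumZ (-1) (psum_geometric r0 (hr k) xr))
    (psum_affine x ((lat tau k)^-1 + a / lat tau k ^+ 2) (lat tau k ^+ 2)^-1).
  move=> H; have {H}-> := psum_pser (eq_has_sum _ H) => [|n]; last first.
    by rewrite mulN1r -mulNr -mulrDl.
  rewrite /zeta_term (PQ k) -/(y k); move: (y k / _) (if _ then _ else _) => P Q.
  by ring.
apply: has_sum_unique (has_sum_wp htau (a + x)) _.
rewrite -cE; apply: eq_has_sum (has_sumB (has_sum_pole a (x ^+ 2)^-1) (Hc' x xr2)) => k.
have := has_sumD (has_sumZ (-1) (psum_geometric_deriv r0 (hr k) xr))
  (psum_affine x (lat tau k ^+ 2)^-1 0).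
move=> H; have {H}-> := psum_pser (eq_has_sum _ H) => [|n]; last first.
  rewrite mulN1r -mulNr -mulrDl /pderiv /zeta_coef /=; congr (_ * _).
  by rewrite -/(y k) if_same; case: n => [|n] /=; ring.
rewrite /wp_term -[((a + x - _) ^+ 2)^-1]exprVn (PQ k) -/(y k); case: eqP => [E|_].
  by rewrite /y E subrr invr0 mul0r subr0 exprVn; ring.
by ring.
Qed.

End LocalExpansions.

(** * The apparent equations *)

Section Apparent.
Variables (R : realType) (tau : Cplx R).
Hypothesis htau : 0 < complex.Im tau.
Implicit Types (k l : int * int) (z a : Cplx R) (e : bool * bool) (x : 'rV[Cplx R]_5).

Definition parities (j : nat) : bool * bool := (odd j, (1 < j)%N).

Lemma omega_half (j : 'I_4) : omega tau j / 2 = half tau (parities j).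
Proof.
by case: j => -[|[|[|[|//]]]] /= ?; rewrite /omega /half /=; ring.
Qed.

Lemma sum_parities (f : bool * bool -> Cplx R) :
  \sum_(j < 4) f (parities j) = \sum_e f e.
Proof.
rewrite [RHS](reindex (fun j : 'I_4 => parities j)) //.
exists (fun e => inord (e.1 + e.2.*2)) => [j _|[[] []] _].
- by apply: val_inj; case: j => -[|[|[|[|//]]]] ? /=; rewrite inordK.
all: by rewrite /parities /= inordK.
Qed.

Lemma parities_eq (i j : 'I_4) : (parities i == parities j) = (i == j).
Proof.
rewrite -[i == j]/(val i == val j).
by case: i j => -[|[|[|[|//]]]] i [[|[|[|[|//]]]] j].
Qed.

Definition parity_vec e : int * int := ((e.1 : nat)%:Z, (e.2 : nat)%:Z).

(** Distinct half-periods are not congruent modulo the lattice. *)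
Lemma half_diff_pole e e' : is_pole tau (half tau e - half tau e') = (e == e')%:R.
Proof.
rewrite /is_pole; case: eqP => [->|H].
  case: asboolP => // -[]; exists 0; by rewrite lat0 subrr.
case: asboolP => // -[k Hk]; case: H.
have : lat tau (k + k) = lat tau (parity_vec e - parity_vec e').
  rewrite !latD latN -!half_lat Hk; ring.
move=> /(lat_inj htau); case: k {Hk} => m n [].
by case: e e' => [[] []] [[] []] //= *; exfalso; lia.
Qed.

(** Modulo the lattice, the difference of two half-periods is the half-period whose
    parities are the exclusive or of theirs, and wp is periodic. *)
Lemma wp_half_diff_sum e : \sum_e' wp tau (half tau e - half tau e') = 0.
Proof.
pose xor e' := (e.1 (+) e'.1, e.2 (+) e'.2).
have xorK : involutive xor.
  by move=> [a b]; rewrite /xor /= !addbA !addbb.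
rewrite -[RHS](wp_half_sum htau) [RHS](reindex_inj (inv_inj xorK)).
apply: eq_bigr => e' _.
rewrite -(wp_periodic htau (parity_vec (~~ e.1 && e'.1, ~~ e.2 && e'.2))).
congr wp; rewrite /half /lat /lattice_point /parity_vec /xor.
by case: e {xor xorK} e' => [[] []] [[] []] /=; field.
Qed.

Definition quasiperiod l : Cplx R := wzeta tau (lat tau l) - wzeta tau 0.

Lemma quasiperiodE l z : wzeta tau (z + lat tau l) - wzeta tau z = quasiperiod l.
Proof. by rewrite (wzeta_quasiperiod htau l z 0) add0r. Qed.

Lemma quasiperiodD k l : quasiperiod (k + l) = quasiperiod k + quasiperiod l.
Proof.
by rewrite -(quasiperiodE k (lat tau l)) /quasiperiod latD [lat tau k + _]addrC; ring.
Qed.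

(** As zeta is odd, zeta(- a + 2 a) - zeta(- a) = 2 zeta(a). *)
Lemma wzeta_half a l : 2 * a = lat tau l -> wzeta tau a = quasiperiod l / 2.
Proof.
move=> H; rewrite -(quasiperiodE l (- a)) -H wzeta_odd //.
have -> : - a + 2 * a = a by ring.
by field.
Qed.

Definition half_quasiperiod e := quasiperiod (parity_vec e).

Lemma wzeta_half_diff e e' : wzeta tau (half tau e - half tau e') =
  (half_quasiperiod e - half_quasiperiod e') / 2.
Proof.
rewrite (@wzeta_half _ (parity_vec e - parity_vec e')); last first.
  by rewrite mulrBr !half_lat latD latN.
congr (_ / 2); have := quasiperiodD (parity_vec e - parity_vec e') (parity_vec e').
by rewrite subrK /half_quasiperiod => ->; rewrite addrK.
Qed.

(** The constant is unique because it can be read off at the half-period 1/2, which is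
    not in the lattice. *)
Lemma eta_quasiperiod (k : nat) l : omega tau k = lat tau l ->
  eta tau k = quasiperiod l.
Proof.
move=> Hk; have ex : exists c, forall z : Cplx R, ~ in_lattice tau z ->
    wzeta tau (z + omega tau k) - wzeta tau z = c.
  by exists (quasiperiod l) => z _; rewrite Hk quasiperiodE.
have H : forall z : Cplx R, ~ in_lattice tau z ->
    wzeta tau (z + omega tau k) - wzeta tau z = eta tau k := xgetPex 0 ex.
rewrite -(H (half tau (true, false))); first by rewrite Hk quasiperiodE.
case=> m [n Hmn]; have := half_diff_pole (true, false) (false, false).
rewrite [half tau (false, false)]/half /= mul0r addr0 mul0r subr0 /is_pole.
case: asboolP => [_ /eqP|[]]; first by rewrite oner_eq0.
by exists (m, n); rewrite Hmn.
Qed.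

Lemma half_quasiperiod_eta :
  [/\ half_quasiperiod (false, false) = 0,
      half_quasiperiod (true, false) = eta tau 1,
      half_quasiperiod (false, true) = eta tau 2 &
      half_quasiperiod (true, true) = eta tau 1 + eta tau 2].
Proof.
have H1 : half_quasiperiod (true, false) = eta tau 1.
  rewrite (@eta_quasiperiod 1 (parity_vec (true, false))) //.
  by rewrite /omega /lat /lattice_point /= mul0r addr0.
have H2 : half_quasiperiod (false, true) = eta tau 2.
  rewrite (@eta_quasiperiod 2 (parity_vec (false, true))) //.
  by rewrite /omega /lat /lattice_point /= mul1r add0r.
split=> //; last by rewrite -H1 -H2 -quasiperiodD.
by rewrite /half_quasiperiod /quasiperiod -[parity_vec _]/(0 : int * int) lat0 subrr.
Qed.

(** At the half-period number k the residue of the potential is T_k. The regular parts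
    of the four wp contribute nothing to the constant term, as their values sum to zero,
    and the values of zeta at differences of half-periods are differences of
    quasi-periods. *)
Lemma potential_expansion x (k : 'I_4) : exists g r,
  [/\ potential_series (potential tau x) (omega tau k / 2) g r, g 0%N = 3 / 4,
      g 1%N = coordT x k &
      g 2%N = \sum_(j < 4) coordT x j *
        ((half_quasiperiod (parities k) - half_quasiperiod (parities j)) / 2)
        + coordB x].
Proof.
set hk := half tau (parities k); pose h (j : 'I_4) := hk - half tau (parities j).
have /choice[r /choice[c Hc]] : forall j : 'I_4, exists r, exists c, [/\ tame c r,
    tame (pderiv c) r, c 0%N = wzeta tau (h j), c 1%N = - wp tau (h j) &
    forall u, nrm u < r -> wzeta tau (h j + u) = is_pole tau (h j) / u + pser c u /\
      wp tau (h j + u) = is_pole tau (h j) / u ^+ 2 - pser (pderiv c) u].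
  by move=> j; exact: local_expansion.
have r_gt0 j : 0 < r j by case: (Hc j) => -[].
have [s s0 Hs] := finite_lower_bound (enum 'I_4) r_gt0.
have sr j : s <= r j by apply: Hs; rewrite mem_enum.
pose d n := \sum_(j < 4) (- (3 / 4) * pderiv (c j) n + coordT x j * c j n)
  + (if n == 0%N then coordB x else if n == 1%N then 0 else 0).
pose g n := (if n == 0%N then 3 / 4 else if n == 1%N then coordT x k else 0)
  + mulXn 2 d n.
have td : tame d s.
  apply: tameD; last exact: tame_affine.
  apply: (@tame_bigsum _ _ _ (fun j n => - (3 / 4) * pderiv (c j) n + coordT x j * c j n)) => // j.
  by case: (Hc j) => t1 t2 _ _ _; apply: tameD; apply: tameZ;
    [apply: tame_le t2 | apply: tame_le t1]; rewrite s0 sr.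
exists g, s; split.
- split; first by apply: tameD; [exact: tame_affine | exact: tame_mulXn].
  move=> z; set u := z - _ => u0 us; symmetry; apply: psum_pser.
  have zE (j : 'I_4) : z - omega tau j / 2 = h j + u.
    by rewrite /u /h /hk !omega_half; ring.
  have D : psum d u (\sum_(j < 4) (- (3 / 4) * pser (pderiv (c j)) u
      + coordT x j * pser (c j) u) + coordB x).
    have Dj (j : 'I_4) : has_sum (fun n => (- (3 / 4) * pderiv (c j) n
        + coordT x j * c j n) * u ^+ n)
        (- (3 / 4) * pser (pderiv (c j)) u + coordT x j * pser (c j) u).
      case: (Hc j) => t1 t2 _ _ _; have ur : nrm u < r j by apply: lt_le_trans (sr j).
      have := has_sumD (has_sumZ (- (3 / 4)) (tame_psum t2 ur))
        (has_sumZ (coordT x j) (tame_psum t1 ur)).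
      by apply: eq_has_sum => n; rewrite [RHS]mulrDl -[X in _ = X + _]mulrA -[X in _ = _ + X]mulrA.
    have := has_sumD (has_sum_bigsum (index_enum 'I_4) Dj) (psum_affine u (coordB x) 0).
    rewrite mul0r addr0; apply: eq_has_sum => n; rewrite /d [RHS]mulrDl.
    by rewrite mulr_suml.
  have := has_sumD (psum_affine u (3 / 4) (coordT x k)) (psum_mulXn 2 D).
  rewrite /psum; under eq_fun do rewrite -mulrDl.
  congr has_sum; rewrite /potential.
  have P (j : 'I_4) : is_pole tau (h j) = (k == j)%:R.
    by rewrite /h /hk half_diff_pole parities_eq.
  have W : \sum_(j < 4) wp tau (z - omega tau j / 2) =
      \sum_(j < 4) ((k == j)%:R / u ^+ 2 - pser (pderiv (c j)) u).
    apply: eq_bigr => j _; rewrite zE -P; case: (Hc j) => _ _ _ _ /(_ u) [] //.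
    exact: lt_le_trans (sr j).
  have Z : \sum_(j < 4) coordT x j * wzeta tau (z - omega tau j / 2) =
      \sum_(j < 4) ((k == j)%:R * (coordT x j / u) + coordT x j * pser (c j) u).
    apply: eq_bigr => j _; rewrite zE; case: (Hc j) => _ _ _ _ /(_ u) [].
      exact: lt_le_trans (sr j).
    by move=> -> _; rewrite -P; ring.
  have delta (f : 'I_4 -> Cplx R) : \sum_j (k == j)%:R * f j = f k.
    rewrite (bigD1 k) //= eqxx mul1r big1 ?addr0 // => j jk.
    by rewrite eq_sym (negPf jk) mul0r.
  rewrite W Z sumrB !big_split /= (delta (fun=> (u ^+ 2)^-1)) delta -!mulr_sumr.
  by field.
- by rewrite /g /= mulXn_lt // addr0.
- by rewrite /g /= mulXn_lt // addr0.
rewrite /g /= add0r /mulXn /= /d /= subnn big_split /=.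
have -> : \sum_(j < 4) - (3 / 4) * pderiv (c j) 0 = 0.
  rewrite -mulr_sumr (eq_bigr (fun j : 'I_4 => - wp tau (hk - half tau (parities j)))).
    by rewrite sumrN (sum_parities (fun e => wp tau (hk - half tau e)))
       wp_half_diff_sum oppr0 mulr0.
  by move=> j _; case: (Hc j) => _ _ _ H _; rewrite /pderiv mul1r H.
rewrite add0r; congr (_ + _); apply: eq_bigr => j _; case: (Hc j) => _ _ -> _ _.
by rewrite /h wzeta_half_diff.
Qed.

Lemma log_free_iff x (k : 'I_4) :
  log_free_at (potential tau x) (omega tau k / 2) <->
  coordT x k ^+ 2 = \sum_(j < 4) coordT x j *
    ((half_quasiperiod (parities k) - half_quasiperiod (parities j)) / 2) + coordB x.
Proof.
have [g [r [ps g0 <- <-]]] := potential_expansion x k; split.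
  by move=> /(log_free_necessary ps g0).
by move=> H; apply: (log_free_sufficient ps g0).
Qed.

Lemma point5E T0 T1 T2 T3 B x : x = point5 T0 T1 T2 T3 B <->
  [/\ coordT x ord0 = T0, coordT x (inord 1) = T1, coordT x (inord 2) = T2,
      coordT x (inord 3) = T3 & coordB x = B].
Proof.
rewrite /coordT /coordB; split=> [->|].
  by rewrite /point5 !mxE /= !inordK.
case=> <- <- <- <- <-; apply/rowP => i; rewrite !mxE.
by case: i => -[|[|[|[|[|//]]]]] i /=; congr (x 0 _); apply: val_inj; rewrite /= ?inordK.
Qed.

Lemma sum_ord4 (f : 'I_4 -> Cplx R) :
  \sum_(j < 4) f j = f ord0 + f (inord 1) + f (inord 2) + f (inord 3).
Proof.
rewrite !big_ord_recl big_ord0 addr0 !addrA.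
by congr (_ + _ + _ + _); congr f; apply: val_inj; rewrite /= ?inordK.
Qed.

Lemma forall_ord4 (P : 'I_4 -> Prop) :
  P ord0 -> P (inord 1) -> P (inord 2) -> P (inord 3) -> forall k : 'I_4, P k.
Proof.
move=> P0 P1 P2 P3 [[|[|[|[|//]]]] i].
- by rewrite (_ : Ordinal i = ord0) //; apply: val_inj.
- by rewrite (_ : Ordinal i = inord 1) //; apply: val_inj; rewrite /= inordK.
- by rewrite (_ : Ordinal i = inord 2) //; apply: val_inj; rewrite /= inordK.
- by rewrite (_ : Ordinal i = inord 3) //; apply: val_inj; rewrite /= inordK.
Qed.

(** As the T_j sum to zero, the contribution of the quasi-period of omega_k disappears,
    and the right-hand side does not depend on k. *)
Lemma AP_equations x : AP tau x <->
  \sum_(k < 4) coordT x k = 0 /\ forall k : 'I_4, coordT x k ^+ 2 =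
    coordB x - (eta tau 1 * (coordT x (inord 1) + coordT x (inord 3))
      + eta tau 2 * (coordT x (inord 2) + coordT x (inord 3))) / 2.
Proof.
have [q0 q1 q2 q3] := half_quasiperiod_eta.
have E (k : 'I_4) : \sum_(k < 4) coordT x k = 0 -> \sum_(j < 4) coordT x j *
    ((half_quasiperiod (parities k) - half_quasiperiod (parities j)) / 2) + coordB x =
    coordB x - (eta tau 1 * (coordT x (inord 1) + coordT x (inord 3))
      + eta tau 2 * (coordT x (inord 2) + coordT x (inord 3))) / 2.
  move=> S0; set Q := half_quasiperiod (parities k).
  rewrite (eq_bigr (fun j => Q / 2 * coordT x j
     - coordT x j * half_quasiperiod (parities j) / 2)); last by move=> j _; field.
  by rewrite sumrB -mulr_sumr S0 sum_ord4 /parities /= !inordK //= q0 q1 q2 q3; field.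
split=> -[S0 H]; split=> // k.
  by rewrite -(E k S0); apply/log_free_iff.
by apply/log_free_iff; rewrite (E k S0).
Qed.

(** The four T_k have the same square, hence T_k = T_0 or T_k = - T_0. The sum being
    zero, either T_0 = 0 or exactly two of the signs are minus; the three possible pairs
    are the three components, and the common equation gives B. *)
Lemma AP_union : AP tau = V1 tau `|` V2 tau `|` V3 R.
Proof.
apply/seteqP; split=> x.
  move=> /AP_equations[]; rewrite sum_ord4.
  set T0 := coordT x ord0; set T1 := coordT x (inord 1).
  set T2 := coordT x (inord 2); set T3 := coordT x (inord 3).
  move=> S0 H; set C := coordB x - _ in H.
  have sq (k : 'I_4) : coordT x k = T0 \/ coordT x k = - T0.
    have /eqP : coordT x k ^+ 2 = T0 ^+ 2 by rewrite !H.
    by rewrite eqf_sqr => /orP[/eqP|/eqP]; [left|right].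
  have BE : coordB x = T0 ^+ 2 + (eta tau 1 * (T1 + T3) + eta tau 2 * (T2 + T3)) / 2.
    by rewrite H /C subrK.
  have dbl u : u + u = 0 -> u = 0 :> Cplx R.
    by move/eqP; rewrite -mulr2n mulrn_eq0 /= => /eqP.
  have x5 : x = point5 T0 T1 T2 T3 (coordB x) by apply/point5E.
  (* Sign patterns that are not balanced force T0 = 0, and the origin is on V1. *)
  have zero : T0 = 0 -> V1 tau x.
    move=> T00; have Z (k : 'I_4) : coordT x k = 0 by case: (sq k); rewrite T00 ?oppr0.
    exists 0; rewrite x5 BE /T0 /T1 /T2 /T3 !Z; congr point5; rewrite ?oppr0 //.
    by field.
  have [e1|e1] := sq (inord 1); have [e2|e2] := sq (inord 2);
    have [e3|e3] := sq (inord 3); rewrite -/T1 -/T2 -/T3 in e1 e2 e3;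
    rewrite e1 e2 e3 in S0 BE x5.
  - by left; left; apply: zero; apply: (dbl); apply: (dbl); rewrite -[RHS]S0; ring.
  - by left; left; apply: zero; apply: (dbl); rewrite -[RHS]S0; ring.
  - by left; left; apply: zero; apply: (dbl); rewrite -[RHS]S0; ring.
  - by left; left; exists T0; rewrite x5; congr point5; rewrite BE; field.
  - by left; left; apply: zero; apply: (dbl); rewrite -[RHS]S0; ring.
  - by left; right; exists T0; rewrite x5; congr point5; rewrite BE; field.
  - by right; exists T0; rewrite x5; congr point5; rewrite BE; field.
  - by left; left; apply: zero; apply: (dbl); rewrite -[RHS]oppr0 -[in RHS]S0; ring.
move=> H; apply/AP_equations; rewrite sum_ord4.
by case: H => [[[T /point5E[E0 E1 E2 E3 ->]]|[T /point5E[E0 E1 E2 E3 ->]]]|[T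
  /point5E[E0 E1 E2 E3 ->]]]; rewrite E0 E1 E2 E3; (split; first by ring);
  apply: forall_ord4; rewrite ?E0 ?E1 ?E2 ?E3; field.
Qed.

End Apparent.

(** * Parametrised curves in the Zariski topology *)

Section AlgebraicCurves.
Variable R : realType.
Notation K := (Cplx R).
Variable n : nat.
Implicit Types (f g : mpoly n K) (x v : 'rV[K]_n) (p : 'I_n -> {poly K}).

Definition mvar (i : 'I_n) : mpoly n K := mpolyX K (mnm1 i).
Definition mconst (c : K) : mpoly n K := mpolyC n c.

Lemma eval_var i x : eval_at (mvar i) x = x 0 i.
Proof. exact: mevalXU. Qed.

Lemma eval_const c x : eval_at (mconst c) x = c.
Proof. exact: mevalC. Qed.

Lemma evalD f g x : eval_at (f + g) x = eval_at f x + eval_at g x.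
Proof. exact: mevalD. Qed.

Lemma evalB f g x : eval_at (f - g) x = eval_at f x - eval_at g x.
Proof. exact: mevalB. Qed.

Lemma evalM f g x : eval_at (f * g) x = eval_at f x * eval_at g x.
Proof. by rewrite /eval_at rmorphM. Qed.

Definition directional f x v : K := \sum_(i < n) eval_at (mderiv i f) x * v 0 i.

Lemma directionalD f g x v :
  directional (f + g) x v = directional f x v + directional g x v.
Proof.
by rewrite -big_split; apply: eq_bigr => i _; rewrite mderivD evalD mulrDl.
Qed.

Lemma directionalB f g x v :
  directional (f - g) x v = directional f x v - directional g x v.
Proof.
by rewrite -sumrB; apply: eq_bigr => i _; rewrite mderivB evalB mulrBl.
Qed.

Lemma directionalM f g x v : directional (f * g) x v =
  directional f x v * eval_at g x + eval_at f x * directional g x v.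
Proof.
rewrite mulr_suml mulr_sumr -big_split; apply: eq_bigr => i _.
rewrite mderivM evalD !evalM /= mulrDl mulrAC; congr (_ + _).
by rewrite mulrA.
Qed.

Lemma directional_const c x v : directional (mconst c) x v = 0.
Proof. by rewrite /directional big1 // => i _; rewrite mderivC /eval_at meval0 mul0r. Qed.

Lemma mderiv_var i j : mderiv i (mvar j) = mconst (i == j)%:R.
Proof.
rewrite /mvar mderivX mnm1E eq_sym; case: eqP => [->|_]; last first.
  by rewrite scale0r /mconst mpolyC0.
rewrite scale1r; have -> : mnm_sub (mnm1 j) (mnm1 j) = mnm0.
  by apply/mnmP => l; rewrite mnmBE subnn mnm0E.
by rewrite /mconst mpolyC1 mpolyX0.
Qed.

Lemma directional_var j x v : directional (mvar j) x v = v 0 j.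
Proof.
rewrite /directional (bigD1 j) //= mderiv_var eqxx eval_const mul1r big1 ?addr0 //.
by move=> i /negPf ij; rewrite mderiv_var ij eval_const mul0r.
Qed.

Definition curve_pt p (t : K) : 'rV[K]_n := \row_i (p i).[t].
Definition curve_vel p (t : K) : 'rV[K]_n := \row_i (p i)^`().[t].

(** The restriction of f to the curve, as a polynomial in the parameter. *)
Definition along p f : {poly K} := mmap (@polyC K) p f.

Lemma along_eval p f t : (along p f).[t] = eval_at f (curve_pt p t).
Proof.
rewrite /along /eval_at /meval /mmap horner_sum; apply: eq_bigr => m _.
rewrite hornerM hornerC; congr (_ * _); rewrite /mmap1 horner_prod.
by apply: eq_bigr => i _; rewrite horner_exp mxE.
Qed.

(** The chain rule: both sides are derivations, so it suffices to treat constants and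
    variables. *)
Lemma along_deriv p f t :
  (along p f)^`().[t] = directional f (curve_pt p t) (curve_vel p t).
Proof.
pose Q h := (along p h)^`().[t] = directional h (curve_pt p t) (curve_vel p t).
have QM g h : Q g -> Q h -> Q (g * h).
  rewrite /Q /along rmorphM derivM hornerD !hornerM -!/(along _ _) => -> ->.
  by rewrite !along_eval directionalM.
have QD g h : Q g -> Q h -> Q (g + h).
  by rewrite /Q /along rmorphD derivD hornerD -!/(along _ _) => -> ->; rewrite directionalD.
have QC c : Q (mconst c).
  by rewrite /Q /along mmapC derivC horner0 directional_const.
have QX i : Q (mvar i).
  by rewrite /Q /along mmapX mmap1U directional_var mxE.
have Q0 : Q 0 by have := QC 0; rewrite /mconst mpolyC0.
have Q1 : Q 1 by have := QC 1; rewrite /mconst mpolyC1.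
rewrite -/(Q f); clearbody Q; elim/mpolyind: f => [//|c m f _ _ Qf].
have Qm : Q (mpolyX K m).
  rewrite mpolyXE_id; elim/big_ind: _ => [//|g h|i _]; first exact: QM.
  elim: (m i) => [|k IH]; first by rewrite expr0.
  by rewrite exprS; apply: QM (QX i) IH.
have -> : c *: mpolyX K m = mconst c * mpolyX K m by rewrite /mconst mul_mpolyC.
exact: QD (QM _ _ (QC c) Qm) Qf.
Qed.

Lemma exists_notin (s : seq K) : exists t, t \notin s.
Proof.
apply: contrapT => /forallNP H.
pose L := [seq i%:R | i <- iota 0 (size s).+1] : seq K.
have uL : uniq L.
  by rewrite map_inj_uniq ?iota_uniq // => i j /eqP; rewrite eqr_nat => /eqP.
have sL : {subset L <= s} by move=> t _; have := H t; move/negP; rewrite negbK.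
by have := uniq_leq_size uL sL; rewrite size_map size_iota ltnn.
Qed.

Lemma poly_infinite_roots (q : {poly K}) (s : seq K) :
  (forall t, t \notin s -> q.[t] = 0) -> q = 0.
Proof.
move=> H; apply/eqP; apply/negPn/negP => q0.
pose L := [seq i%:R | i <- iota 0 (size q + size s)] : seq K.
have uL : uniq L.
  by rewrite map_inj_uniq ?iota_uniq // => i j /eqP; rewrite eqr_nat => /eqP.
have H1 : (count (predC (mem s)) L < size q)%N.
  rewrite -size_filter; apply: max_poly_roots q0 _ _; last by rewrite filter_uniq.
  by apply/allP => t; rewrite mem_filter => /andP[/H/eqP].
have H2 : (count (mem s) L <= size s)%N.
  rewrite -size_filter; apply: uniq_leq_size; first by rewrite filter_uniq.
  by move=> t; rewrite mem_filter => /andP[].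
have := count_predC (mem s) L; rewrite size_map size_iota; lia.
Qed.

Definition curve p : set 'rV[K]_n := [set curve_pt p t | t in setT].

Lemma vanishing_along p f :
  (forall x, curve p x -> eval_at f x = 0) -> along p f = 0.
Proof.
by move=> H; apply: (@poly_infinite_roots _ [::]) => t _; rewrite along_eval H //; exists t.
Qed.

(** A polynomial that vanishes at infinitely many points of the curve vanishes on the
    whole curve. *)
Lemma closed_curve p A : zariski_closed A -> curve p `<=` A \/
  exists s : seq K, forall t, A (curve_pt p t) -> t \in s.
Proof.
case=> S ->; case: (pselect (exists2 f, S f & along p f != 0)) => [[f Sf f0]|H].
  right; have [s Hs] : exists s : seq K, forall t, root (along p f) t -> t \in s.
    apply: contrapT => /forallNP H; move/negP: f0; apply.
    have E m : exists L : seq K, [/\ size L = m, uniq L & all (root (along p f)) L].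
      elim: m => [|m [L [sL uL rL]]]; first by exists [::].
      have [t] : exists t, ~ (root (along p f) t -> t \in L).
        by apply/existsNP; exact: H.
      by case/not_implyP => rt /negP tL; exists (t :: L); rewrite /= sL tL rt.
    have [L [sL uL rL]] := E (size (along p f)).
    by apply/eqP; apply: (roots_geq_poly_eq0 rL); rewrite ?sL.
  exists s => t At; apply: Hs; apply/rootP; rewrite along_eval.
  exact: At f Sf.
left=> _ [t _ <-] f Sf; rewrite -along_eval.
have [->|f0] := eqVneq (along p f) 0; first by rewrite horner0.
by case: H; exists f.
Qed.

(** Two finite sets do not cover the parameter line. *)
Lemma curve_irreducible p : zariski_irreducible (curve p).
Proof.
split; first by exists (curve_pt p 0); exists 0.
move=> A B cA cB sub.
case: (closed_curve p cA) => [|[s Hs]]; first by left.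
case: (closed_curve p cB) => [|[u Hu]]; first by right.
have [t] := exists_notin (s ++ u); rewrite mem_cat negb_or => /andP[ts tu].
have [/Hs st|/Hu ut] := sub (curve_pt p t) (ex_intro2 _ _ t I erefl).
  by rewrite st in ts.
by rewrite ut in tu.
Qed.

(** The products of the equations. *)
Lemma closedU A B : zariski_closed A -> zariski_closed B ->
  zariski_closed (A `|` B : set 'rV[K]_n).
Proof.
case=> S -> [T ->]; exists [set h | exists f g, [/\ S f, T g & h = f * g]].
apply/seteqP; split=> [x [H|H] _ [f [g [Sf Tg ->]]]|x H].
- by rewrite evalM (H f Sf) mul0r.
- by rewrite evalM (H g Tg) mulr0.
case: (pselect (zero_locus S x)) => [|nS]; [by left | right=> g Tg].
have [f Sf fx] : exists2 f, S f & eval_at f x <> 0.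
  by apply: contrapT => H'; apply: nS => f Sf; apply: contrapT => fx; apply: H'; exists f.
have /eqP := H (f * g) (ex_intro _ f (ex_intro _ g (And3 Sf Tg erefl))).
by rewrite evalM mulf_eq0 => /orP[/eqP|/eqP].
Qed.

Lemma closed_point x : zariski_closed [set x].
Proof.
exists [set h | exists i, h = mvar i - mconst (x 0 i)].
apply/seteqP; split=> [_ -> _ [i ->]|y H].
  by rewrite evalB eval_var eval_const subrr.
apply/rowP => i; apply/eqP; rewrite -subr_eq0 -[y 0 i]eval_var.
rewrite -[X in _ - X](eval_const _ y) -evalB; apply/eqP; apply: H; by exists i.
Qed.

Lemma irreducible_point x : zariski_irreducible [set x].
Proof.
split; first by exists x.
by move=> A B _ _ sub; have [Ax|Bx] := sub x erefl; [left|right] => _ ->.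
Qed.

Lemma closed_empty : zariski_closed (set0 : set 'rV[K]_n).
Proof.
exists [set mconst 1]; apply/seteqP; split=> // x /(_ _ erefl).
by rewrite eval_const => /eqP; rewrite oner_eq0.
Qed.

Lemma closed_finite (L : seq 'rV[K]_n) : zariski_closed [set x | x \in L].
Proof.
elim: L => [|a L IH].
  by rewrite (_ : [set x | _] = set0); [exact: closed_empty | apply/seteqP; split].
rewrite (_ : [set x | _] = [set a] `|` [set x | x \in L]).
  by apply: closedU IH; exact: closed_point.
apply/seteqP; split=> x /=; rewrite inE.
  by move=> /orP[/eqP|]; [left|right].
by case=> [->|->]; rewrite ?eqxx ?orbT.
Qed.

Lemma irreducible_finite Z (L : seq 'rV[K]_n) : zariski_irreducible Z ->
  (forall x, Z x -> x \in L) -> exists a, Z `<=` [set a].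
Proof.
case=> -[z Zz] irr; elim: L => [|a L IH] H; first by have := H z Zz.
have [|Za|ZL] := irr [set a] [set x | x \in L] (closed_point a) (closed_finite L).
- by move=> x /H; rewrite inE => /orP[/eqP ->|]; [left|right].
- by exists a.
- by apply: IH => x /ZL.
Qed.

(** An irreducible closed subset of the union is contained in one of the curves, and a
    proper closed subset of a curve is finite, hence a point if it is irreducible. *)
Lemma curve_chain p1 p2 p3 x d :
  zariski_closed (curve p1) -> zariski_closed (curve p2) -> zariski_closed (curve p3) ->
  irreducible_chain (curve p1 `|` curve p2 `|` curve p3) x d -> (d <= 1)%N.
Proof.
move=> c1 c2 c3 [Z [_ Hirr Hlt]]; rewrite leqNgt; apply/negP => d2.
have [cl0 irr0 _] := Hirr 0%N isT.
have [cl1 irr1 _] := Hirr 1%N (ltnW d2).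
have [_ [_ irr2] sub2] := Hirr 2%N d2.
have [_ Z10] := Hlt 0%N (ltnW d2); have [Z12 Z21] := Hlt 1%N d2.
have [p Hp] : exists p, Z 2%N `<=` curve p.
  have [H|H] := irr2 _ _ (closedU c1 c2) c3 sub2; last by exists p3.
  by have [H'|H'] := irr2 _ _ c1 c2 H; [exists p1 | exists p2].
case: (closed_curve p cl1) => [H|[s Hs]].
  by apply: Z21 => y /Hp; apply: H.
have [|a Za] := @irreducible_finite (Z 1%N) [seq curve_pt p t | t <- s] irr1.
  by move=> y Zy; have [t _ E] := Hp _ (Z12 y Zy); rewrite -E map_f // Hs // E.
have [[z Zz] _] := irr0; apply: Z10 => y Zy.
have [Z01 _] := Hlt 0%N (ltnW d2).
by rewrite (Za y Zy) -(Za z (Z01 z Zz)).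
Qed.

Lemma curve_chain1 p t (X : set 'rV[K]_n) : zariski_closed (curve p) ->
  curve p `<=` X -> (exists u, curve_pt p u <> curve_pt p t) ->
  irreducible_chain X (curve_pt p t) 1.
Proof.
move=> cp sub [u pu]; exists (fun i => if i is 0%N then [set curve_pt p t] else curve p).
split=> // [[|i] _|[|i] //].
- split; [exact: closed_point | exact: irreducible_point |].
  by move=> _ ->; apply: sub; exists t.
- by split=> //; exact: curve_irreducible.
- move=> _; split; first by move=> _ ->; exists t.
  by move=> /(_ (curve_pt p u) (ex_intro2 _ _ u I erefl)).
Qed.

(** A polynomial that vanishes on the curve has a zero restriction to it, and the
    derivative of this restriction is the derivative along the velocity. *)
Lemma tangent_vel p t (X : set 'rV[K]_n) c : curve p `<=` X ->
  tangent_space X (curve_pt p t) (c *: curve_vel p t).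
Proof.
move=> sub f Hf; have H : along p f = 0.
  by apply: vanishing_along => x /sub; exact: Hf.
have := along_deriv p f t; rewrite H deriv0 horner0 => E.
transitivity (c * directional f (curve_pt p t) (curve_vel p t)).
  by rewrite mulr_sumr; apply: eq_bigr => i _; rewrite [X in _ * X]mxE mulrCA.
by rewrite -E mulr0.
Qed.

(** Where h does not vanish, the equations of Y become equations of X after
    multiplication by h, with the same differential at x up to the factor h(x). *)
Lemma tangent_locally (X Y : set 'rV[K]_n) h x v f :
  (forall y, X y -> Y y \/ eval_at h y = 0) -> eval_at h x != 0 ->
  vanishing_ideal Y f -> eval_at f x = 0 -> tangent_space X x v ->
  directional f x v = 0.
Proof.
move=> XY hx fY fx /(_ (h * f)) H.
have : directional (h * f) x v = 0.
  apply: H => y /XY[Yy|hy]; rewrite evalM; first by rewrite (fY y Yy) mulr0.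
  by rewrite hy mul0r.
by rewrite directionalM fx mulr0 add0r => /eqP; rewrite mulf_eq0 (negPf hx) => /eqP.
Qed.

End AlgebraicCurves.

(** * Singular points *)

Section SignCurves.
Variable R : realType.
Notation K := (Cplx R).
Implicit Types (a b d c t : K) (x v : 'rV[K]_5).

(** The common form of V1, V2 and V3. *)
Definition sign_curve a b d c : 'I_5 -> {poly K} := fun i =>
  [:: 'X; a *: 'X; b *: 'X; d *: 'X; 'X^2 - c *: 'X]`_i.

Lemma sign_curve_pt a b d c t : curve_pt (sign_curve a b d c) t =
  point5 t (a * t) (b * t) (d * t) (t ^+ 2 - c * t).
Proof.
apply/rowP => i; rewrite !mxE /sign_curve.
by case: i => -[|[|[|[|[|//]]]]] i /=; rewrite !hornerE.
Qed.

Lemma sign_curve_vel a b d c t : curve_vel (sign_curve a b d c) t =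
  point5 1 a b d (2 * t - c).
Proof.
apply/rowP => i; rewrite !mxE /sign_curve.
by case: i => -[|[|[|[|[|//]]]]] i /=;
  rewrite ?(derivB, derivXn, derivZ, derivX) !hornerE ?mulr1 //=; ring.
Qed.

Lemma forall_ord5 (P : 'I_5 -> Prop) :
  P (inord 0) -> P (inord 1) -> P (inord 2) -> P (inord 3) -> P (inord 4) ->
  forall i : 'I_5, P i.
Proof.
move=> P0 P1 P2 P3 P4 [[|[|[|[|[|//]]]]] i].
- by rewrite (_ : Ordinal i = inord 0) //; apply: val_inj; rewrite /= inordK.
- by rewrite (_ : Ordinal i = inord 1) //; apply: val_inj; rewrite /= inordK.
- by rewrite (_ : Ordinal i = inord 2) //; apply: val_inj; rewrite /= inordK.
- by rewrite (_ : Ordinal i = inord 3) //; apply: val_inj; rewrite /= inordK.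
- by rewrite (_ : Ordinal i = inord 4) //; apply: val_inj; rewrite /= inordK.
Qed.

Lemma point5_coord (T0 T1 T2 T3 B : K) :
  let y := point5 T0 T1 T2 T3 B in
  [/\ y 0 (inord 0) = T0, y 0 (inord 1) = T1, y 0 (inord 2) = T2,
      y 0 (inord 3) = T3 & y 0 (inord 4) = B].
Proof. by move=> y; rewrite /y !mxE !inordK. Qed.

Lemma row5_eq x (T0 T1 T2 T3 B : K) :
  x 0 (inord 0) = T0 -> x 0 (inord 1) = T1 -> x 0 (inord 2) = T2 ->
  x 0 (inord 3) = T3 -> x 0 (inord 4) = B -> x = point5 T0 T1 T2 T3 B.
Proof.
have [E0 E1 E2 E3 E4] := point5_coord T0 T1 T2 T3 B.
move=> H0 H1 H2 H3 H4; apply/rowP; apply: forall_ord5.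
- by rewrite H0 E0. - by rewrite H1 E1. - by rewrite H2 E2.
- by rewrite H3 E3. - by rewrite H4 E4.
Qed.

Definition ratio_eq (i : nat) a : mpoly 5 K :=
  mvar R (inord i) - mconst 5 a * mvar R (inord 0).

Definition parabola_eq c : mpoly 5 K :=
  mvar R (inord 4) - (mvar R (inord 0) * mvar R (inord 0) - mconst 5 c * mvar R (inord 0)).

Lemma eval_ratio i a x : eval_at (ratio_eq i a) x = x 0 (inord i) - a * x 0 (inord 0).
Proof. by rewrite evalB evalM eval_const !eval_var. Qed.

Lemma eval_parabola c x : eval_at (parabola_eq c) x =
  x 0 (inord 4) - (x 0 (inord 0) ^+ 2 - c * x 0 (inord 0)).
Proof. by rewrite !(evalB, evalM) eval_const !eval_var. Qed.

Lemma directional_ratio i a x v : directional (ratio_eq i a) x v =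
  v 0 (inord i) - a * v 0 (inord 0).
Proof.
rewrite directionalB directionalM directional_const !directional_var.
by rewrite eval_const mul0r add0r.
Qed.

Lemma directional_parabola c x v : directional (parabola_eq c) x v =
  v 0 (inord 4) - (2 * x 0 (inord 0) - c) * v 0 (inord 0).
Proof.
rewrite !directionalB !directionalM directional_const !directional_var.
by rewrite eval_const !eval_var; ring.
Qed.

Lemma sign_curve_vanishing a b d c i s : (i, s) \in [:: (1%N, a); (2%N, b); (3%N, d)] ->
  vanishing_ideal (curve (sign_curve a b d c)) (ratio_eq i s).
Proof.
move=> H y [t _ <-]; rewrite sign_curve_pt eval_ratio.
have [E0 E1 E2 E3 _] := point5_coord t (a * t) (b * t) (d * t) (t ^+ 2 - c * t).
move: H; rewrite !inE => /or3P[] /eqP[-> ->]; rewrite ?E1 ?E2 ?E3 E0 subrr //.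
Qed.

Lemma sign_curve_parabola a b d c :
  vanishing_ideal (curve (sign_curve a b d c)) (parabola_eq c).
Proof.
move=> y [t _ <-]; rewrite sign_curve_pt eval_parabola.
have [E0 _ _ _ E4] := point5_coord t (a * t) (b * t) (d * t) (t ^+ 2 - c * t).
by rewrite E0 E4 subrr.
Qed.

Lemma sign_curve_closed a b d c : zariski_closed (curve (sign_curve a b d c)).
Proof.
exists [set f | f = parabola_eq c \/
  exists i s, (i, s) \in [:: (1%N, a); (2%N, b); (3%N, d)] /\ f = ratio_eq i s].
apply/seteqP; split=> x.
  move=> Hx f [->|[i [s [H ->]]]]; first exact: sign_curve_parabola Hx.
  exact: sign_curve_vanishing H x Hx.
move=> H; exists (x 0 (inord 0)) => //; rewrite sign_curve_pt; symmetry.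
have r i s : (i, s) \in [:: (1%N, a); (2%N, b); (3%N, d)] ->
    x 0 (inord i) = s * x 0 (inord 0).
  move=> is_; apply/eqP; rewrite -subr_eq0 -eval_ratio; apply/eqP.
  by apply: H; right; exists i, s.
apply: row5_eq => //.
- by apply: r; rewrite !inE eqxx.
- by apply: r; rewrite !inE eqxx orbT.
- by apply: r; rewrite !inE eqxx !orbT.
by apply/eqP; rewrite -subr_eq0 -eval_parabola; apply/eqP; apply: H; left.
Qed.

Section Union.
Variables (p1 p2 p3 : 'I_5 -> {poly K}).
Hypotheses (cl1 : zariski_closed (curve p1)) (cl2 : zariski_closed (curve p2))
  (cl3 : zariski_closed (curve p3)).
Let X := curve p1 `|` curve p2 `|` curve p3.

Lemma union_local_dim a b d c t : curve (sign_curve a b d c) `<=` X ->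
  local_dim X (curve_pt (sign_curve a b d c) t) 1.
Proof.
move=> sub; split; last by move=> e; exact: curve_chain.
apply: curve_chain1 sub _; first exact: sign_curve_closed.
exists (t + 1); rewrite !sign_curve_pt => /rowP /(_ (inord 0)).
have [-> _ _ _ _] := point5_coord t (a * t) (b * t) (d * t) (t ^+ 2 - c * t).
rewrite !mxE inordK //= => /eqP.
by rewrite addrC -subr_eq0 addrK oner_eq0.
Qed.

(** Away from the other curves, the equations of one curve cut out the union, so that
    the tangent space is the line spanned by the velocity. *)
Lemma sign_curve_nonsingular a b d c t h : curve (sign_curve a b d c) `<=` X ->
  (forall y, X y -> curve (sign_curve a b d c) y \/ eval_at h y = 0) ->
  eval_at h (curve_pt (sign_curve a b d c) t) != 0 ->
  ~ singular_point X (curve_pt (sign_curve a b d c) t).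
Proof.
set p := sign_curve a b d c; set x := curve_pt p t.
move=> sub Xh hx [_]; apply; exists 1%N, (curve_vel p t).
split; first exact: union_local_dim.
  rewrite /row_free eqn_leq rank_leq_row lt0n mxrank_eq0.
  apply/eqP => /rowP /(_ (inord 0)); rewrite sign_curve_vel !mxE inordK //=.
  by move/eqP; rewrite oner_eq0.
apply/seteqP; split=> v.
  move=> Tv; apply/sub_rVP; exists (v 0 (inord 0)); rewrite sign_curve_vel.
  have cx : curve p x by exists t.
  have rv i s : (i, s) \in [:: (1%N, a); (2%N, b); (3%N, d)] ->
      v 0 (inord i) = s * v 0 (inord 0).
    move=> is_; have van := @sign_curve_vanishing a b d c _ _ is_.
    have := tangent_locally Xh hx van (van x cx) Tv.
    by rewrite directional_ratio => /eqP; rewrite subr_eq0 => /eqP.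
  have pv : v 0 (inord 4) = (2 * t - c) * v 0 (inord 0).
    have van := @sign_curve_parabola a b d c.
    have := tangent_locally Xh hx van (van x cx) Tv.
    rewrite directional_parabola /x sign_curve_pt.
    have [-> _ _ _ _] := point5_coord t (a * t) (b * t) (d * t) (t ^+ 2 - c * t).
    by move/eqP; rewrite subr_eq0 => /eqP.
  have [E0 E1 E2 E3 E4] := point5_coord 1 a b d (2 * t - c).
  apply/rowP; apply: forall_ord5; rewrite [RHS]mxE ?E0 ?E1 ?E2 ?E3 ?E4 mulrC ?mul1r //.
  - by apply: rv; rewrite !inE eqxx.
  - by apply: rv; rewrite !inE eqxx orbT.
  - by apply: rv; rewrite !inE eqxx !orbT.
by move=> /sub_rVP[k ->]; exact: tangent_vel.
Qed.

(** Two velocities that are not proportional do not fit into a tangent line. *)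
Lemma crossing_singular a b d c a' b' d' c' : a != a' ->
  curve (sign_curve a b d c) `<=` X -> curve (sign_curve a' b' d' c') `<=` X ->
  singular_point X (0 : 'rV[K]_5).
Proof.
move=> aa sub sub'.
have zero e f g h : curve_pt (sign_curve e f g h) 0 = 0.
  rewrite sign_curve_pt; symmetry; apply: row5_eq; rewrite mxE ?mulr0 //.
  by rewrite expr0n subr0.
split; first by apply: sub; exists 0.
case=> dm [A [[chn dmax] _ TA]].
have d1 : (1 <= dm)%N.
  by apply: dmax; rewrite -(zero a b d c); case: (union_local_dim 0 sub).
have d1' : (dm <= 1)%N := curve_chain cl1 cl2 cl3 chn.
have v1 : (curve_vel (sign_curve a b d c) 0 <= A)%MS.
  have := tangent_vel 0 1 sub; rewrite zero scale1r TA; exact.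
have v2 : (curve_vel (sign_curve a' b' d' c') 0 <= A)%MS.
  have := tangent_vel 0 1 sub'; rewrite zero scale1r TA; exact.
have dm1 : dm = 1%N by apply/eqP; rewrite eqn_leq d1' d1.
move: A TA v1 v2; rewrite dm1 => A _ /sub_rVP[k1 H1] /sub_rVP[k2 H2].
rewrite sign_curve_vel in H1; rewrite sign_curve_vel in H2.
have [E0 E1 _ _ _] := point5_coord 1 a b d (2 * 0 - c).
have [E0' E1' _ _ _] := point5_coord 1 a' b' d' (2 * 0 - c').
rewrite H1 !mxE in E0 E1; rewrite H2 !mxE in E0' E1'.
have k12 : k1 = k2.
  have A0 : A 0 (inord 0) != 0 by apply: contra_eq_neq E0 => ->; rewrite mulr0 eq_sym oner_neq0.
  by apply: (mulIf A0); rewrite E0 E0'.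
by move: aa; rewrite -E1 -E1' k12 eqxx.
Qed.

End Union.

End SignCurves.

Section Main.
Variables (R : realType) (tau : Cplx R).
Notation K := (Cplx R).

Let q1 := sign_curve 1 (-1) (-1) (eta tau 2).
Let q2 := sign_curve (-1) 1 (-1) (eta tau 1).
Let q3 := sign_curve (-1) (-1) 1 (0 : K).

Lemma V1E : V1 tau = curve q1.
Proof.
by apply/seteqP; split=> x [T]; [move=> ->|move=> _ <-]; exists T => //;
  rewrite sign_curve_pt !mulN1r mul1r.
Qed.

Lemma V2E : V2 tau = curve q2.
Proof.
by apply/seteqP; split=> x [T]; [move=> ->|move=> _ <-]; exists T => //;
  rewrite sign_curve_pt !mulN1r mul1r.
Qed.

Lemma V3E : V3 R = curve q3.
Proof.
by apply/seteqP; split=> x [T]; [move=> ->|move=> _ <-]; exists T => //;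
  rewrite sign_curve_pt !mulN1r mul1r mul0r subr0.
Qed.

Lemma sum_form_zero (i : nat) (a b d c : K) : (i, - 1) \in [:: (1%N, a); (2%N, b); (3%N, d)] ->
  forall y : 'rV[K]_5, curve (sign_curve a b d c) y -> eval_at (ratio_eq i (-1)) y = 0.
Proof. by move=> H y; exact: sign_curve_vanishing. Qed.

Lemma sum_form_neq0 (i : nat) (a b d c t : K) : t != 0 ->
  (i, 1) \in [:: (1%N, a); (2%N, b); (3%N, d)] ->
  eval_at (ratio_eq i (-1)) (curve_pt (sign_curve a b d c) t) != 0.
Proof.
move=> t0 H; rewrite sign_curve_pt eval_ratio.
have [-> E1 E2 E3 _] := point5_coord t (a * t) (b * t) (d * t) (t ^+ 2 - c * t).
have -> : point5 t (a * t) (b * t) (d * t) (t ^+ 2 - c * t) 0 (inord i) = t.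
  by move: H; rewrite !inE => /or3P[] /eqP[-> e]; rewrite ?E1 ?E2 ?E3 -e mul1r.
by rewrite mulN1r opprK -mulr2n mulrn_eq0.
Qed.

(** The form T_0 + T_i vanishes on the two curves whose i-th sign is minus, and on the
    third one only at the origin. *)
Lemma singular_union :
  [set x | singular_point (curve q1 `|` curve q2 `|` curve q3) x] = [set 0].
Proof.
have c1 : zariski_closed (curve q1) by exact: sign_curve_closed.
have c2 : zariski_closed (curve q2) by exact: sign_curve_closed.
have c3 : zariski_closed (curve q3) by exact: sign_curve_closed.
set X := _ `|` _.
have s1 : curve q1 `<=` X by move=> y; left; left.
have s2 : curve q2 `<=` X by move=> y; left; right.
have s3 : curve q3 `<=` X by move=> y; right.
apply/seteqP; split=> x; last first.
  move=> ->; apply: (crossing_singular c1 c2 c3 _ s1 s2).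
  by rewrite -subr_eq0 opprK -mulr2n mulrn_eq0 oner_eq0.
move=> /= sing; apply: contrapT => x0.
have nz a b d c t : x = curve_pt (sign_curve a b d c) t -> t != 0.
  move=> E; apply/eqP => t0; apply: x0; rewrite E t0 sign_curve_pt.
  by symmetry; apply: row5_eq; rewrite mxE ?mulr0 // expr0n subr0.
case: (sing) => Xx _; case: Xx => [[[t _ E]|[t _ E]]|[t _ E]]; have t0 := nz _ _ _ _ _ (esym E);
  move: sing; rewrite -E.
- apply: (sign_curve_nonsingular (h := ratio_eq 1 (-1)) c1 c2 c3 s1).
    move=> y [[|]|]; [by left | |]; move=> H; right;
      by apply: sum_form_zero H; rewrite !inE eqxx ?orbT.
  by apply: sum_form_neq0 => //; rewrite !inE eqxx ?orbT.
- apply: (sign_curve_nonsingular (h := ratio_eq 2 (-1)) c1 c2 c3 s2).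
    move=> y [[|]|]; [|by left|]; move=> H; right;
      by apply: sum_form_zero H; rewrite !inE eqxx ?orbT.
  by apply: sum_form_neq0 => //; rewrite !inE eqxx ?orbT.
- apply: (sign_curve_nonsingular (h := ratio_eq 3 (-1)) c1 c2 c3 s3).
    move=> y [[|]|]; [| |by left]; move=> H; right;
      by apply: sum_form_zero H; rewrite !inE eqxx ?orbT.
  by apply: sum_form_neq0 => //; rewrite !inE eqxx ?orbT.
Qed.

End Main.

Theorem lemma2p1 (R : realType) (tau : Cplx R) (htau : 0 < complex.Im tau) :
  AP tau = V1 tau `|` V2 tau `|` V3 R /\
  [set x | singular_point (AP tau) x] = [set 0].
Proof.
rewrite AP_union //; split=> //.
by rewrite (V1E tau) (V2E tau) (V3E R) singular_union.
Qed.
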